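(* Let $X:M^n\looparrowright\mathbb{R}^{n+p}_{p}$ be a complete spacelike self-shrinker with $\|X^\perp\|^2<2p$ on $M^n$. Let $r$ be the distance function on $M^n$ from a fixed point $x_0\in M$. Assume that there are constants $C>0$, $\varepsilon>0$ and $\rho_0>0$ such that the second fundamental form $A$ satisfies $$|A|\leq\frac{C}{r^{1+\varepsilon}}\quad\text{and}\quad \rho_0\geq\left(\frac{C_0}{\varepsilon}\right)^{1/\varepsilon},\qquad C_0=\sqrt{2p}\,C,$$ where the bound on $|A|$ is required at all points where $r>0$. Then $M^n$ is an $n$-dimensional spacelike hyperplane of $\mathbb{R}^{n+p}_{p}$.
   Context: $\mathbb{R}^{n+p}_{p}$ is the linear space $\mathbb{R}^{n+p}$ endowed with the indefinite flat metric $\langle\,,\rangle=\sum_{i=1}^{n}(dx_i)^2-\sum_{\alpha=n+1}^{n+p}(dx_\alpha)^2$. A spacelike submanifold $X:M^n\looparrowright\mathbb{R}^{n+p}_p$ is a smooth immersion of a connected $n$-dimensional manifold whose induced metric is Riemannian (positive definite); its normal bundle is then negative definite. It is complete if the induced Riemannian metric is complete, and $r$ is the distance of that metric. Choose local orthonormal frames $\{e_i\}_{1\le i\le n}$ of $TM$ (spacelike) and $\{e_\alpha\}_{n+1\le\alpha\le n+p}$ of $TM^\perp$ (timelike, $\langle e_\alpha,e_\beta\rangle=-\delta_{\alpha\beta}$). The second fundamental form $A$ has values $A_{ij}=(\overline{\nabla}_{e_i}e_j)^\perp=\sum_\alpha h^\alpha_{ij}e_\alpha$, where $\overline{\nabla}$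 is the flat connection of $\mathbb{R}^{n+p}_p$, and the (non-normalized) mean curvature vector is $\vec{H}=\sum_\alpha\left(\sum_k h^\alpha_{kk}\right)e_\alpha$. For normal (timelike) quantities norms are taken to be nonnegative: $|A|^2=\sum_{i,j,\alpha}(h^\alpha_{ij})^2$ and $\|X^\perp\|^2=-\langle X^\perp,X^\perp\rangle$, where $X^\perp$ is the normal part of the position vector $X$. $M^n$ is a spacelike self-shrinker if $\vec{H}=-\frac12X^\perp$. ''$M^n$ is an $n$-dimensional spacelike hyperplane of $\mathbb{R}^{n+p}_p$'' means that $X(M)$ is an $n$-dimensional affine plane of $\mathbb{R}^{n+p}_p$ on which the metric is positive definite. *)

(* Defs.v *)
From mathcomp Require Import all_boot all_order all_algebra.
From mathcomp Require Import all_classical all_reals all_analysis.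

Set Implicit Arguments.
Unset Strict Implicit.
Unset Printing Implicit Defensive.

Import Order.TTheory GRing.Theory Num.Theory.
Import numFieldNormedType.Exports.

Local Open Scope classical_set_scope.
Local Open Scope ring_scope.

(* The flat metric of R^{n+p}_p: the first n coordinates are spacelike, the
   last p coordinates timelike. *)
Definition inner (R : realType) (n p : nat) (x y : 'rV[R]_(n + p)) : R :=
  \sum_(i < n) x ord0 (lshift p i) * y ord0 (lshift p i)
  - \sum_(a < p) x ord0 (rshift n a) * y ord0 (rshift n a).

(* C^k and C^infinity maps on a set U, which is open wherever this is used, so
   that the directional derivatives at the points of U only depend on f on U. *)
Fixpoint Ck_on (R : realType) (V W : normedModType R) (k : nat) (U : set V)
    (f : V -> W) : Prop :=
  {within U, continuous f} /\
  (if k is k'.+1 then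
     forall v, (forall x, U x -> derivable f x v) /\ Ck_on k' U ('D_v f)
   else True).

Definition smooth_on (R : realType) (V W : normedModType R) (U : set V)
    (f : V -> W) : Prop :=
  forall k, Ck_on k U f.

Record chart (R : realType) (n : nat) (M : topologicalType) := Chart {
  chart_dom : set M ;
  chart_map :> M -> 'rV[R]_n ;
  chart_inv : 'rV[R]_n -> M ;
  chart_dom_open : open chart_dom ;
  chart_img_open : open (chart_map @` chart_dom) ;
  chart_map_continuous : {within chart_dom, continuous chart_map} ;
  chart_inv_continuous : {within chart_map @` chart_dom, continuous chart_inv} ;
  chart_mapK : forall x, chart_dom x -> chart_inv (chart_map x) = x
}.

Record smooth_manifold (R : realType) (n : nat) := SmoothManifold {
  carrier :> topologicalType ;
  atlas : set (chart R n carrier) ;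
  manifold_hausdorff : hausdorff_space carrier ;
  manifold_second_countable : @second_countable carrier ;
  atlas_cover : forall x : carrier, exists2 c, atlas c & chart_dom c x ;
  atlas_compatible : forall c d, atlas c -> atlas d ->
    smooth_on (c @` (chart_dom c `&` chart_dom d)) (d \o chart_inv c)
}.

Section Submanifolds.
Variables (R : realType) (n p : nat) (M : smooth_manifold R n).
Local Notation E := 'rV[R]_(n + p).
Implicit Types (X W : M -> E) (x y : M) (t w z : E).

Definition smooth_map_on (O : set M) W : Prop :=
  forall c, atlas c ->
    smooth_on (c @` (chart_dom c `&` O)) (W \o chart_inv c).

(* dW_x applied to the tangent vector with coordinates v in the chart c *)
Definition chart_diff (c : chart R n M) W x (v : 'rV[R]_n) : E :=
  'D_v (W \o chart_inv c) (c x).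

Definition immersion X : Prop :=
  smooth_map_on setT X /\
  forall c x, atlas c -> chart_dom c x -> injective (chart_diff c X x).

(* the image of dX_x *)
Definition tangent_space X x : set E :=
  [set w | exists c v, [/\ atlas c, chart_dom c x & w = chart_diff c X x v]].

Definition normal_space X x : set E :=
  [set z | forall w, tangent_space X x w -> inner z w = 0].

Definition spacelike X : Prop :=
  forall x w, tangent_space X x w -> w != 0 -> 0 < inner w w.

(* [get P] is the element satisfying P, when it is unique; for a spacelike
   immersion E is the direct sum of the tangent and the normal space. *)
Definition normal_part X x w : E :=
  get [set z | normal_space X x z /\ tangent_space X x (w - z)].

(* The flat connection of the ambient space: the derivative of the E-valued
   field W on M in the direction of the tangent vector t = dX_x(v). *)
Definition flat_connection X W x t : E :=
  get [set z | exists c v, [/\ atlas c, chart_dom c x,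
                               t = chart_diff c X x v &
                               z = chart_diff c W x v]].

Definition tangent_extension X x w W : Prop :=
  exists O : set M, [/\ open O, O x, smooth_map_on O W,
    (forall y, O y -> tangent_space X y (W y)) & W x = w].

(* A(t, w) is the normal part of the derivative along t of any local tangent
   field extending w. *)
Definition second_fundamental_form X x t w : E :=
  get [set z | exists2 W, tangent_extension X x w W &
                          z = normal_part X x (flat_connection X W x t)].

Definition adapted_frame X x (e : ('I_n -> E) * ('I_p -> E)) : Prop :=
  [/\ forall i, tangent_space X x (e.1 i),
      forall a, normal_space X x (e.2 a),
      forall i j, inner (e.1 i) (e.1 j) = (i == j)%:R &
      forall a b, inner (e.2 a) (e.2 b) = - (a == b)%:R].

(* A choice of orthonormal tangent and normal frames at x; the quantities
   below do not depend on it. *)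
Definition frame X x : ('I_n -> E) * ('I_p -> E) :=
  get [set e | adapted_frame X x e].

(* The sign comes from <e_a, e_b> = - delta_ab: this makes
   A(e_i, e_j) = \sum_a h^a_ij e_a. *)
Definition sff_coef X x (a : 'I_p) (i j : 'I_n) : R :=
  - inner (second_fundamental_form X x ((frame X x).1 i) ((frame X x).1 j))
          ((frame X x).2 a).

Definition sff_norm X x : R :=
  Num.sqrt (\sum_(i < n) \sum_(j < n) \sum_(a < p) sff_coef X x a i j ^+ 2).

Definition mean_curvature X x : E :=
  \sum_(a < p) (\sum_(k < n) sff_coef X x a k k) *: (frame X x).2 a.

Definition self_shrinker X : Prop :=
  forall x, mean_curvature X x = - 2%:R^-1 *: normal_part X x (X x).

Definition normal_position_sqnorm X x : R :=
  - inner (normal_part X x (X x)) (normal_part X x (X x)).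

Definition smooth_curve (g : R -> M) : Prop :=
  exists O : set R, [/\ open O, `[0, 1] `<=` O, {within O, continuous g} &
    forall c, atlas c ->
      smooth_on (O `&` g @^-1` chart_dom c : set R^o) (c \o g : R^o -> _)].

Definition curve_length X (g : R -> M) : R :=
  \int[lebesgue_measure]_(t in `[0, 1])
    Num.sqrt (inner (derive1 (X \o g) t) (derive1 (X \o g) t)).

(* A piecewise smooth curve from x to y, given by its successive smooth
   pieces, each of them parametrized by [0, 1]. *)
Fixpoint piecewise_smooth (s : seq (R -> M)) x y : Prop :=
  if s is g :: s' then
    [/\ smooth_curve g, g 0 = x & piecewise_smooth s' (g 1) y]
  else x = y.

Definition distance X x y : R :=
  inf [set l | exists2 s, piecewise_smooth s x y &
                          l = \sum_(g <- s) curve_length X g].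

Definition complete_submanifold X : Prop :=
  forall u : nat -> M,
    (forall e, 0 < e -> exists N, forall i j, (N <= i)%N -> (N <= j)%N ->
       distance X (u i) (u j) < e) ->
    exists y, forall e, 0 < e -> exists N, forall i, (N <= i)%N ->
      distance X (u i) y < e.

(* The image of X is an n-dimensional affine plane on which the metric is
   positive definite. *)
Definition spacelike_hyperplane X : Prop :=
  exists (q : E) (P : {vspace E}),
    [/\ \dim P = n, (forall w, w \in P -> w != 0 -> 0 < inner w w) &
        range X = [set q + w | w in [set w | w \in P]]].

End Submanifolds.

(* Main.v *)
(** Let F be the spacelike part of X, i.e. its first n coordinates. Since the
    tangent spaces are spacelike, F is a local diffeomorphism and lifts of
    segments of R^n are at most as long as the segments; by completeness they
    never end, so F has a global section and X(M) is the graph of a map u whose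
    differential is a strict contraction. The shrinker equation becomes
    g^kl D_k D_l u = (D_x u - u) / 2, with g the induced metric.

    For a point x and a vector t of R^n let
    Phi(x, t) = |D_t u(x) - u(x)|^2 - |x - t|^2 = - <X - V, X - V>, where V is
    the tangent vector with spacelike part t. Then Phi <= ||X^perp||^2 < 2p.
    Differentiating the equation shows that, at a maximum of Phi penalised by a
    small multiple of ln(1 + z), z being the squared distance to the point of the
    graph above 0, Phi is at most a multiple of the penalty. Hence Phi <= 0, and
    t = x gives D_x u = u: u is smooth and homogeneous of degree one, so it is
    linear. *)
Require Import Defs.
From HB Require Import structures.
From mathcomp Require Import all_boot all_order all_algebra.
From mathcomp Require Import all_classical all_reals all_analysis.
From mathcomp Require Import ring lra.

Set Implicit Arguments.
Unset Strict Implicit.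
Unset Printing Implicit Defensive.

Import Order.TTheory GRing.Theory Num.Theory.
Import numFieldNormedType.Exports.

Local Open Scope classical_set_scope.
Local Open Scope ring_scope.

(** * Functions of class C^k *)

(** Phi is controlled by the zeroth order term of the equation. Put N = D_t u - u. Stationarity of
    Phi in t gives N . (D_x u - u) = Phi, so the equation puts Phi / 2 into the traced second
    variation; the drift N . D_x D_t u, which comes from the differentiated equation, is of the
    order of the penalty by stationarity in x. The differentiated equation also contains the
    derivative of the inverse metric, a Hessian term without sign. Moving t by an additional vector
    c reproduces this term in the second variation, and what c changes in the first order terms
    still leaves a sum of squares. The obstacle is that pairs (x, t) range over a noncompact set.
    The bound 2p against an unbounded logarithm confines x, because z grows at least linearly; over
    a ball the metric is uniformly definite, and there Phi > 0 confines t. The logarithm fits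
    because the second order expression in z that appears at the maximum is at most a multiple of 1
    + z. *)

Section LocalDerivatives.
Variables (R : realType) (V W : normedModType R).
Implicit Types (f g : V -> W) (x v : V).

Lemma differentiableP_eps f x : differentiable f x -> forall e : R, 0 < e ->
  \forall h \near 0, `|f (x + h) - f x - 'd f x h| <= e * `|h|.
Proof.
move=> /diff_locally /eqaddoP H e e0; have := H e e0.
by apply: filterS => h; rewrite !fctE /= opprD addrA [h + x]addrC.
Qed.

Lemma differentiable_eps f x (L : {linear V -> W}) : continuous L ->
  (forall e : R, 0 < e ->
    \forall h \near 0, `|f (x + h) - f x - L h| <= e * `|h|) ->
  differentiable f x /\ 'd f x = L :> (V -> W).
Proof.
move=> Lc H.
have E : f \o shift x = cst (f x) + L +o_ 0 id.
  apply/eqaddoP => e e0; have := H e e0.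
  apply: filterS => h /=.
  by rewrite !fctE /= opprD addrA [h + x]addrC.
have dE := diff_unique Lc E.
split=> //; apply/diff_locallyP; split; first by rewrite dE.
by rewrite dE.
Qed.

Lemma near_differentiable f g x : differentiable f x ->
  (\forall y \near x, f y = g y) -> differentiable g x.
Proof.
move=> /[dup] /diff_locallyP [dc E] df fg.
have [] // := @differentiable_eps g x ('d f x) dc.
move=> e e0.
move/eqaddoP : E => /(_ _ e0).
have fg0 : \forall h \near 0, f (h + x) = g (h + x).
  by move: fg; rewrite (near_shift 0 x) /=; apply: filterS => h; rewrite /= subr0.
apply: filterS2 fg0 => h Eh; rewrite !fctE /= Eh opprD addrA [h + x]addrC.
by rewrite (nbhs_singleton fg).
Qed.

(** Both sides have literally the same difference quotient. This carries one-variable rules, such as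
    the mean value theorem and the chain rule, over to directional derivatives. *)
Lemma is_derive_lineP f x v (s : R) (df : W) :
  is_derive s (1 : R) (fun r : R => f (x + r *: v)) df <->
  is_derive (x + s *: v) v f df.
Proof.
have E : (fun h : R => h^-1 *: (f (h *: v + (x + s *: v)) - f (x + s *: v)))
  = (fun h : R => h^-1 *: (((fun r : R => f (x + r *: v)) \o shift s) (h *: (1:R))
       - (fun r : R => f (x + r *: v)) s)).
  apply/funext => h /=; congr (_ *: (f _ - _)).
  by rewrite scalerDl addrCA [h *: (1:R)]mulr1.
split=> -[d1 d2]; apply: DeriveDef.
- by rewrite /derivable E.
- by rewrite /derive E.
- by rewrite /derivable -E.
- by rewrite /derive -E.
Qed.

Lemma is_derive_line f x v (s : R) : derivable f (x + s *: v) v ->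
  is_derive s (1 : R) (fun r : R => f (x + r *: v)) ('D_v f (x + s *: v)).
Proof. by move=> df; apply/is_derive_lineP/derivableP. Qed.

End LocalDerivatives.

Section MeanValue.
Variables (R : realType) (V : normedModType R).
Implicit Types (f : V -> R) (x v : V).

Lemma MVT_line f x v : (forall s : R, 0 <= s <= 1 -> derivable f (x + s *: v) v) ->
  exists2 s : R, 0 < s < 1 & f (x + v) - f x = 'D_v f (x + s *: v).
Proof.
move=> df.
have [||s] := @MVT R (fun r : R => f (x + r *: v))
   (fun r => 'D_v f (x + r *: v)) 0 1 ltr01.
- move=> s; rewrite in_itv /= => /andP[s0 s1].
  by apply: is_derive_line; apply: df; rewrite !ltW.
- apply: derivable_within_continuous => s; rewrite in_itv /= => s01.
  have /is_derive_line [] // := df s s01.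
- rewrite in_itv /= => s01; rewrite scale1r scale0r addr0 subr0 mulr1 => E.
  by exists s.
Qed.
End MeanValue.

Lemma near_continuous (T S : topologicalType) (f g : T -> S) (x : T) :
  (\forall y \near x, f y = g y) -> {for x, continuous f} -> {for x, continuous g}.
Proof.
move=> fg; rewrite /prop_for /continuous_at -(nbhs_singleton fg) => fx.
apply: cvg_trans fx; apply: near_eq_cvg; by apply: filterS fg => y ->.
Qed.

Section Ck.
Variables (R : realType) (V : normedModType R).
Implicit Types (f g : V -> R) (U : set V).

(* Unlike [Ck_on], this asks for Frechet differentiability, which makes the
   closure under composition immediate. *)
Fixpoint Ck (k : nat) U f : Prop :=
  if k is k'.+1 then
    (forall x, U x -> differentiable f x) /\ (forall v, Ck k' U ('D_v f))
  else forall x, U x -> {for x, continuous f}.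

Lemma Ck_differentiable k U f x : Ck k.+1 U f -> U x -> differentiable f x.
Proof. by move=> [+ _]; apply. Qed.

Lemma Ck_derivable k U f x v : Ck k.+1 U f -> U x -> derivable f x v.
Proof. by move=> Hf Ux; apply/diff_derivable/(Ck_differentiable Hf). Qed.

Lemma Ck_derive k U f v : Ck k.+1 U f -> Ck k U ('D_v f).
Proof. by move=> [_]; apply. Qed.

Lemma CkW k U f : Ck k.+1 U f -> Ck k U f.
Proof.
elim: k f => [|k IH] f [df Df] /=.
  by move=> x Ux; apply: differentiable_continuous; exact: df.
by split=> // v; apply: IH.
Qed.

Lemma Ck_continuous k U f x : Ck k U f -> U x -> {for x, continuous f}.
Proof. by elim: k => [|k IH] Hf; [exact: Hf | exact/IH/CkW]. Qed.

Lemma Ck_sub k U U' f : U' `<=` U -> Ck k U f -> Ck k U' f.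
Proof.
move=> sU; elim: k f => [|k IH] f /= Hf; first by move=> x /sU; exact: Hf.
by case: Hf => df Df; split=> [x /sU|v]; [exact: df | exact/IH/Df].
Qed.

Lemma eq_Ck k U f g : open U -> (forall x, U x -> f x = g x) ->
  Ck k U f -> Ck k U g.
Proof.
move=> oU; elim: k f g => [|k IH] f g fg Hf /=.
  move=> x Ux; apply: (near_continuous _ (Hf x Ux)).
  by apply: (filterS _ (open_nbhs_nbhs (conj oU Ux))) => y /fg.
have nfg x : U x -> \forall y \near x, f y = g y.
  by move=> Ux; apply: (filterS _ (open_nbhs_nbhs (conj oU Ux))) => y /fg.
case: Hf => df Df; split=> [x Ux|v].
  exact: near_differentiable (df x Ux) (nfg x Ux).
apply: (IH ('D_v f)); last exact: Df.
by move=> x Ux; apply: near_eq_derive; exact: nfg.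
Qed.

(** [Ck k.+1] speaks of the total function ['D_v f], which is uncontrolled off [U]. Here a formula
    valid on [U] is enough; this is the induction step of the closure lemmas. *)
Lemma Ck_step k U f (f' : V -> V -> R) : open U ->
  (forall x, U x -> differentiable f x) ->
  (forall v x, U x -> 'D_v f x = f' v x) ->
  (forall v, Ck k U (f' v)) -> Ck k.+1 U f.
Proof.
move=> oU df E Hf'; split=> // v.
by apply: (eq_Ck oU _ (Hf' v)) => x Ux; rewrite E.
Qed.

Lemma Ck_cst k U (c : R) : open U -> Ck k U (fun=> c).
Proof.
move=> oU; elim: k c => [|k IH] c; first by move=> x _; exact: cvg_cst.
apply: (Ck_step (f' := fun _ _ => 0) oU) => // v x _.
exact: derive_cst.
Qed.

Lemma CkD k U f g : open U -> Ck k U f -> Ck k U g -> Ck k U (fun x => f x + g x).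
Proof.
move=> oU; elim: k f g => [|k IH] f g Hf Hg.
  by move=> x Ux; apply: continuousD; [exact: Hf|exact: Hg].
apply: (Ck_step (f' := fun v x => 'D_v f x + 'D_v g x) oU) => [x Ux|v x Ux|v].
- exact: (differentiableD (Ck_differentiable Hf Ux) (Ck_differentiable Hg Ux)).
- have := (deriveD (Ck_derivable (v:=v) Hf Ux) (Ck_derivable (v:=v) Hg Ux)); exact.
- by apply: IH; exact: Ck_derive.
Qed.

Lemma CkM k U f g : open U -> Ck k U f -> Ck k U g -> Ck k U (fun x => f x * g x).
Proof.
move=> oU; elim: k f g => [|k IH] f g Hf Hg.
  by move=> x Ux; apply: continuousM; [exact: Hf|exact: Hg].
apply: (Ck_step (f' := fun v x => f x * 'D_v g x + g x * 'D_v f x) oU)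
  => [x Ux|v x Ux|v].
- exact: (differentiableM (Ck_differentiable Hf Ux) (Ck_differentiable Hg Ux)).
- have := (deriveM (Ck_derivable (v:=v) Hf Ux) (Ck_derivable (v:=v) Hg Ux)); exact.
- by apply: CkD => //; apply: IH; do ?[exact: CkW|exact: Ck_derive].
Qed.

Lemma CkN k U f : open U -> Ck k U f -> Ck k U (fun x => - f x).
Proof.
move=> oU Hf; apply: (eq_Ck (f := fun x => -1 * f x) oU) => [x _|].
  by rewrite mulN1r.
exact: CkM (Ck_cst _ _ oU) Hf.
Qed.

Lemma CkB k U f g : open U -> Ck k U f -> Ck k U g -> Ck k U (fun x => f x - g x).
Proof. by move=> oU Hf Hg; apply: CkD => //; exact: CkN. Qed.

Lemma Ck_sum k U (I : Type) (r : seq I) (P : pred I) (F : I -> V -> R) : open U ->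
  (forall i, P i -> Ck k U (F i)) -> Ck k U (fun x => \sum_(i <- r | P i) F i x).
Proof.
move=> oU HF; elim: r => [|i r IH].
  by apply: (eq_Ck oU _ (Ck_cst k 0 oU)) => x _; rewrite big_nil.
case Pi : (P i); last first.
  by apply: (eq_Ck oU _ IH) => x _; rewrite big_cons Pi.
apply: (eq_Ck oU _ (CkD oU (HF i Pi) IH)) => x _; by rewrite big_cons Pi.
Qed.

Lemma Ck_prod k U (I : Type) (r : seq I) (P : pred I) (F : I -> V -> R) : open U ->
  (forall i, P i -> Ck k U (F i)) -> Ck k U (fun x => \prod_(i <- r | P i) F i x).
Proof.
move=> oU HF; elim: r => [|i r IH].
  by apply: (eq_Ck oU _ (Ck_cst k 1 oU)) => x _; rewrite big_nil.
case Pi : (P i); last first.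
  by apply: (eq_Ck oU _ IH) => x _; rewrite big_cons Pi.
apply: (eq_Ck oU _ (CkM oU (HF i Pi) IH)) => x _; by rewrite big_cons Pi.
Qed.

Lemma CkV k U f : open U -> (forall x, U x -> f x != 0) ->
  Ck k U f -> Ck k U (fun x => (f x)^-1).
Proof.
move=> oU f0; elim: k f f0 => [|k IH] f f0 Hf.
  by move=> x Ux; apply: continuousV; [exact: f0|exact: Hf].
apply: (Ck_step (f' := fun v x => - ((f x)^-1 * (f x)^-1 * 'D_v f x)) oU)
  => [x Ux|v x Ux|v].
- exact: (differentiableV (Ck_differentiable Hf Ux) (f0 x Ux)).
- rewrite (deriveV (f0 x Ux) (Ck_derivable (v:=v) Hf Ux)) scaleNr.
  by rewrite expr2 invfM.
- apply: CkN => //; apply: CkM => //; last exact: Ck_derive.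
  by apply: CkM => //; apply: IH => //; exact: CkW.
Qed.

End Ck.

Lemma continuous_rV (R : realType) (T : topologicalType) n (G : T -> 'rV[R]_n) x :
  (forall j, {for x, continuous (fun y => G y 0 j : R)}) -> {for x, continuous G}.
Proof.
move=> cG; apply/cvgrPdist_lt => e e0.
have H : \forall y \near x, forall j : 'I_n, `|G x 0 j - G y 0 j| < e / 2.
  apply: filter_forall => j.
  by have /cvgrPdist_lt := cG j; apply; rewrite divr_gt0.
apply: filterS H => y Hy; apply: (@le_lt_trans _ _ (e / 2)); last by lra.
rewrite [leLHS]/Num.Def.normr/= mx_normrE.
by apply: bigmax_le => [|[i j] _]; [lra|rewrite !mxE (ord1 i) ltW ?Hy].
Qed.

(** * Composition, determinants and inverse matrices *)

Section CkComp.
Variables (R : realType) (V : normedModType R).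
Implicit Types (U : set V).

Lemma differentiable_rV n (G : V -> 'rV[R]_n) x :
  (forall j, differentiable (fun y => G y 0 j) x) -> differentiable G x.
Proof.
move=> dG.
have -> : G = \sum_(j < n) (fun y => G y 0 j *: (delta_mx 0 j : 'rV_n)).
  by apply/funext => y; rewrite fct_sumE [LHS]row_sum_delta.
apply: differentiable_sum => j; exact: differentiableZl.
Qed.

Lemma derive_rV n (G : V -> 'rV[R]_n) x v :
  (forall j, derivable (fun y => G y 0 j) x v) ->
  'D_v G x = \row_j 'D_v (fun y => G y 0 j) x.
Proof.
move=> dG; have dG' : derivable G x v.
  by apply/derivable_mxP => i j; rewrite (ord1 i).
by rewrite (derive_mx dG'); apply/matrixP => i j; rewrite !mxE (ord1 i).
Qed.

Lemma derive_comp n (f : 'rV[R]_n -> R) (G : V -> 'rV[R]_n) x v :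
  differentiable f (G x) -> (forall j, differentiable (fun y => G y 0 j) x) ->
  'D_v (f \o G) x = \sum_j 'D_v (fun y => G y 0 j) x * 'D_(delta_mx 0 j) f (G x).
Proof.
move=> df dG; have dG' := differentiable_rV dG.
rewrite deriveE; last exact: differentiable_comp.
rewrite diff_comp //= -(deriveE v dG') derive_rV; last first.
  by move=> j; apply: diff_derivable.
rewrite [X in 'd f _ X](row_sum_delta _) linear_sum; apply: eq_bigr => j _.
by rewrite linearZ mxE (deriveE _ df).
Qed.

Lemma derive_sum_coord n (f : 'rV[R]_n -> R) x v : differentiable f x ->
  'D_v f x = \sum_j v 0 j * 'D_(delta_mx 0 j) f x.
Proof.
move=> df; rewrite deriveE // {1}[v]row_sum_delta linear_sum.
by apply: eq_bigr => j _; rewrite linearZ (deriveE _ df).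
Qed.

Lemma Ck_comp n k U (U' : set 'rV[R]_n) (f : 'rV[R]_n -> R) (G : V -> 'rV[R]_n) :
  open U -> (forall x, U x -> U' (G x)) -> Ck k U' f ->
  (forall j, Ck k U (fun x => G x 0 j)) -> Ck k U (f \o G).
Proof.
move=> oU GU; elim: k f => [|k IH] f Hf HG.
  move=> x Ux; apply: continuous_comp; last exact: (Hf _ (GU _ Ux)).
  by apply: continuous_rV => j; exact: (HG j x Ux).
apply: (Ck_step (f' := fun v x =>
  \sum_j 'D_v (fun y => G y 0 j) x * ('D_(delta_mx 0 j) f \o G) x) oU).
- move=> x Ux; apply: differentiable_comp; last exact: (Ck_differentiable Hf (GU x Ux)).
  by apply: differentiable_rV => j; exact: (Ck_differentiable (HG j) Ux).
- move=> v x Ux; apply: derive_comp; first exact: (Ck_differentiable Hf (GU x Ux)).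
  by move=> j; exact: (Ck_differentiable (HG j) Ux).
- move=> v; apply: Ck_sum => // j _; apply: CkM => //; first exact: Ck_derive.
  by apply: IH => [|i]; [exact: Ck_derive|exact: CkW].
Qed.

Lemma Ck_coord n k (U : set 'rV[R]_n) j : open U -> Ck k U (fun x => x 0 j).
Proof.
move=> oU; case: k => [|k].
  by move=> x _; apply: differentiable_continuous; exact: differentiable_coord.
apply: (@Ck_step _ _ k U _ (fun v _ : 'rV[R]_n => v 0 j) oU) => [x _|v x _|v].
- exact: differentiable_coord.
- have := derive_mx (@derivable_id _ _ x v); rewrite derive_id => /matrixP/(_ 0 j).
  by rewrite mxE => <-.
- exact: Ck_cst.
Qed.

Lemma Ck_det n k U (A : V -> 'M[R]_n) : open U ->
  (forall i j, Ck k U (fun x => A x i j)) -> Ck k U (fun x => \det (A x)).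
Proof.
move=> oU HA; apply: Ck_sum => // s _; apply: CkM => //; first exact: Ck_cst.
by apply: Ck_prod.
Qed.

Lemma Ck_invmx n k U (A : V -> 'M[R]_n) i j : open U ->
  (forall x, U x -> A x \in unitmx) ->
  (forall i j, Ck k U (fun x => A x i j)) -> Ck k U (fun x => invmx (A x) i j).
Proof.
move=> oU uA HA.
apply: (eq_Ck (f := fun x => (\det (A x))^-1 * cofactor (A x) j i) oU).
  by move=> x Ux; rewrite /invmx (uA x Ux) !mxE.
apply: CkM => //.
  apply: CkV => //; last exact: Ck_det.
  by move=> x /uA; rewrite unitmxE unitfE.
apply: CkM => //; first exact: Ck_cst.
apply: Ck_det => // a b.
by apply: (eq_Ck oU _ (HA (lift j a) (lift i b))) => x _; rewrite !mxE.
Qed.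

End CkComp.

(** * From directional derivatives to Frechet differentiability *)

Section C1.
Variables (R : realType).

(** Homogeneity in the direction from a single directional derivative: it is used where Frechet
    differentiability is still to be proved. *)
Lemma is_derive_scale (V : normedModType R) (f : V -> R) x v (c : R) df :
  is_derive x v f df -> is_derive x (c *: v) f (c * df).
Proof.
move=> fv.
have fv' : is_derive (0 : R) (1 : R) (fun r : R => f (x + r *: v)) df.
  by apply/is_derive_lineP; rewrite scale0r addr0.
have [Z|c0] := eqVneq c 0; first by rewrite Z scale0r mul0r; exact: is_derive0.
have cv : is_derive (0 : R) (1 : R) ( *%R c : R -> R) c.
  by have := @is_deriveZ R R R id c 0 1 1 _; rewrite scaler1 => /(_ _); apply.
have -> : x = x + 0 *: (c *: v) by rewrite scale0r addr0.
apply/is_derive_lineP; rewrite mulrC.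
have -> : (fun r : R => f (x + r *: (c *: v))) = (fun r => f (x + r *: v)) \o *%R c.
  by apply/funext => r /=; rewrite scalerA mulrC.
apply: is_derive1_comp; by rewrite mulr0.
Qed.

(** The increment is split into moves along one coordinate at a time; the mean value theorem and the
    continuity of the partial derivatives control each move. *)
Lemma C1_differentiable n (U : set 'rV[R]_n) (f : 'rV[R]_n -> R) x :
  open U -> U x ->
  (forall j y, U y -> derivable f y (delta_mx 0 j)) ->
  (forall j, {for x, continuous ('D_(delta_mx 0 j) f)}) ->
  differentiable f x.
Proof.
move=> oU Ux df cf.
pose Lf (h : 'rV[R]_n) : R := \sum_(j < n) h 0 j * 'D_(delta_mx 0 j) f x.
have Llin : linear Lf.
  move=> a u v; rewrite /Lf scaler_sumr -big_split; apply: eq_bigr => j _ /=.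
  by rewrite !mxE mulrDl -mulrA.
pose Lm := GRing.isLinear.Build _ _ _ _ _ Llin.
pose L : {linear 'rV[R]_n -> R} := HB.pack Lf Lm.
have Lc : continuous L.
  move=> y; rewrite -[L : _ -> _]/Lf.
  suff H : Ck 0 setT Lf by exact: (Ck_continuous H).
  apply: Ck_sum => [|j _]; first exact: openT.
  by apply: CkM; [exact: openT|apply: Ck_coord; exact: openT|apply: Ck_cst; exact: openT].
suff [] : differentiable f x /\ 'd f x = L :> (_ -> _) by [].
apply: differentiable_eps => // e e0.
(* [P k h] keeps the first [k] coordinates of [h]; truncation does not increase the sup norm, so the
   whole path stays in the ball. *)
pose P k (h : 'rV[R]_n) : 'rV[R]_n := \row_j (if (j < k)%N then h 0 j else 0).
have PS (h : 'rV[R]_n) (k : 'I_n) : P k.+1 h = P k h + h 0 k *: delta_mx 0 k.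
  apply/rowP => j; rewrite !mxE eqxx ltnS /=.
  case: (ltngtP j k) => jk.
  - by have /negPf -> : j != k by [rewrite -val_eqE neq_ltn jk]; rewrite mulr0 addr0.
  - by have /negPf -> : j != k by [rewrite -val_eqE neq_ltn jk orbT]; rewrite mulr0 addr0.
  - by rewrite (val_inj jk) eqxx mulr1 add0r.
(* The [n] coordinate moves share the error [e]; the successor keeps the denominator nonzero when
   [n] is 0. *)
pose e' := e / n.+1%:R.
have e'0 : 0 < e' by rewrite divr_gt0.
have H : \forall y \near x, U y /\
    forall j, `|'D_(delta_mx 0 j) f x - 'D_(delta_mx 0 j) f y| < e'.
  near=> y; split; first by near: y; exact: open_nbhs_nbhs.
  near: y; apply: filter_forall => j.
  by have /cvgrPdist_lt := cf j; apply.
have /nbhs_ballP [d /= d0 Hd] := H.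
apply/nbhs_ballP; exists d => //= h; rewrite -ball_normE /= sub0r normrN => hd.
have Pn (k : nat) (t : R) (j : 'I_n) : (k <= j)%N -> 0 <= t <= 1 ->
    `|P k h + t *: (h 0 j *: delta_mx 0 j)| <= `|h|.
  move=> kj /andP[t0 t1]; rewrite [leLHS]/Num.Def.normr/= mx_normrE.
  apply: bigmax_le => [//|[i l] _]; rewrite (ord1 i) !mxE /= ?eqxx /=.
  have hl : `|h 0 l| <= `|h|.
    by rewrite [leRHS]/Num.Def.normr/= mx_normrE; exact: (le_bigmax _ _ (0, l)).
  have [El|nl] := eqVneq l j.
    rewrite -El leqNgt in kj; rewrite El in kj *.
    rewrite (negPf kj) add0r mulr1 normrM (ger0_norm t0) -El.
    by apply: le_trans hl; rewrite ler_piMl.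
  by rewrite !mulr0 addr0; case: ifP => // _; rewrite normr0.
have step (k : 'I_n) : `|f (x + P k.+1 h) - f (x + P k h)
    - h 0 k * 'D_(delta_mx 0 k) f x| <= e' * `|h|.
  have in_d (t : R) : 0 <= t <= 1 ->
      ball x d (x + P k h + t *: (h 0 k *: delta_mx 0 k)).
    move=> t01; rewrite -ball_normE /= -addrA opprD addrA subrr sub0r normrN.
    by apply: le_lt_trans hd; exact: Pn.
  rewrite PS addrA.
  have [|s s01 ->] := @MVT_line _ _ f (x + P k h) (h 0 k *: delta_mx 0 k).
    move=> s s01; have [Us _] := Hd _ (in_d s s01).
    by have /derivableP/(is_derive_scale (h 0 k)) [] := df k _ Us.
  have s01' : 0 <= s <= 1 by case/andP: s01 => ? ?; rewrite !ltW.
  have [Us Ds] := Hd _ (in_d s s01').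
  have /derivableP/(is_derive_scale (h 0 k)) [_ ->] := df k _ Us.
  rewrite -mulrBr normrM mulrC distrC.
  apply: ler_pM => //; first exact/ltW/Ds.
  by rewrite [leRHS]/Num.Def.normr/= mx_normrE; exact: (le_bigmax _ _ (0, k)).
have -> : f (x + h) - f x = \sum_(k < n) (f (x + P k.+1 h) - f (x + P k h)).
  rewrite -(big_mkord xpredT (fun k => f (x + P k.+1 h) - f (x + P k h))).
  rewrite (telescope_sumr (fun k => f (x + P k h))) //.
  have -> : P n h = h by apply/rowP => j; rewrite mxE ltn_ord.
  have -> : P 0%N h = 0 by apply/rowP => j; rewrite !mxE.
  by rewrite addr0.
rewrite -sumrB; apply: (le_trans (ler_norm_sum _ _ _)).
apply: (@le_trans _ _ (\sum_(k < n) (e' * `|h|))); first by apply: ler_sum => k _.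
rewrite sumr_const card_ord -mulrnAl ler_wpM2r //.
rewrite -mulr_natr /e' -mulrA ler_piMr ?(ltW e0) // mulrC ler_pdivrMr // mul1r.
by rewrite ler_nat.
Unshelve. all: by end_near.
Qed.

(** Abstracting this implication lets one induction serve both row vectors, by [C1_differentiable],
    and the real line, where derivable already means differentiable. *)
Let C1_diff (V : normedModType R) : Prop := forall (U : set V) (f : V -> R) x,
  open U -> U x -> (forall v y, U y -> derivable f y v) ->
  (forall v, {for x, continuous ('D_v f)}) -> differentiable f x.

Let Ck_of_coord_on_gen (V : normedModType R) m k (U : set V) (f : V -> 'rV[R]_m) i :
  C1_diff V -> open U -> Ck_on k U f -> Ck k U (fun x => f x 0 i).
Proof.
move=> C1V oU; elim: k f => [|k IH] f [cf Df].
  move=> x Ux; apply: (@continuous_comp _ _ _ f (fun y : 'rV[R]_m => y 0 i)).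
    by move: cf; rewrite continuous_open_subspace// => /(_ x (mem_set Ux)).
  exact/coord_continuous.
have cD v x : U x -> {for x, continuous ('D_v f)}.
  case: (Df v) => _ + Ux.
  case: k {IH Df} => [|k] [+ _];
  by rewrite continuous_open_subspace// => /(_ x (mem_set Ux)).
have E v x : U x -> 'D_v (fun x => f x 0 i) x = 'D_v f x 0 i.
  by move=> Ux; rewrite derive_mx ?mxE //; case: (Df v) => + _; exact.
apply: (Ck_step (f' := fun v x => 'D_v f x 0 i) oU) => // [x Ux|v]; last first.
  by apply: IH; case: (Df v).
apply: (C1V U) => // [v y Uy|v].
  by have /derivable_mxP := (Df v).1 y Uy; exact.
have Hc : {for x, continuous (fun y => 'D_v f y 0 i)}.
  apply: (@continuous_comp _ _ _ _ (fun y : 'rV[R]_m => y 0 i)); last exact/coord_continuous.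
  exact: cD.
apply: (near_continuous _ Hc).
by apply: (filterS _ (open_nbhs_nbhs (conj oU Ux))) => y Uy; rewrite E.
Qed.

Lemma Ck_of_coord_on m n k (U : set 'rV[R]_n) (f : 'rV[R]_n -> 'rV[R]_m) i :
  open U -> Ck_on k U f -> Ck k U (fun x => f x 0 i).
Proof.
apply: Ck_of_coord_on_gen => {}U {}f x oU Ux df cf.
by apply: (C1_differentiable oU Ux) => [j|j]; [exact: df|exact: cf].
Qed.

Lemma Ck_of_coord_on_R m k (U : set R^o) (f : R^o -> 'rV[R]_m) i :
  open U -> Ck_on k U f -> Ck k U (fun x => f x 0 i).
Proof.
apply: Ck_of_coord_on_gen => {}U {}f x oU Ux df cf.
by apply/derivable1_diffP; exact: df.
Qed.

(** [Ck] is a pointwise condition on total functions, so the sets [U'] only have to contain the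
    points. *)
Lemma Ck_local (V : normedModType R) k (U : set V) (f : V -> R) :
  (forall x, U x -> exists2 U', U' x & Ck k U' f) -> Ck k U f.
Proof.
elim: k f => [|k IH] f H /=.
  by move=> x /H [U' U'x]; exact.
split=> [x /H [U' U'x [+ _]]|v]; first exact.
by apply: IH => x /H [U' U'x [_ Df]]; exists U' => //; exact: Df.
Qed.

Lemma Ck_on_of_Ck (V : normedModType R) m k (U : set V) (f : V -> 'rV[R]_m) :
  open U -> (forall i, Ck k U (fun x => f x 0 i)) -> Ck_on k U f.
Proof.
move=> oU.
have cf k' (g : V -> 'rV[R]_m) : (forall i, Ck k' U (fun x => g x 0 i)) ->
    {within U, continuous g}.
  move=> Hg; rewrite continuous_open_subspace// => x /set_mem Ux.
  by apply: continuous_rV => j; exact: (Ck_continuous (Hg j) Ux).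
elim: k f => [|k IH] f Hf; split; do ?[exact: cf Hf|by []].
move=> v; split=> [x Ux|].
  by apply/derivable_mxP => i j; rewrite (ord1 i); exact: (Ck_derivable (Hf j) Ux).
apply: IH => i; apply: (eq_Ck oU _ (Ck_derive v (Hf i))) => x Ux.
rewrite derive_mx ?mxE //.
by apply/derivable_mxP => a b; rewrite (ord1 a); exact: (Ck_derivable (Hf b) Ux).
Qed.

End C1.

(** * Symmetry of second derivatives *)

Section Schwarz.
Variable (R : realType).

(* Both mixed derivatives are the limit of the symmetric second difference
   quotient. *)
Lemma derive_comm (V : normedModType R) (U : set V) (f : V -> R) x v w :
  open U -> U x -> Ck 2 U f -> 'D_v ('D_w f) x = 'D_w ('D_v f) x.
Proof.
move=> oU Ux Hf.
pose D2 (s : R) := f (x + s *: v + s *: w) - f (x + s *: v) - f (x + s *: w) + f x.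
suff H (a b : V) : forall e : R, 0 < e -> \forall s \near (0 : R)^',
    `|s^-1 * s^-1 * (f (x + s *: a + s *: b) - f (x + s *: a) - f (x + s *: b) + f x)
      - 'D_b ('D_a f) x| <= e.
  have e3 : forall e : R, 0 < e -> `|'D_v ('D_w f) x - 'D_w ('D_v f) x| <= e.
    move=> e e0; have e20 : 0 < e / 2 by rewrite divr_gt0.
    have F1 := H v w _ e20; have F2 := H w v _ e20.
    have [s [H1 H2]] := filter_ex (filterI F1 F2).
    have Ds : f (x + s *: w + s *: v) - f (x + s *: w) - f (x + s *: v) + f x = D2 s.
      by rewrite /D2 [x + s *: v + s *: w]addrAC; ring.
    rewrite {}Ds in H2.
    rewrite /= -/(D2 s) in H1; move: H1 H2.
    move: (s^-1 * s^-1 * D2 s) ('D_v ('D_w f) x) ('D_w ('D_v f) x) => q B A H1 H2.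
    have -> : B - A = (q - A) - (q - B) by ring.
    by apply: (le_trans (ler_normB _ _)); lra.
  apply/eqP; rewrite -subr_eq0 -normr_le0; apply/ler_addgt0Pr => e e0.
  by rewrite add0r; exact: e3.
move=> e e0.
have dDa : differentiable ('D_a f) x.
  exact: (Ck_differentiable (Ck_derive a Hf) Ux).
pose C := `|a| + `|b| + 1.
have C0 : 0 < C by rewrite /C; have := normr_ge0 a; have := normr_ge0 b; lra.
(* The first order expansion of ['D_a f] at [x] is used at two points, each within [C * |s|] of [x];
   the two errors add up to [e * |s|]. *)
pose e' := e / (2 * C).
have e'0 : 0 < e' by rewrite divr_gt0 // mulr_gt0.
have /nbhs_ballP [d /= d0 Hd] := differentiableP_eps dDa e'0.
have /nbhs_ballP [d1 /= d10 Hd1] := open_nbhs_nbhs (conj oU Ux).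
near=> s.
have s0 : s != 0 by near: s; exact: nbhs_dnbhs_neq.
have sd : `|s| < Num.min d d1 / C.
  near: s; apply: dnbhs0_lt; rewrite divr_gt0 //; by rewrite lt_min d0.
have small (t r : R) : `|t| <= `|s| -> `|r| <= `|s| ->
    `|t *: a + r *: b| <= C * `|s| /\ `|t *: a + r *: b| < Num.min d d1.
  move=> ts rs.
  have L : `|t *: a + r *: b| <= C * `|s|.
    apply: (le_trans (ler_normD _ _)); rewrite !normrZ /C.
    have := ler_wpM2r (normr_ge0 a) ts; have := ler_wpM2r (normr_ge0 b) rs.
    by have := normr_ge0 s; lra.
  split=> //; apply: (le_lt_trans L); by rewrite mulrC -ltr_pdivlMr.
have inU (t r : R) : `|t| <= `|s| -> `|r| <= `|s| -> U (x + (t *: a + r *: b)).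
  move=> ts rs; apply: Hd1; rewrite -ball_normE /= opprD addrA subrr sub0r normrN.
  by have [_] := small t r ts rs; rewrite lt_min => /andP[].
have ths (th : R) : 0 <= th <= 1 -> `|th * s| <= `|s|.
  by case/andP=> t0 t1; rewrite normrM (ger0_norm t0) ler_piMl.
have Df1 y : U y -> is_derive y (s *: a) f (s * 'D_a f y).
  by move=> Uy; apply/is_derive_scale/derivableP/(Ck_derivable Hf Uy).
have U1 (r : R) : 0 <= r <= 1 -> U (x + s *: b + r *: (s *: a)).
  move=> r01; rewrite scalerA -addrA [s *: b + _]addrC.
  by apply: inU => //; exact: ths.
have U2 (r : R) : 0 <= r <= 1 -> U (x + r *: (s *: a)).
  move=> r01; rewrite scalerA -[_ *: a]addr0 -(scale0r b).
  by apply: inU; [exact: ths|rewrite normr0].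
(* The second difference is the increment of [psi] over the unit interval. The mean value theorem
   turns it into a difference of values of ['D_a f], which differentiability at [x] then
   evaluates. *)
pose psi (r : R) : R := f (x + s *: b + r *: (s *: a)) - f (x + r *: (s *: a)).
pose dpsi (r : R) : R :=
  s * 'D_a f (x + s *: b + r *: (s *: a)) - s * 'D_a f (x + r *: (s *: a)).
have Dpsi (r : R) : 0 <= r <= 1 -> is_derive r (1 : R) psi (dpsi r).
  move=> r01; apply: is_deriveB; apply/is_derive_lineP; apply: Df1; [exact: U1|exact: U2].
have [||th] := @MVT R psi dpsi 0 1 ltr01.
- move=> r; rewrite in_itv /= => /andP[? ?]; apply: Dpsi; by rewrite !ltW.
- apply: derivable_within_continuous => r; rewrite in_itv /= => r01.
  by have [] := Dpsi r r01.
rewrite in_itv /= subr0 mulr1 => /andP[th0 th1].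
have th01 : 0 <= th <= 1 by rewrite !ltW.
have -> : psi 1 - psi 0 =
    f (x + s *: a + s *: b) - f (x + s *: a) - f (x + s *: b) + f x.
  rewrite /psi !scale1r !scale0r !addr0 [x + s *: b + _]addrAC; ring.
move=> ->; rewrite /dpsi.
have err (k : V) : `|k| < d -> `|'D_a f (x + k) - 'D_a f x - 'd ('D_a f) x k| <= e' * `|k|.
  by move=> kd; apply: Hd; rewrite -ball_normE /= sub0r normrN.
have [k1C k1d] := small (th * s) s (ths _ th01) (lexx _).
have [k2C k2d] : `|th * s *: a| <= C * `|s| /\ `|th * s *: a| < Num.min d d1.
  rewrite -[_ *: a]addr0 -(scale0r b).
  by apply: small; [exact: ths|rewrite normr0].
move: k1d k2d; rewrite !lt_min => /andP[/err e1 _] /andP[/err e2 _].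
have Ed : 'd ('D_a f) x (th * s *: a + s *: b) =
    'd ('D_a f) x (th * s *: a) + s * 'D_b ('D_a f) x.
  by rewrite linearD [X in _ + X = _]linearZ /= -(deriveE b dDa).
rewrite {}Ed in e1.
set p1 := 'D_a f (x + (_ + _)) in e1; set p2 := 'D_a f (x + _) in e2.
set q := 'd _ _ _ in e1 e2.
have E1 : 'D_a f (x + s *: b + th *: (s *: a)) = p1.
  by rewrite /p1 scalerA -addrA [s *: b + _]addrC.
have E2 : 'D_a f (x + th *: (s *: a)) = p2 by rewrite /p2 scalerA.
rewrite E1 E2.
set D := 'D_b _ x in e1 *.
have -> : s^-1 * s^-1 * (s * p1 - s * p2) - D
    = s^-1 * ((p1 - 'D_a f x - (q + s * D)) - (p2 - 'D_a f x - q)) by field.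
rewrite normrM normfV ler_pdivrMl ?normr_gt0 //.
apply: (le_trans (ler_normB _ _)).
have B1 := le_trans e1 (ler_wpM2l (ltW e'0) k1C).
have B2 := le_trans e2 (ler_wpM2l (ltW e'0) k2C).
have -> : `|s| * e = e' * (C * `|s|) + e' * (C * `|s|).
  by rewrite /e'; field; rewrite gt_eqF.
exact: lerD.
Unshelve. all: by end_near.
Qed.
End Schwarz.

(** * Norms and compact balls of row vectors *)

Section RowVectorNorm.
Variable R : realType.

Lemma le_norm_coord n (x : 'rV[R]_n) j : `|x 0 j| <= `|x|.
Proof. by rewrite [leRHS]/Num.Def.normr/= mx_normrE; exact: (le_bigmax _ _ (0, j)). Qed.

Lemma norm_rV_le n (x : 'rV[R]_n) (c : R) : 0 <= c ->
  (forall j, `|x 0 j| <= c) -> `|x| <= c.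
Proof.
move=> c0 H; rewrite [leLHS]/Num.Def.normr/= mx_normrE.
by apply: bigmax_le => // -[i j] _; rewrite (ord1 i).
Qed.

Lemma mulmx_bounded m n (T : 'M[R]_(m, n)) :
  exists2 C : R, 0 < C & forall v : 'rV[R]_m, `|v *m T| <= C * `|v|.
Proof.
exists (1 + \sum_i \sum_j `|T i j|).
  by apply: ltr_wpDr => //; apply: sumr_ge0 => i _; apply: sumr_ge0.
move=> v; apply: norm_rV_le => [|j].
  by apply: mulr_ge0 => //; apply: addr_ge0 => //; apply: sumr_ge0 => i _; apply: sumr_ge0.
rewrite mxE; apply: (le_trans (ler_norm_sum _ _ _)).
apply: (@le_trans _ _ (\sum_i (`|T i j| * `|v|))).
  by apply: ler_sum => i _; rewrite normrM mulrC ler_wpM2l ?le_norm_coord.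
rewrite -mulr_suml ler_wpM2r //.
apply: (@le_trans _ _ (\sum_i \sum_j `|T i j|)); last by rewrite lerDr.
by apply: ler_sum => i _; rewrite (bigD1 j) //= lerDl; apply: sumr_ge0.
Qed.

Lemma closed_ball_rV_compact n (x : 'rV[R]_n) (e : R) :
  compact [set y : 'rV[R]_n | `|x - y| <= e].
Proof.
have [e0|e0] := ltP 0 e; last first.
  have -> : [set y : 'rV[R]_n | `|x - y| <= e] = (if e == 0 then [set x] else set0).
    apply/seteqP; split=> y /=.
      move=> H; have := le_trans H e0; rewrite normr_le0 subr_eq0 => /eqP E.
      have := le_trans (normr_ge0 _) H => e0'.
      have -> : e == 0 by rewrite eq_le e0 e0'.
      by rewrite E.
    by case: eqP => // -> ->; rewrite subrr normr0.
  by case: ifP => _; [exact: compact_set1|exact: compact0].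
apply: bounded_closed_compact.
  exists (`|x| + e); split; first exact: num_real.
  move=> M HM y /= H; apply: le_trans (ltW HM).
  have -> : y = x - (x - y) by rewrite opprB addrC subrK.
  by apply: (le_trans (ler_normB _ _)); rewrite lerD2l.
have := @closed_ball_closed R _ x e; rewrite closed_ballE //.
Qed.

End RowVectorNorm.

Lemma ball_segment (R : realType) (V : normedModType R) (c : V) (e : R) x y (r : R) :
  ball c e x -> ball c e y -> 0 <= r <= 1 -> ball c e (x + r *: (y - x)).
Proof.
rewrite -!ball_normE /= => bx bY /andP[r0 r1].
have -> : c - (x + r *: (y - x)) = (1 - r) *: (c - x) + r *: (c - y).
  have -> : y - x = (c - x) - (c - y) by rewrite opprB [RHS]addrC addrA subrK.
  by rewrite opprD addrA scalerBr opprB scalerBl scale1r addrA addrAC.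
apply: (le_lt_trans (ler_normD _ _)); rewrite !normrZ (ger0_norm r0) ger0_norm ?subr_ge0 //.
have [->|r1'] := eqVneq r 1; first by rewrite subrr mul0r add0r mul1r.
have r1'' : 0 < 1 - r by rewrite subr_gt0 lt_neqAle r1' r1.
have h1 : r * `|c - y| <= r * e by rewrite ler_wpM2l // ltW.
have h2 : (1 - r) * `|c - x| < (1 - r) * e by rewrite ltr_pM2l.
have -> : e = (1 - r) * e + r * e by ring.
exact: ltr_leD.
Qed.

(** * The inverse function theorem *)

Section InverseFunction.
Variables (R : realType) (n : nat).
Variables (U : set 'rV[R]_n) (F : 'rV[R]_n -> 'rV[R]_n) (a : 'rV[R]_n).
Hypotheses (oU : open U) (Ua : U a) (F_smooth : forall k i, Ck k U (fun x => F x 0 i)).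

Let J x : 'M[R]_n := \matrix_(j, i) 'D_(delta_mx 0 j) (fun y => F y 0 i) x.

Hypothesis J_inj : forall v : 'rV[R]_n, v *m J a = 0 -> v = 0.

Let F_diff x : U x -> differentiable F x.
Proof.
by move=> Ux; apply: differentiable_rV => j; exact: (Ck_differentiable (F_smooth 1 j) Ux).
Qed.

Let derive_FE x v i : U x -> 'D_v (fun y => F y 0 i) x = (v *m J x) 0 i.
Proof.
move=> Ux; rewrite derive_sum_coord; last exact: (Ck_differentiable (F_smooth 1 i) Ux).
by rewrite mxE; apply: eq_bigr => j _; rewrite mxE.
Qed.

Let diff_FE x v : U x -> 'd F x v = v *m J x.
Proof.
move=> Ux; rewrite -deriveE; last exact: F_diff.
rewrite derive_rV => [|j]; last exact: (Ck_derivable (F_smooth 1 j) Ux).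
by apply/rowP => i; rewrite mxE derive_FE.
Qed.

Lemma inj_unitmx m (A : 'M[R]_m) : (forall v : 'rV_m, v *m A = 0 -> v = 0) ->
  A \in unitmx.
Proof.
move=> H; rewrite -row_free_unit -kermx_eq0; apply/eqP/row_matrixP => i.
by rewrite row0; apply: H; rewrite -row_mul mulmx_ker row0.
Qed.

Let T := invmx (J a).

Let JT : J a *m T = 1%:M.
Proof. by rewrite mulmxV //; exact: inj_unitmx. Qed.

(** A Newton map with frozen Jacobian: its differential vanishes at [a], and [F x = y] exactly when
    [x] is a fixed point of [Phi + y *m T]. *)
Let Phi x := x - F x *m T.

Let Phi_coord x i : Phi x 0 i = x 0 i - \sum_l F x 0 l * T l i.
Proof. by rewrite !mxE. Qed.

Let Phi_smooth k i : Ck k U (fun x => Phi x 0 i).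
Proof.
apply: (@eq_Ck _ _ k U (fun x => x 0 i - \sum_l F x 0 l * T l i) _ oU).
  by move=> x _; rewrite Phi_coord.
apply: CkB => //; first exact: Ck_coord.
by apply: Ck_sum => // l _; apply: CkM => //; exact: Ck_cst.
Qed.

Let derive_PhiE x v i : U x -> 'D_v (fun y => Phi y 0 i) x = (v - v *m J x *m T) 0 i.
Proof.
move=> Ux.
have PhiE : (fun y => Phi y 0 i) = (fun y : 'rV[R]_n => y 0 i : R)
     - \sum_l (fun y : 'rV[R]_n => F y 0 l * T l i : R).
  by apply/funext => y; rewrite Phi_coord !fctE fct_sumE.
have dF l : derivable (fun y : 'rV[R]_n => F y 0 l * T l i : R) x v.
  apply: derivableM; last exact: derivable_cst.
  exact: (Ck_derivable (F_smooth 1 l) Ux).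
have dc : derivable (fun y : 'rV[R]_n => y 0 i : R) x v.
  by apply: diff_derivable; exact: differentiable_coord.
rewrite PhiE deriveB //; last exact: derivable_sum.
rewrite derive_sum //.
have -> : 'D_v (fun y : 'rV[R]_n => y 0 i) x = v 0 i.
  have := derive_mx (@derivable_id _ _ x v); rewrite derive_id => /matrixP/(_ 0 i).
  by rewrite mxE => <-.
rewrite mxE [in RHS]mxE; congr (_ - _); rewrite [RHS]mxE; apply: eq_bigr => l _.
rewrite deriveM; [|exact: (Ck_derivable (F_smooth 1 l) Ux)|exact: derivable_cst].
by rewrite derive_cst scaler0 add0r derive_FE // [_ *: _]mulrC.
Qed.

Let Phi_contraction : exists2 d : R, 0 < d & ball a d `<=` U /\
  forall x v i, ball a d x -> `|'D_v (fun y => Phi y 0 i) x| <= `|v| / 2.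
Proof.
(* A directional derivative is a combination of [n] partial derivatives; this bound on each keeps
   the total below one half. *)
pose e : R := (2 * n.+1%:R)^-1.
have e0 : 0 < e by rewrite invr_gt0 mulr_gt0.
have H : \forall x \near a, U x /\ forall ji : 'I_n * 'I_n,
    `|'D_(delta_mx 0 ji.1) (fun y => Phi y 0 ji.2) x| < e.
  near=> x; split; first by near: x; exact: open_nbhs_nbhs.
  near: x; apply: filter_forall => -[j i] /=.
  have /cvgrPdist_lt/(_ _ e0) := Ck_continuous (Ck_derive (delta_mx 0 j) (Phi_smooth 1 i)) Ua.
  apply: filterS => x.
  by rewrite derive_PhiE // -mulmxA JT mulmx1 subrr mxE sub0r normrN.
have /nbhs_ballP [d /= d0 Hd] := H.
exists d => //; split; first by move=> x /Hd [].
move=> x v i /Hd [Ux Hx].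
rewrite derive_sum_coord; last exact: (Ck_differentiable (Phi_smooth 1 i) Ux).
apply: (le_trans (ler_norm_sum _ _ _)).
apply: (@le_trans _ _ (\sum_(j < n) (`|v| * e))).
  apply: ler_sum => j _; rewrite normrM.
  by apply: ler_pM => //; [exact: le_norm_coord|exact/ltW/(Hx (j, i))].
rewrite sumr_const card_ord -mulrnAr ler_wpM2l //.
have n0 : 0 < n.+1%:R :> R by rewrite ltr0n.
have -> : e *+ n = (n%:R / n.+1%:R) / 2.
  by rewrite -[LHS]mulr_natr /e; field; rewrite gt_eqF.
by rewrite -[leRHS]mul1r ler_pM2r ?invr_gt0 // ler_pdivrMr // mul1r ler_nat.
Unshelve. all: by end_near.
Qed.

Theorem inverse_function : exists (W : set 'rV[R]_n) (e : R) (G : 'rV[R]_n -> 'rV[R]_n),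
  [/\ open W, W `<=` U, 0 < e & G (F a) = a] /\
  [/\ forall y, ball (F a) e y -> W (G y) /\ F (G y) = y,
      forall x, W x -> G (F x) = x, W a &
      forall k i, Ck k (ball (F a) e) (fun y => G y 0 i)].
Proof.
have [d d0 [dU dPhi]] := Phi_contraction.
have lipPhi x x' : ball a d x -> ball a d x' -> `|Phi x - Phi x'| <= `|x - x'| / 2.
  move=> bx bx'; apply: norm_rV_le => [|i]; first by rewrite divr_ge0.
  have bs (s : R) : 0 <= s <= 1 -> ball a d (x' + s *: (x - x')) by exact: ball_segment.
  have [|s s01] := @MVT_line _ _ (fun y => Phi y 0 i) x' (x - x').
    by move=> s s01; apply: (Ck_derivable (Phi_smooth 1 i)); exact/dU/bs.
  rewrite [x' + _]addrC subrK => E.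
  have -> : (Phi x - Phi x') 0 i = Phi x 0 i - Phi x' 0 i by rewrite [LHS]mxE [X in _ + X]mxE.
  rewrite E; apply: dPhi; apply: bs; by case/andP: s01 => ? ?; rewrite !ltW.
have inj x x' : ball a d x -> ball a d x' ->
    `|x - x'| <= 2 * `|(F x - F x') *m T|.
  move=> bx bx'; have := lipPhi _ _ bx bx'.
  have -> : x - x' = (Phi x - Phi x') + (F x - F x') *m T.
    by rewrite /Phi mulmxBl; apply/rowP => j; rewrite !mxE; ring.
  have := ler_normD (Phi x - Phi x') ((F x - F x') *m T).
  by lra.
have [C C0 HC] := mulmx_bounded T.
(* The target contributes at most [d / 4] and the contraction at most [d / 4], so [ph] below maps
   the ball [K] of radius [d / 2] into itself. *)
pose e := d / (4 * C).
have e0 : 0 < e by rewrite divr_gt0 // mulr_gt0.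
have surj y : ball (F a) e y -> exists2 x, ball a d x & F x = y.
  move=> yB; have ye : `|F a - y| < e by move: yB; rewrite -ball_normE.
  pose K := [set x : 'rV[R]_n | `|a - x| <= d / 2].
  have Kb x : K x -> ball a d x.
    by rewrite -ball_normE /K /= => H; apply: (le_lt_trans H); rewrite ltr_pdivrMr // mulr_natr mulr2n ltrDl.
  pose ph x := Phi x + y *m T.
  have phK x : K x -> K (ph x).
    move=> Kx.
    have -> : K (ph x) = (`|a - ph x| <= d / 2) :> Prop by [].
    have -> : a - ph x = (Phi a - Phi x) + (F a - y) *m T.
      by rewrite /ph /Phi mulmxBl; apply/rowP => j; rewrite !mxE; ring.
    have h1 : `|Phi a - Phi x| <= `|a - x| / 2.
      by apply: lipPhi; [exact: ballxx|exact: Kb].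
    have h2 : `|(F a - y) *m T| <= d / 4.
      apply: (le_trans (HC _)); rewrite mulrC -ler_pdivlMr //.
      by apply: (le_trans (ltW ye)); rewrite /e invfM mulrA.
    have := ler_normD (Phi a - Phi x) ((F a - y) *m T).
    by move: Kx; rewrite /K /=; lra.
  have cg : {within K, continuous (fun x => `|ph x - x|)}.
    have cPhi x : U x -> {for x, continuous Phi}.
      by move=> Ux; apply: continuous_rV => i; exact: (Ck_continuous (Phi_smooth 0 i) Ux).
    apply: (@continuous_subspaceW _ _ K (ball a d)); first by move=> x; exact: Kb.
    rewrite continuous_open_subspace; last exact: ball_open.
    move=> x /set_mem xd; apply: continuous_comp; last exact: norm_continuous.
    apply: continuousB; last exact: cvg_id.
    by apply: continuousD; [exact/cPhi/dU|exact: cst_continuous].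
  have K0 : K !=set0 by exists a; rewrite /K /= subrr normr0; apply: divr_ge0 => //; exact: ltW.
  (* The fixed point is found without iteration: [p] minimises the displacement of [ph], and
     applying [ph] once more would halve it, so the minimum is 0. *)
  have [p pK pmin] := EVT_min_rV K0 (@closed_ball_rV_compact R n a (d / 2)) cg.
  have {}pK := set_mem pK.
  exists p; first exact: (Kb p pK).
  have := pmin (ph p) (mem_set (phK p pK)).
  have -> : ph (ph p) - ph p = Phi (ph p) - Phi p.
    by rewrite /ph; apply/rowP => j; rewrite !mxE; ring.
  move=> h; have h' := le_trans h (lipPhi _ _ (Kb _ (phK p pK)) (Kb _ pK)).
  have : `|ph p - p| <= 0 by move: h'; have := normr_ge0 (ph p - p); lra.
  rewrite normr_le0 => /eqP Ep.
  have : (F p - y) *m T = 0.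
    by rewrite mulmxBl -[RHS]oppr0 -Ep /ph /Phi; apply/rowP => j; rewrite !mxE; ring.
  move=> /(congr1 (mulmx^~ (J a))); rewrite -mulmxA mulVmx; last exact: inj_unitmx.
  by rewrite mulmx1 mul0mx => /eqP; rewrite subr_eq0 => /eqP.
pose G y := get [set x | ball a d x /\ F x = y].
have Gex y : (exists2 x, ball a d x & F x = y) -> ball a d (G y) /\ F (G y) = y.
  by move=> [x bx Fx]; exact: (@getPex _ [set x | ball a d x /\ F x = y] (ex_intro _ x (conj bx Fx))).
have GF x : ball a d x -> G (F x) = x.
  move=> bx; have [bG FG] := Gex (F x) (ex_intro2 _ _ x bx erefl).
  have := inj _ _ bG bx; rewrite FG subrr mul0mx normr0 mulr0 normr_le0 subr_eq0.
  by move=> /eqP.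
have GB y : ball (F a) e y -> ball a d (G y) /\ F (G y) = y by move/surj/Gex.
have Glip y y' : ball (F a) e y -> ball (F a) e y' -> `|G y - G y'| <= 2 * C * `|y - y'|.
  move=> /GB [b1 E1] /GB [b2 E2]; apply: (le_trans (inj _ _ b1 b2)).
  by rewrite E1 E2 -mulrA ler_wpM2l.
have oB : open (ball (F a) e) by exact: ball_open.
(* On the kernel of [J x] the differential of [Phi] is the identity, yet it shrinks norms by
   half. *)
have Junit x : ball a d x -> J x \in unitmx.
  move=> bx; apply: inj_unitmx => v vJ.
  apply/eqP; rewrite -normr_le0.
  suff : `|v| <= `|v| / 2 by have := normr_ge0 v; lra.
  apply: norm_rV_le => [|i]; first by rewrite divr_ge0.
  by have := dPhi x v i bx; rewrite derive_PhiE ?vJ ?mul0mx ?subr0 //; exact: dU.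
have nearB (y : 'rV[R]_n) : ball (F a) e y -> \forall k \near (0 : 'rV[R]_n), ball (F a) e (y + k).
  move=> yB; have : \forall z \near y, ball (F a) e z by exact: (open_nbhs_nbhs (conj oB yB)).
  by rewrite (near_shift 0 y) /=; apply: filterS => k; rewrite /= subr0 addrC.
have dG y : ball (F a) e y -> differentiable G y /\
    'd G y = mulmxr (invmx (J (G y))) :> (_ -> _).
  move=> yB; have [bG FG] := GB y yB.
  have [CL CL0 HCL] := mulmx_bounded (invmx (J (G y))).
  apply: differentiable_eps.
    move=> v; apply: continuous_rV => i.
    rewrite (_ : (fun w => _) = (fun w : 'rV[R]_n => \sum_l w 0 l * invmx (J (G y)) l i)).
      suff H : Ck 0 setT (fun w : 'rV[R]_n => \sum_l w 0 l * invmx (J (G y)) l i).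
        exact: (Ck_continuous H).
      apply: Ck_sum => [|l _]; first exact: openT.
      by apply: CkM; [exact: openT|apply: Ck_coord; exact: openT|apply: Ck_cst; exact: openT].
    by apply/funext => w; rewrite mxE.
  move=> r r0.
  (* Compensates the bound [CL] of the inverse Jacobian and the Lipschitz constant [2 * C] of
     [G]. *)
  pose r' := r / (CL * (2 * C)).
  have r'0 : 0 < r' by rewrite divr_gt0 // !mulr_gt0.
  have /nbhs_ballP [s /= s0 Hs] := differentiableP_eps (F_diff (dU _ bG)) r'0.
  have Hk : \forall k \near (0 : 'rV[R]_n), `|k| < s / (2 * C).
    apply/nbhs_ballP; exists (s / (2 * C)) => /=; first by rewrite divr_gt0 // mulr_gt0.
    by move=> k; rewrite -ball_normE /= sub0r normrN.
  apply: filterS2 (nearB y yB) Hk => k ykB ks.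
  pose h := G (y + k) - G y.
  have hk : `|h| <= 2 * C * `|k|.
    have := Glip _ _ ykB yB; by rewrite [y + k - y]addrAC subrr add0r.
  have hs : `|h| < s.
    by apply: (le_lt_trans hk); rewrite mulrC -ltr_pdivlMr // mulr_gt0.
  have := Hs h; rewrite -ball_normE /= sub0r normrN => /(_ hs).
  have -> : G y + h = G (y + k) by rewrite /h addrC subrK.
  have [_ ->] := GB _ ykB; rewrite FG [y + k - y]addrAC subrr add0r diff_FE; last exact: dU.
  move=> Hh.
  have -> : h - mulmxr (invmx (J (G y))) k = - ((k - h *m J (G y)) *m invmx (J (G y))).
    by rewrite mulmxBl mulmxK ?Junit //= opprB.
  rewrite normrN; apply: (le_trans (HCL _)).
  apply: (@le_trans _ _ (CL * (r' * (2 * C * `|k|)))).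
    rewrite ler_wpM2l ?(ltW CL0) //; apply: (le_trans Hh).
    by rewrite ler_wpM2l // ltW.
  rewrite le_eqVlt; apply/orP; left; apply/eqP; rewrite /r'; field.
  by rewrite !gt_eqF.
have Jsm k i j : Ck k (ball a d) (fun x => J x i j).
  apply: (@eq_Ck _ _ k _ ('D_(delta_mx 0 i) (fun y => F y 0 j))).
  - exact: ball_open.
  - by move=> x _; rewrite mxE.
  - exact/(Ck_sub dU)/Ck_derive.
exists (ball a d), e, G; split; split=> //.
- exact: ball_open.
- by apply: GF; exact: ballxx.
- exact: ballxx.
(* Bootstrap: the differential of [G] is the inverse Jacobian composed with [G], so class [k] of [G]
   yields class [k.+1]. *)
elim=> [|k IH] i.
  move=> y yB.
  have /differentiable_continuous cG := (dG y yB).1.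
  apply: (@continuous_comp _ _ _ G (fun x : 'rV[R]_n => x 0 i)); first exact: cG.
  exact/coord_continuous.
have dGi y : ball (F a) e y -> differentiable (fun y => G y 0 i) y.
  move=> yB; apply: (@differentiable_comp _ _ _ _ G (fun x : 'rV[R]_n => x 0 i)).
    exact: (dG y yB).1.
  exact: differentiable_coord.
apply: (@Ck_step _ _ k _ (fun y => G y 0 i)
  (fun v y : 'rV[R]_n => \sum_l v 0 l * invmx (J (G y)) l i) oB).
- exact: dGi.
- move=> v y yB; have [dGy E] := dG y yB.
  have := derive_mx (diff_derivable (v := v) dGy).
  rewrite deriveE // E => /matrixP/(_ 0 i); rewrite [RHS]mxE => <-.
  by rewrite mxE.
- move=> v; apply: Ck_sum => // l _; apply: CkM => //; first exact: Ck_cst.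
  apply: Ck_invmx => //.
    by move=> y yB; apply: Junit; case: (GB y yB).
  move=> p q; apply: (@Ck_comp _ _ n k _ (ball a d) (fun x => J x p q) G) => //.
  by move=> y /GB [].
Qed.

End InverseFunction.

(** * The Euclidean inner product *)

Section Dot.
Variable R : realType.

Definition dot m (x y : 'rV[R]_m) : R := \sum_i x 0 i * y 0 i.

Lemma dotC m (x y : 'rV[R]_m) : dot x y = dot y x.
Proof. by apply: eq_bigr => i _; rewrite mulrC. Qed.

Lemma dotDl m (x y z : 'rV[R]_m) : dot (x + y) z = dot x z + dot y z.
Proof. by rewrite /dot -big_split; apply: eq_bigr => i _; rewrite mxE mulrDl. Qed.

Lemma dotZl m a (x z : 'rV[R]_m) : dot (a *: x) z = a * dot x z.
Proof. by rewrite /dot mulr_sumr; apply: eq_bigr => i _; rewrite mxE mulrA. Qed.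

Lemma dotDr m (x y z : 'rV[R]_m) : dot z (x + y) = dot z x + dot z y.
Proof. by rewrite dotC dotDl !(dotC z). Qed.

Lemma dotZr m a (x z : 'rV[R]_m) : dot z (a *: x) = a * dot z x.
Proof. by rewrite dotC dotZl dotC. Qed.

Lemma dotNl m (x z : 'rV[R]_m) : dot (- x) z = - dot x z.
Proof. by rewrite -scaleN1r dotZl mulN1r. Qed.

Lemma dotNr m (x z : 'rV[R]_m) : dot z (- x) = - dot z x.
Proof. by rewrite dotC dotNl dotC. Qed.

Lemma dot0l m (z : 'rV[R]_m) : dot 0 z = 0.
Proof. by rewrite -(scale0r 0) dotZl mul0r. Qed.

Lemma dot0r m (z : 'rV[R]_m) : dot z 0 = 0.
Proof. by rewrite dotC dot0l. Qed.

Lemma dot_ge0 m (x : 'rV[R]_m) : 0 <= dot x x.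
Proof. by apply: sumr_ge0 => i _; rewrite -expr2 sqr_ge0. Qed.

Lemma dot_eq0 m (x : 'rV[R]_m) : dot x x = 0 -> x = 0.
Proof.
move=> /eqP; rewrite psumr_eq0 => [/allP H|i _]; last by rewrite -expr2 sqr_ge0.
apply/rowP => i; have := H i (mem_index_enum _).
by rewrite mulf_eq0 orbb mxE => /eqP.
Qed.

Lemma dot_gt0 m (x : 'rV[R]_m) : x != 0 -> 0 < dot x x.
Proof.
by move=> x0; rewrite lt0r dot_ge0 andbT; apply: contra x0 => /eqP/dot_eq0 ->.
Qed.

Lemma innerE n p (x y : 'rV[R]_(n + p)) :
  inner x y = dot (lsubmx x) (lsubmx y) - dot (rsubmx x) (rsubmx y).
Proof. by congr (_ - _); apply: eq_bigr => i _; rewrite !mxE. Qed.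

Lemma sqr_coord_le_dot m (x : 'rV[R]_m) i : x 0 i ^+ 2 <= dot x x.
Proof.
rewrite /dot (bigD1 i) //= -expr2 lerDl.
by apply: sumr_ge0 => j _; rewrite -expr2 sqr_ge0.
Qed.

Lemma norm_le_dot m (x : 'rV[R]_m) : `|x| ^+ 2 <= dot x x.
Proof.
rewrite -[dot x x]sqr_sqrtr ?dot_ge0 // ler_sqr ?nnegrE ?sqrtr_ge0 //.
apply: norm_rV_le => [|j]; first exact: sqrtr_ge0.
by rewrite -sqrtr_sqr ler_sqrt ?dot_ge0 // sqr_coord_le_dot.
Qed.

End Dot.

Lemma open_preimage_on (T S : topologicalType) (U : set T) (f : T -> S) (O : set S) :
  open U -> (forall x, U x -> {for x, continuous f}) -> open O ->
  open (U `&` f @^-1` O).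
Proof.
move=> oU cf oO; rewrite openE => x [Ux Ofx]; rewrite /interior.
apply: filterI; first exact: open_nbhs_nbhs.
by apply: (cf x Ux); exact: open_nbhs_nbhs.
Qed.

(** * Local sections of the projection to the spacelike factor *)

Section Patches.
Variables (R : realType) (n p : nat) (M : smooth_manifold R n).
Variable X : M -> 'rV[R]_(n + p).
Hypotheses (X_immersion : immersion X) (X_spacelike : spacelike X).

(* The projection to the spacelike factor: a local diffeomorphism, since the
   kernel of [lsubmx] is negative definite. *)
Definition space_part (m : M) : 'rV[R]_n := lsubmx (X m).
Local Notation F := space_part.

Section Chart.
Variable c : chart R n M.
Hypothesis c_atlas : atlas c.

Lemma chart_map_for x : chart_dom c x -> {for x, continuous c}.
Proof.
move=> cx; have := @chart_map_continuous _ _ _ c.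
by rewrite continuous_open_subspace => [/(_ x (mem_set cx))//|]; exact: chart_dom_open.
Qed.

Lemma chart_inv_for v : (c @` chart_dom c) v -> {for v, continuous (chart_inv c)}.
Proof.
move=> cv; have := @chart_inv_continuous _ _ _ c.
by rewrite continuous_open_subspace => [/(_ v (mem_set cv))//|]; exact: chart_img_open.
Qed.

Lemma chart_invP v : (c @` chart_dom c) v ->
  chart_dom c (chart_inv c v) /\ c (chart_inv c v) = v.
Proof. by move=> [x cx <-]; rewrite chart_mapK. Qed.

Lemma chart_img_openI (O : set M) : open O -> open (c @` (chart_dom c `&` O)).
Proof.
move=> oO.
have -> : c @` (chart_dom c `&` O) = (c @` chart_dom c) `&` chart_inv c @^-1` O.
  apply/seteqP; split=> v /=.
    by move=> [x [cx Ox] <-]; rewrite chart_mapK //; split=> //; exists x.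
  by move=> [[x cx <-]]; rewrite chart_mapK // => Ox; exists x.
by apply: open_preimage_on => //; [exact: chart_img_open|exact: chart_inv_for].
Qed.

Lemma smooth_map_Ck m (O : set M) (W : M -> 'rV[R]_m) k i : open O ->
  (forall k, Ck_on k (c @` (chart_dom c `&` O)) (W \o chart_inv c)) ->
  Ck k (c @` (chart_dom c `&` O)) (fun v => W (chart_inv c v) 0 i).
Proof.
move=> oO H.
by apply: (@Ck_of_coord_on _ _ _ _ _ (W \o chart_inv c)); [exact: chart_img_openI|exact: H].
Qed.

Lemma X_chart_Ck k i : Ck k (c @` chart_dom c) (fun v => X (chart_inv c v) 0 i).
Proof.
have := @smooth_map_Ck _ setT X k i openT.
by rewrite setIT; apply => k'; have := X_immersion.1 c c_atlas k'; rewrite setIT.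
Qed.

Lemma F_chart_Ck k i : Ck k (c @` chart_dom c) (fun v => F (chart_inv c v) 0 i).
Proof.
apply: (@eq_Ck _ _ k _ (fun v => X (chart_inv c v) 0 (lshift p i))).
- exact: chart_img_open.
- by move=> v _; rewrite mxE.
- exact: X_chart_Ck.
Qed.

Lemma X_chart_derive v x i : (c @` chart_dom c) x ->
  'D_v (X \o chart_inv c) x 0 i = 'D_v (fun y => X (chart_inv c y) 0 i) x.
Proof.
move=> cx; rewrite (@derive_rV _ _ _ (X \o chart_inv c)) ?mxE // => j.
exact: (Ck_derivable (X_chart_Ck 1 j) cx).
Qed.

End Chart.

Lemma X_continuous : continuous X.
Proof.
move=> m; have [c ca cm] := atlas_cover m.
have ccm : (c @` chart_dom c) (c m) by exists m.
have H : {for m, continuous (X \o chart_inv c \o c)}.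
  apply: continuous_comp; first exact: chart_map_for.
  apply: continuous_rV => j; exact: (Ck_continuous (X_chart_Ck ca 0 j) ccm).
apply: (near_continuous _ H).
apply: (filterS _ (open_nbhs_nbhs (conj (@chart_dom_open _ _ _ c) cm))) => x cx /=.
by rewrite chart_mapK.
Qed.

Lemma F_continuous : continuous F.
Proof.
move=> m; apply: continuous_rV => j.
rewrite (_ : (fun y => F y 0 j) = (fun y => X y 0 (lshift p j))); last first.
  by apply/funext => y; rewrite mxE.
apply: (@continuous_comp _ _ _ X (fun v : 'rV[R]_(n + p) => v 0 (lshift p j))).
  exact: X_continuous.
exact/coord_continuous.
Qed.

(** The source is an arbitrary normed space so that sections over R^n and curves share one notion of
    smoothness. *)
Definition chart_smooth_on (V : normedModType R) (B : set V) (G : V -> M) : Prop :=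
  [/\ open B, forall y, B y -> {for y, continuous G} &
    forall c, atlas c -> forall k i,
      Ck k (B `&` G @^-1` chart_dom c) (fun y => c (G y) 0 i)].

Record graph_patch (m : M) (e : R) (G : 'rV[R]_n -> M) : Prop := GraphPatch {
  patch_gt0 : 0 < e ;
  patch_center : G (F m) = m ;
  patchK : forall y, ball (F m) e y -> F (G y) = y ;
  patch_smooth : chart_smooth_on (ball (F m) e) G ;
  patch_open : open (G @` ball (F m) e)
}.

Lemma patch_exists m : exists e G, graph_patch m e G.
Proof.
have [c ca cm] := atlas_cover m.
pose f := F \o chart_inv c.
pose V := c @` chart_dom c.
have oV : open V by exact: chart_img_open.
have Vm : V (c m) by exists m.
have fm : f (c m) = F m by rewrite /f /= chart_mapK.
have fs k i : Ck k V (fun v => f v 0 i) by exact: F_chart_Ck.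
have [|W [e [Gc [[oW WV e0 GcF] [GcB GcK Wm Gcs]]]]] := @inverse_function R n V f (c m) oV Vm fs.
  move=> v; set J := \matrix_(j, i) _ => vJ.
  have dF i : 'D_v (fun y => f y 0 i) (c m) = 0.
    rewrite derive_sum_coord; last exact: (Ck_differentiable (fs 1 i) Vm).
    transitivity ((v *m J) 0 i); last by rewrite vJ mxE.
    by rewrite mxE; apply: eq_bigr => j _; congr (_ * _); rewrite mxE.
  pose w := chart_diff c X m v.
  have tw : tangent_space X m w by exists c, v.
  have lw : lsubmx w = 0.
    apply/rowP => i; rewrite mxE [RHS]mxE /w /chart_diff X_chart_derive //.
    rewrite -[RHS](dF i); congr ('D_v _ _).
    by apply/funext => y; rewrite mxE.
  have w0 : w = 0.
    apply/eqP/negPn/negP => w0; have := X_spacelike tw w0.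
    by rewrite innerE lw dot0l sub0r oppr_gt0 ltNge dot_ge0.
  apply: (X_immersion.2 c m ca cm); rewrite -/w w0.
  by rewrite /chart_diff derive0.
rewrite fm in GcF GcB Gcs.
pose B := ball (F m) e.
have oB : open B by exact: ball_open.
have GcV y : B y -> V (Gc y) by move=> /GcB [/WV].
pose G := chart_inv c \o Gc.
have cGc y : B y -> {for y, continuous Gc}.
  by move=> By; apply: continuous_rV => i; exact: (Ck_continuous (Gcs 0 i) By).
have cG y : B y -> {for y, continuous G}.
  move=> By; apply: continuous_comp; first exact: cGc.
  exact: (chart_inv_for (GcV y By)).
have GB y : B y -> chart_dom c (G y) /\ c (G y) = Gc y.
  by move=> By; apply: chart_invP; exact: GcV.
exists e, G; split=> //.
- by rewrite /G /= GcF chart_mapK.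
- by move=> y /GcB [].
- split=> // d da k i.
  have oU : open (B `&` G @^-1` chart_dom d).
    by apply: open_preimage_on => //; exact: chart_dom_open.
  apply: (@Ck_comp _ _ n k _ (c @` (chart_dom c `&` chart_dom d))
    (fun v => d (chart_inv c v) 0 i) Gc) => //.
  + by move=> y [By dGy]; have [? E] := GB y By; exists (G y).
  + apply: smooth_map_Ck; first exact: chart_dom_open.
    exact: atlas_compatible.
  + by move=> j; apply: (Ck_sub _ (Gcs k j)) => y [].
(* Because [Gc] inverts [f] on all of [W], the image is cut out by open conditions in the chart. *)
- have -> : G @` B = chart_dom c `&` c @^-1` (W `&` f @^-1` B).
    apply/seteqP; split=> x.
      move=> [y By <-]; have [dG E] := GB y By; split=> //=.
      by rewrite E; have [? ?] := GcB y By; split=> //=; rewrite (_ : f _ = y).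
    move=> [/= cx [Wx]]; rewrite /f /= chart_mapK // => BF.
    exists (F x) => //; rewrite /G /=.
    by have := GcK _ Wx; rewrite /f /= chart_mapK // => ->; rewrite chart_mapK.
  apply: open_preimage_on; [exact: chart_dom_open|exact: chart_map_for|].
  apply: open_preimage_on; [exact: oW| |exact: oB] => x Wx.
  by apply: continuous_rV => i; exact: (Ck_continuous (fs 0 i) (WV _ Wx)).
Qed.

End Patches.

(** * Uniqueness and smoothness of sections *)

Section Sections.
Variables (R : realType) (n p : nat) (M : smooth_manifold R n).
Variable X : M -> 'rV[R]_(n + p).
Hypotheses (X_immersion : immersion X) (X_spacelike : spacelike X).
Local Notation F := (space_part X).

Record section_on (U : set 'rV[R]_n) (s : 'rV[R]_n -> M) : Prop := SectionOn {
  section_open : open U ;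
  section_continuous : forall v, U v -> {for v, continuous s} ;
  sectionK : forall v, U v -> F (s v) = v
}.

Lemma patch_section m e G : graph_patch X m e G -> section_on (ball (F m) e) G.
Proof. by case=> e0 GF FG [oB cG _] _; split. Qed.

Lemma patch_invK m e G x : graph_patch X m e G -> (G @` ball (F m) e) x -> G (F x) = x.
Proof. by case=> e0 GF FG _ _ [y By <-]; rewrite FG. Qed.

Lemma patch_nbhs m e G : graph_patch X m e G -> nbhs m (G @` ball (F m) e).
Proof.
move=> [e0 GF FG _ oG]; apply: open_nbhs_nbhs; split=> //.
by exists (F m) => //; exact: ballxx.
Qed.

(** By continuity both sections stay in the image of one patch, on which the projection is
    injective. *)
Lemma section_near_eq U1 U2 s1 s2 v : section_on U1 s1 -> section_on U2 s2 ->
  U1 v -> U2 v -> s1 v = s2 v -> \forall w \near v, s1 w = s2 w.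
Proof.
move=> [oU1 c1 F1] [oU2 c2 F2] U1v U2v E.
have [e [G PG]] := patch_exists X_immersion X_spacelike (s1 v).
have N1 := patch_nbhs PG.
have N2 : nbhs (s2 v) (G @` ball (F (s1 v)) e) by rewrite -E.
have H1 : \forall w \near v, (G @` ball (F (s1 v)) e) (s1 w) := c1 v U1v _ N1.
have H2 : \forall w \near v, (G @` ball (F (s1 v)) e) (s2 w) := c2 v U2v _ N2.
have W1 : \forall w \near v, U1 w := open_nbhs_nbhs (conj oU1 U1v).
have W2 : \forall w \near v, U2 w := open_nbhs_nbhs (conj oU2 U2v).
near=> w.
have G1 : (G @` ball (F (s1 v)) e) (s1 w) by near: w.
have G2 : (G @` ball (F (s1 v)) e) (s2 w) by near: w.
have W1w : U1 w by near: w.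
have W2w : U2 w by near: w.
by rewrite -(patch_invK PG G1) -(patch_invK PG G2) F1 ?F2.
Unshelve. all: by end_near.
Qed.

Lemma section_near_neq U1 U2 s1 s2 v : section_on U1 s1 -> section_on U2 s2 ->
  U1 v -> U2 v -> s1 v <> s2 v -> \forall w \near v, s1 w <> s2 w.
Proof.
move=> [oU1 c1 F1] [oU2 c2 F2] U1v U2v /eqP neq.
have := @manifold_hausdorff _ _ M; rewrite open_hausdorff.
move=> /(_ _ _ neq) [[A B] /= [/set_mem A1 /set_mem B2] [oA oB /eqP AB]].
have H1 : \forall w \near v, A (s1 w) := c1 v U1v _ (open_nbhs_nbhs (conj oA A1)).
have H2 : \forall w \near v, B (s2 w) := c2 v U2v _ (open_nbhs_nbhs (conj oB B2)).
apply: filterS2 H1 H2 => w /= Aw Bw E.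
have : (A `&` B) (s1 w) by split=> //; rewrite E.
by rewrite AB.
Qed.

Lemma line_continuous (a b : 'rV[R]_n) : continuous (fun r : R => a + r *: b).
Proof.
move=> r; apply: cvgD; first exact: cvg_cst.
exact: scalel_continuous.
Qed.

(** Agreement and disagreement are both open along the segment, by the two preceding lemmas on
    sections, and a segment is connected. *)
Lemma sections_agree U1 U2 s1 s2 a b : section_on U1 s1 -> section_on U2 s2 ->
  (forall r : R, 0 <= r <= 1 -> U1 (a + r *: (b - a)) /\ U2 (a + r *: (b - a))) ->
  s1 a = s2 a -> s1 b = s2 b.
Proof.
move=> S1 S2 U12 Ea.
pose l (r : R) := a + r *: (b - a).
have cl : continuous l by exact: line_continuous.
pose I := `[0 : R, 1]%classic.
pose C := [set r : R | (U1 (l r) /\ U2 (l r)) /\ s1 (l r) = s2 (l r)].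
pose D := [set r : R | (U1 (l r) /\ U2 (l r)) /\ s1 (l r) <> s2 (l r)].
have nU r : U1 (l r) -> U2 (l r) -> \forall x \near r, U1 (l x) /\ U2 (l x).
  move=> h1 h2; have oU1 := section_open S1; have oU2 := section_open S2.
  have H1 : \forall x \near r, U1 (l x) := cl r _ (open_nbhs_nbhs (conj oU1 h1)).
  have H2 : \forall x \near r, U2 (l x) := cl r _ (open_nbhs_nbhs (conj oU2 h2)).
  by apply: filterS2 H1 H2 => x.
have oC : open C.
  rewrite openE => r [[h1 h2] E]; rewrite /interior.
  have H : \forall x \near r, s1 (l x) = s2 (l x) := cl r _ (section_near_eq S1 S2 h1 h2 E).
  by apply: filterS2 (nU r h1 h2) H => x.
have oD : open D.
  rewrite openE => r [[h1 h2] E]; rewrite /interior.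
  have H : \forall x \near r, s1 (l x) <> s2 (l x) := cl r _ (section_near_neq S1 S2 h1 h2 E).
  by apply: filterS2 (nU r h1 h2) H => x.
have IU r : I r -> U1 (l r) /\ U2 (l r).
  by rewrite /I /= in_itv /=; exact: U12.
have EI : I `&` C = I.
  apply: (@segment_connected R 0 1).
  - exists 0; split; first by rewrite /I /= in_itv /= lexx ler01.
    split; first by apply: IU; rewrite /I /= in_itv /= lexx ler01.
    by rewrite /l scale0r addr0.
  - by exists C.
  - exists (~` D); first by rewrite closedC.
    apply/seteqP; split=> r [Ir Hr]; split=> //.
      by move=> [_]; case: Hr => _ ->.
    by split; [exact: IU|apply: contrapT => E; apply: Hr; split=> //; exact: IU].
have : (I `&` C) 1 by rewrite EI /I /= in_itv /= ler01 lexx.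
by move=> [_ [_]]; rewrite /l scale1r addrC subrK.
Qed.

(** Continuity suffices: near each point the section coincides with a patch, which is smooth. *)
Lemma section_smooth U s : section_on U s -> chart_smooth_on U s.
Proof.
move=> Ss; have [oU cs Fs] := Ss; split=> // c ca k i.
apply: Ck_local => v [Uv sv].
have [e [G PG]] := patch_exists X_immersion X_spacelike (s v).
have [e0 GF FG [oB cG smG] oG] := PG.
have Bv : ball (F (s v)) e v by rewrite Fs //; exact: ballxx.
have Ev : s v = G v by rewrite -{1}GF Fs.
have N := section_near_eq Ss (patch_section PG) Uv Bv Ev.
pose U' := ball (F (s v)) e `&` G @^-1` chart_dom c `&` [set w | s w = G w]°.
have oU' : open U'.
  apply: openI; last exact: open_interior.
  by apply: open_preimage_on => //; exact: chart_dom_open.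
exists U'; first by split=> //; split=> //=; rewrite -Ev.
apply: (@eq_Ck _ _ k U' (fun y => c (G y) 0 i)) => //.
  by move=> w [_ /interior_subset /= ->].
by apply: (Ck_sub _ (smG c ca k i)) => w [].
Qed.

Lemma smooth_pullback (V : normedModType R) (B : set V) (G : V -> M)
    (O : set M) (W : M -> 'rV[R]_(n + p)) k i :
  chart_smooth_on B G -> open O -> smooth_map_on O W ->
  Ck k (B `&` G @^-1` O) (fun y => W (G y) 0 i).
Proof.
move=> [oB cG smG] oO smW; apply: Ck_local => v [Bv Ov].
have [c ca cv] := atlas_cover (G v).
have oc := @chart_dom_open _ _ _ c.
have oU : open (B `&` G @^-1` (chart_dom c `&` O)).
  by apply: open_preimage_on => //; exact: openI.
exists (B `&` G @^-1` (chart_dom c `&` O)); first by split.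
apply: (@eq_Ck _ _ k _ ((fun x => W (chart_inv c x) 0 i) \o (c \o G))) => //.
  by move=> w [_ [cw _]] /=; rewrite chart_mapK.
apply: (@Ck_comp _ _ n k _ (c @` (chart_dom c `&` O))) => //.
- by move=> w [_ H]; exists (G w).
- by apply: smooth_map_Ck => // k'; exact: smW.
- by move=> j; apply: (Ck_sub _ (smG c ca k j)) => w [? []].
Qed.

Lemma X_pullback (V : normedModType R) (B : set V) (G : V -> M) k i :
  chart_smooth_on B G -> Ck k B (fun y => X (G y) 0 i).
Proof.
move=> HG; have := smooth_pullback k i HG openT X_immersion.1.
by rewrite preimage_setT setIT.
Qed.

Lemma chart_smooth_comp (V : normedModType R) (B : set V) (G : V -> 'rV[R]_n)
    (U : set 'rV[R]_n) s : open B -> (forall v, B v -> U (G v)) ->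
  (forall k i, Ck k B (fun y => G y 0 i)) -> chart_smooth_on U s ->
  chart_smooth_on (M := M) B (s \o G).
Proof.
move=> oB BU smG [oU cs sms].
have cG v : B v -> {for v, continuous G}.
  by move=> Bv; apply: continuous_rV => i; exact: (Ck_continuous (smG 0 i) Bv).
have csG v : B v -> {for v, continuous (s \o G)}.
  by move=> Bv; apply: continuous_comp; [exact: cG|exact/cs/BU].
split=> // c ca k i.
apply: (@Ck_comp _ _ n k _ (U `&` s @^-1` chart_dom c) (fun y => c (s y) 0 i) G).
- by apply: open_preimage_on => //; exact: chart_dom_open.
- by move=> x [Bx cx]; split=> //; exact: BU.
- exact: sms.
- by move=> j; apply: (Ck_sub _ (smG k j)) => x [].
Qed.

Lemma derive_tangent (V : normedModType R) (B : set V) (G : V -> M) y v :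
  chart_smooth_on B G -> B y -> tangent_space X (G y) ('D_v (X \o G) y).
Proof.
move=> HG By; have [oB cG smG] := HG.
have [c ca cv] := atlas_cover (G y).
exists c, ('D_v (c \o G) y); split=> //.
have BGy : (B `&` G @^-1` chart_dom c) y by split.
have dcG j : differentiable (fun w => c (G w) 0 j) y.
  exact: (Ck_differentiable (smG c ca 1 j) BGy).
have cGy : (c @` chart_dom c) (c (G y)) by exists (G y).
have dXG j : derivable (fun w => X (G w) 0 j) y v.
  exact: (Ck_derivable (X_pullback 1 j HG) By).
rewrite /chart_diff; apply/rowP => j.
rewrite (@derive_rV _ _ _ (X \o G)) // mxE X_chart_derive //.
have -> : 'D_v (fun w => X (G w) 0 j) y =
    'D_v ((fun x => X (chart_inv c x) 0 j) \o (c \o G)) y.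
  have N : \forall w \near y, chart_dom c (G w).
    exact: (cG y By _ (open_nbhs_nbhs (conj (@chart_dom_open _ _ _ c) cv))).
  by apply: near_eq_derive; apply: filterS N => w cw /=; rewrite chart_mapK.
have dXc := Ck_differentiable (X_chart_Ck X_immersion ca 1 j) cGy.
rewrite (@derive_comp _ _ n (fun x => X (chart_inv c x) 0 j) (c \o G)) //.
rewrite [RHS](@derive_sum_coord R n (fun x => X (chart_inv c x) 0 j)) //.
apply: eq_bigr => l _; congr (_ * _); rewrite derive_rV ?mxE // => l'.
exact: diff_derivable.
Qed.

Lemma derive_space_part (V : normedModType R) (B : set V) (G : V -> M) y v :
  chart_smooth_on B G -> B y -> lsubmx ('D_v (X \o G) y) = 'D_v (F \o G) y.
Proof.
move=> HG By.
have dXG j : derivable (fun w => X (G w) 0 j) y v.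
  exact: (Ck_derivable (X_pullback 1 j HG) By).
have EF j : (fun w => F (G w) 0 j) = (fun w => X (G w) 0 (lshift p j)).
  by apply/funext => w; rewrite mxE.
rewrite (@derive_rV _ _ _ (X \o G)) // (@derive_rV _ _ _ (F \o G)) => [|j].
  by apply/rowP => j; rewrite !mxE /= EF.
by rewrite /= EF.
Qed.

Lemma derive_section U s y v : section_on U s -> U y ->
  lsubmx ('D_v (X \o s) y) = v.
Proof.
move=> Ss Uy; have [oU _ Fs] := Ss.
rewrite (derive_space_part _ (section_smooth Ss)) //.
rewrite (@near_eq_derive _ _ _ _ id) ?derive_id //.
by apply: (filterS _ (open_nbhs_nbhs (conj oU Uy))) => w /Fs.
Qed.

Lemma section_inner_gt0 U s y v : section_on U s -> U y -> v != 0 ->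
  0 < inner ('D_v (X \o s) y) ('D_v (X \o s) y).
Proof.
move=> Ss Uy v0; apply: X_spacelike; first exact: (derive_tangent v (section_smooth Ss) Uy).
by apply: contra v0 => /eqP E; rewrite -(derive_section v Ss Uy) E; apply/eqP/rowP => i; rewrite !mxE.
Qed.

End Sections.

(** * Differentials read through a section *)

Section TangentSections.
Variables (R : realType) (n p : nat) (M : smooth_manifold R n).
Variable X : M -> 'rV[R]_(n + p).
Hypotheses (X_immersion : immersion X) (X_spacelike : spacelike X).
Local Notation F := (space_part X).

Lemma section_invK U s y : section_on X U s -> U y ->
  \forall x \near s y, s (F x) = x.
Proof.
move=> Ss Uy; have [oU cs Fs] := Ss.
have [e [G PG]] := patch_exists X_immersion X_spacelike (s y).
have [e0 GF _ _ _] := PG.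
have By : ball (F (s y)) e y by rewrite Fs //; exact: ballxx.
have Ey : s y = G y by rewrite -{1}GF Fs.
have N := section_near_eq X_immersion X_spacelike Ss (patch_section PG) Uy By Ey.
have N' : \forall x \near s y, s (F x) = G (F x).
  have N1 : \forall w \near F (s y), s w = G w by rewrite Fs.
  exact: (F_continuous X_immersion N1).
have NG : \forall x \near s y, (G @` ball (F (s y)) e) x := patch_nbhs PG.
by apply: filterS2 N' NG => x -> /(patch_invK PG).
Qed.

Lemma smooth_map_section_Ck U s (O : set M) (W : M -> 'rV[R]_(n + p)) k i :
  section_on X U s -> open O -> smooth_map_on O W ->
  Ck k (U `&` s @^-1` O) (fun y => W (s y) 0 i).
Proof.
move=> Ss oO smW.
exact: (smooth_pullback k i (section_smooth X_immersion X_spacelike Ss) oO smW).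
Qed.

(** Eliminates charts: near the point, the inverse chart is [s] composed with the projection read in
    the chart, so the chain rule expresses every differential as a derivative along a vector of
    R^n. *)
Lemma chart_diff_section U s (O : set M) (W : M -> 'rV[R]_(n + p)) y c v :
  section_on X U s -> U y -> open O -> O (s y) -> smooth_map_on O W ->
  atlas c -> chart_dom c (s y) ->
  chart_diff c W (s y) v = 'D_(lsubmx (chart_diff c X (s y) v)) (W \o s) y.
Proof.
move=> Ss Uy oO Osy smW ca cy; have [oU cs Fs] := Ss.
have cDy : (c @` chart_dom c) (c (s y)) by exists (s y).
have cOy : (c @` (chart_dom c `&` O)) (c (s y)) by exists (s y).
pose f := F \o chart_inv c.
have fy : f (c (s y)) = y by rewrite /f /= chart_mapK // Fs.
have df j : differentiable (fun x => f x 0 j) (c (s y)).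
  exact: (Ck_differentiable (F_chart_Ck X_immersion ca 1 j) cDy).
have Ea : lsubmx (chart_diff c X (s y) v) = 'D_v f (c (s y)).
  apply/rowP => j; rewrite mxE /chart_diff X_chart_derive //.
  rewrite derive_rV => [|l]; last exact: diff_derivable.
  by rewrite mxE; congr ('D_v _ _); apply/funext => x; rewrite mxE.
have dW i : differentiable (fun x => W (s x) 0 i) y.
  exact: (Ck_differentiable (smooth_map_section_Ck 1 i Ss oO smW) (conj Uy Osy)).
have dWc i : derivable (fun x => W (chart_inv c x) 0 i) (c (s y)) v.
  apply: (Ck_derivable (k := 0)); last exact: cOy.
  by apply: smooth_map_Ck => // k'; exact: smW.
have N : \forall x \near c (s y), s (F (chart_inv c x)) = chart_inv c x.
  have N1 : \forall x \near chart_inv c (c (s y)), s (F x) = x.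
    by rewrite chart_mapK //; exact: section_invK Ss Uy.
  have cc := chart_inv_for cDy; exact: (cc _ N1).
rewrite Ea /chart_diff (@derive_rV _ _ _ (W \o chart_inv c)) //.
rewrite (@derive_rV _ _ _ (W \o s)) => [|i]; last exact: diff_derivable.
apply/rowP => i; rewrite !mxE.
rewrite (@near_eq_derive _ _ _ _ ((fun x => W (s x) 0 i) \o f)); last first.
  by apply: filterS N => x /= ->.
rewrite derive_comp ?fy // derive_sum_coord //.
apply: eq_bigr => j _; congr (_ * _).
by rewrite derive_rV ?mxE // => l; exact: diff_derivable.
Qed.

Lemma tangent_sectionP U s y w : section_on X U s -> U y ->
  tangent_space X (s y) w -> w = 'D_(lsubmx w) (X \o s) y.
Proof.
move=> Ss Uy [c [v [ca cy ->]]].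
exact: (chart_diff_section _ Ss Uy openT I X_immersion.1 ca cy).
Qed.

End TangentSections.

(** * Uniform positivity over compact sets *)

Section PosDef.
Variable R : realType.

Lemma continuous_big_sum (T : topologicalType) (I : finType) (f : I -> T -> R) x :
  (forall i, {for x, continuous (f i)}) ->
  {for x, continuous (fun y => \sum_i f i y)}.
Proof.
move=> cf; elim: (index_enum I) => [|i r IH].
  rewrite (_ : (fun y => _) = fun=> 0); first exact: cst_continuous.
  by apply/funext => y; rewrite big_nil.
rewrite (_ : (fun y => _) = fun y => f i y + \sum_(j <- r) f j y).
  exact: continuousD.
by apply/funext => y; rewrite big_cons.
Qed.

Lemma sphere_compact n : compact [set v : 'rV[R]_n | dot v v = 1].
Proof.
apply: (@subclosed_compact _ _ [set v | `|0 - v| <= 1]).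
- apply: (@closed_comp _ _ (fun v : 'rV[R]_n => dot v v) [set (1 : R)]) => [v _|].
    suff H : Ck 0 setT (fun v : 'rV[R]_n => dot v v) by exact: (Ck_continuous H).
    apply: Ck_sum => [|i _]; first exact: openT.
    by apply: CkM; do ?[exact: openT]; apply: Ck_coord; exact: openT.
  exact: closed_eq.
- exact: closed_ball_rV_compact.
- move=> v /= v1; rewrite sub0r normrN; have := norm_le_dot v; rewrite v1.
  by rewrite -[X in _ <= X](expr1n _ 2) ler_sqr ?nnegrE.
Qed.

(** The constant is the minimum of the form over [K] times the unit sphere; homogeneity extends the
    bound to all vectors. *)
Lemma posdef_lower_bound (T : topologicalType) n (K : set T) (g : 'I_n -> 'I_n -> T -> R) :
  compact K -> (forall i j y, K y -> {for y, continuous (g i j)}) ->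
  (forall y (v : 'rV[R]_n), K y -> v != 0 ->
     0 < \sum_i \sum_j v 0 i * v 0 j * g i j y) ->
  exists2 k : R, 0 < k & forall y (v : 'rV[R]_n), K y ->
    k * dot v v <= \sum_i \sum_j v 0 i * v 0 j * g i j y.
Proof.
move=> cK cg pos.
pose q y (v : 'rV[R]_n) := \sum_i \sum_j v 0 i * v 0 j * g i j y.
pose S := [set v : 'rV[R]_n | dot v v = 1].
have cS : compact S by exact: sphere_compact.
(* The product is empty when [K] is empty or in dimension 0, where no minimum exists but any
   constant works. *)
have [Z|/set0P [[y0 v0] [/= Ky0 Sv0]]] := eqVneq (K `*` S) set0.
  exists 1 => // y v Ky; have [->|v0] := eqVneq v 0.
    rewrite dot0l mulr0; apply: sumr_ge0 => i _; apply: sumr_ge0 => j _.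
    by rewrite mxE !mul0r.
  exfalso; have d0 := dot_gt0 v0.
  have : (K `*` S) (y, (Num.sqrt (dot v v))^-1 *: v).
    split=> //; rewrite /S /= dotZl dotZr mulrA -invfM -expr2 sqr_sqrtr ?ltW //.
    by rewrite mulVf // gt_eqF.
  by rewrite Z.
have cq : {within K `*` S, continuous (fun x : T * 'rV[R]_n => q x.1 x.2)}.
  apply: continuous_in_subspaceT => -[y v] /set_mem [/= Ky _].
  apply: continuous_big_sum => i; apply: continuous_big_sum => j.
  have c2 l : {for (y, v), continuous (fun x : T * 'rV[R]_n => x.2 0 l : R)}.
    apply: (@continuous_comp _ _ _ snd (fun v : 'rV[R]_n => v 0 l)); first exact: cvg_snd.
    exact/coord_continuous.
  apply: continuousM; first by apply: continuousM; exact: c2.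
  apply: (@continuous_comp _ _ _ fst (g i j)); first exact: cvg_fst.
  exact: cg.
have [[y1 v1] /set_mem [/= Ky1 Sv1] Hmin] := @compact_EVT_min _ _ _ _
   (ex_intro _ (y0, v0) (conj Ky0 Sv0) : K `*` S !=set0) (compact_setX cK cS) cq.
have v10 : v1 != 0.
  by apply/eqP => Z; move: Sv1; rewrite /S /= Z dot0l => /eqP; rewrite eq_sym oner_eq0.
exists (q y1 v1); first exact: pos.
move=> y v Ky; have [->|vn0] := eqVneq v 0.
  rewrite dot0l mulr0; apply: sumr_ge0 => i _; apply: sumr_ge0 => j _.
  by rewrite mxE !mul0r.
have d0 := dot_gt0 vn0.
pose u := (Num.sqrt (dot v v))^-1 *: v.
have Su : S u.
  rewrite /S /= dotZl dotZr mulrA -invfM -expr2 sqr_sqrtr ?ltW //.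
  by rewrite mulVf // gt_eqF.
have := Hmin (y, u) (mem_set (conj Ky Su)).
have -> : q y u = (dot v v)^-1 * q y v.
  rewrite /q mulr_sumr; apply: eq_bigr => i _; rewrite mulr_sumr; apply: eq_bigr => j _.
  rewrite !mxE.
  have -> : (dot v v)^-1 = (Num.sqrt (dot v v))^-1 * (Num.sqrt (dot v v))^-1.
    by rewrite -invfM -expr2 sqr_sqrtr // ltW.
  by ring.
by rewrite ler_pdivlMl // mulrC.
Qed.

End PosDef.

(** * Lengths of curves *)

Section Increment.
Variable R : realType.
Local Notation mu := (@lebesgue_measure R).

(** With [P] the primitive of [f], the function [K * P - h] has a nonnegative derivative, so only
    the continuous [f] is ever integrated. *)
Lemma increment_le_integral (f h : R -> R) (K : R) (O : set R) :
  `[0, 1] `<=` O -> (forall t, O t -> {for t, continuous f}) ->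
  (forall t, O t -> derivable h t 1) ->
  (forall t, O t -> 'D_1 h t <= K * f t) ->
  h 1 - h 0 <= K * \int[mu]_(t in `[0, 1]) f t.
Proof.
move=> IO cf dh hf.
have I01 (t : R) : 0 <= t <= 1 -> O t by move=> t01; apply: IO; rewrite /= in_itv.
have cI : {within `[0, 1], continuous f}.
  by apply: continuous_in_subspaceT => t /set_mem; rewrite /= in_itv /= => /I01/cf.
have intf : mu.-integrable `[0, 1] (EFin \o f).
  by apply: continuous_compact_integrable => //; exact: segment_compact.
pose P x := \int[mu]_(t in `[0, x]) f t.
have cP : {within `[0, 1], continuous P} by exact: parameterized_integral_continuous.
have dP (t : R) : t \in `]0, 1[%R -> derivable P t 1 /\ derive1 P t = f t.
  rewrite in_itv /= => /andP[t0 t1].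
  apply: (continuous_FTC1 t1 intf); first by rewrite /= lte_fin.
  by apply/cf/I01; rewrite !ltW.
pose g t := K * P t - h t.
have dg (t : R) : t \in `]0, 1[%R -> is_derive t 1 g (K * f t - 'D_1 h t).
  move=> t01; have [dPt EP] := dP t t01.
  have /andP[t0 t1] : 0 < t < 1 by move: t01; rewrite in_itv.
  have Pt := DeriveDef dPt (etrans (esym (derive1E P t)) EP).
  have ht : is_derive t 1 h ('D_1 h t).
    by apply/derivableP/dh/I01; rewrite !ltW.
  apply: is_deriveB; have := @is_deriveZ R R R P K t 1 (f t) Pt; exact.
have cg : {within `[0, 1], continuous g}.
  have cKP : {within `[0, 1], continuous (fun t => K * P t)}.
    by move=> x; apply: cvgM; [exact: cvg_cst|exact: cP].
  have ch : {within `[0, 1], continuous h}.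
    by apply: derivable_within_continuous => t; rewrite in_itv /= => /I01/dh.
  exact: within_continuousB cKP ch.
have g01 : g 0 <= g 1.
  have dgt (t : R) : t \in `]0, 1[%R -> derivable g t 1 by move=> /dg [].
  have dg0 (t : R) : t \in `]0, 1[%R -> 0 <= derive1 g t.
    move=> t01; have [_] := dg t t01; rewrite derive1E => ->; rewrite subr_ge0.
    by apply/hf/I01; move: t01; rewrite in_itv /= => /andP[? ?]; rewrite !ltW.
  have I0 : (0 : R) \in `[0, 1]%R by rewrite in_itv /= lexx ler01.
  have I1 : (1 : R) \in `[0, 1]%R by rewrite in_itv /= lexx ler01.
  exact: (ger0_derive1_le_cc dgt dg0 cg I0 I1 ler01).
move: g01; rewrite /g.
have -> : P 0 = 0 by rewrite /P set_itv1 Rintegral_set1.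
by rewrite /P; lra.
Qed.

(* A C^1 cutoff: the square removes the corner at 1. *)
Definition sqr_ramp (s : R) : R := Num.max 0 (1 - s) ^+ 2.

Lemma is_derive_sqr_ramp (s : R) : is_derive s (1 : R) sqr_ramp (- (2 * Num.max 0 (1 - s))).
Proof.
have key (h : R) : `|sqr_ramp (s + h) - sqr_ramp s - (- (2 * Num.max 0 (1 - s))) * h| <= h ^+ 2.
  rewrite /sqr_ramp ler_norml.
  by have [h1|h1] := leP (1 - s) 0; have [h2|h2] := leP (1 - (s + h)) 0;
    apply/andP; split; nra.
set a := - (2 * _) in key *.
have [||d E] := @differentiable_eps R R R sqr_ramp s ( *:%R a : {linear R -> R}).
- exact: scaler_continuous.
- move=> e e0; near=> h.
  have he : h ^+ 2 <= e * `|h|.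
    by rewrite -(real_normK (num_real h)) expr2 ler_wpM2r //; near: h; exact: nbhs0_le.
  exact: le_trans (key h) he.
apply: DeriveDef; first exact: diff_derivable.
by rewrite deriveE // E /= [_ *: _]mulr1.
Unshelve. all: by end_near.
Qed.

(** The factor [n] is the price of pairing the sup norm of [x] with the Euclidean length of [y]. *)
Lemma dot_bound n (x y : 'rV[R]_n) : `|dot x y| <= n%:R * (`|x| * Num.sqrt (dot y y)).
Proof.
apply: (le_trans (ler_norm_sum _ _ _)).
apply: (@le_trans _ _ (\sum_(i < n) (`|x| * Num.sqrt (dot y y)))).
  apply: ler_sum => i _; rewrite normrM; apply: ler_pM => //; first exact: le_norm_coord.
  by rewrite -sqrtr_sqr ler_sqrt ?dot_ge0 // sqr_coord_le_dot.
by rewrite sumr_const card_ord -[leLHS]mulr_natl.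
Qed.

End Increment.

(** * Curves on the submanifold and its distance *)

Section Metric.
Variables (R : realType) (n p : nat) (M : smooth_manifold R n).
Variable X : M -> 'rV[R]_(n + p).
Hypotheses (X_immersion : immersion X) (X_spacelike : spacelike X).
Local Notation F := (space_part X).
Local Notation mu := (@lebesgue_measure R).

Lemma smooth_curve_chart (g : R -> M) : smooth_curve g ->
  exists2 O : set R^o, `[0, 1] `<=` O & chart_smooth_on (V := R^o) O g.
Proof.
move=> [D [oO sIO cg sg]]; exists D => //.
have cg' (t : R^o) : D t -> {for t, continuous (g : R^o -> M)}.
  by move: cg; rewrite continuous_open_subspace // => cg Ot; exact: (cg t (mem_set Ot)).
split=> // c ca k i.
apply: (@Ck_of_coord_on_R R n k _ (c \o g)); last exact: sg.
by apply: open_preimage_on => //; exact: chart_dom_open.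
Qed.

Lemma chart_smooth_curve (O : set R^o) (g : R^o -> M) : `[0, 1] `<=` O ->
  chart_smooth_on O g -> smooth_curve (g : R -> M).
Proof.
move=> sIO [oO cg sg]; exists O; split=> //.
  by rewrite continuous_open_subspace // => t /set_mem; exact: cg.
move=> c ca k; apply: Ck_on_of_Ck => [|i]; last exact: sg.
by apply: open_preimage_on => //; exact: chart_dom_open.
Qed.

Definition speed (g : R -> M) (t : R) : R :=
  Num.sqrt (inner (derive1 (X \o g) t) (derive1 (X \o g) t)).

Lemma speed_continuous (O : set R^o) (g : R^o -> M) t :
  chart_smooth_on O g -> O t -> {for t, continuous (speed g)}.
Proof.
move=> sg Ot; have oO : open O by case: sg.
have E j (x : R^o) : O x ->
    derive1 (X \o g : R -> _) x 0 j = 'D_1 (fun t : R^o => X (g t) 0 j) x.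
  move=> Ox; rewrite derive1E derive_rV ?mxE // => l.
  exact: (Ck_derivable (X_pullback X_immersion 1 l sg) Ox).
have c j : {for t, continuous (fun x : R => derive1 (X \o g : R -> _) x 0 j)}.
  have H := Ck_continuous (Ck_derive (1 : R^o) (X_pullback X_immersion 1 j sg)) Ot.
  apply: (near_continuous _ H).
  by apply: (filterS _ (open_nbhs_nbhs (conj oO Ot))) => x /E ->.
apply: continuous_comp; last exact: sqrt_continuous.
by apply: continuousB; apply: continuous_big_sum => i; apply: continuousM; exact: c.
Qed.

Lemma curve_length_ge0 (g : R -> M) : 0 <= curve_length X g.
Proof. by apply: Rintegral_ge0 => t _; exact: sqrtr_ge0. Qed.

Lemma curve_length_le (O : set R^o) (g : R^o -> M) (L : R) :
  `[0, 1] `<=` O -> chart_smooth_on O g ->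
  (forall t : R, 0 <= t <= 1 -> speed g t <= L) -> curve_length X g <= L.
Proof.
move=> sIO sg H.
have -> : L = \int[mu]_(t in `[0, 1]) (cst L t).
  rewrite Rintegral_cst //= lebesgue_measure_itv /= lte_fin ltr01 /= oppr0 addr0.
  by rewrite /= mulr1.
have intc (f : R -> R) : {in `[0, 1]%classic, continuous f} -> mu.-integrable `[0, 1] (EFin \o f).
  move=> cf; apply: continuous_compact_integrable; first exact: segment_compact.
  exact: continuous_in_subspaceT.
have i1 : mu.-integrable `[0, 1] (EFin \o speed g).
  by apply: intc => t /set_mem /sIO Ot; exact: (speed_continuous sg Ot).
have i2 : mu.-integrable `[0, 1] (EFin \o cst L).
  by apply: intc => t _; exact: cst_continuous.
apply: (le_Rintegral _ i1 i2); first exact: measurable_itv.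
by move=> t; rewrite /= in_itv /= => /H.
Qed.

Lemma speed_space_part (O : set R^o) (g : R^o -> M) (t : R) :
  chart_smooth_on O g -> O t ->
  speed g t <= Num.sqrt (dot ('D_1 (F \o g : R^o -> _) t) ('D_1 (F \o g : R^o -> _) t)).
Proof.
move=> sg Ot; rewrite /speed derive1E ler_sqrt ?dot_ge0 // innerE.
by rewrite (derive_space_part X_immersion (1 : R^o) sg Ot) lerBlDr lerDl dot_ge0.
Qed.

Lemma section_segment U s a b : section_on X U s ->
  (forall r : R, 0 <= r <= 1 -> U (a + r *: (b - a))) ->
  smooth_curve (fun r : R => s (a + r *: (b - a))) /\
  curve_length X (fun r : R => s (a + r *: (b - a))) <= Num.sqrt (dot (b - a) (b - a)).
Proof.
move=> Ss HU; have [oU cs Fs] := Ss.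
pose l (r : R^o) := a + r *: (b - a).
have cl : continuous l by exact: line_continuous.
pose O := l @^-1` U.
have oO : open O by apply: open_comp => // r _; exact: cl.
have sIO : `[0, 1] `<=` O by move=> r; rewrite /= in_itv /=; exact: HU.
have dl (r : R^o) : is_derive r (1 : R^o) l (b - a).
  apply/is_derive_lineP; exact: is_derive_id.
have smO k i : Ck k O (fun r : R^o => l r 0 i).
  apply: (@eq_Ck _ _ k O (fun r : R^o => a 0 i + r * (b - a) 0 i)) => //.
    by move=> r _; rewrite !mxE.
  apply: CkD => //; first exact: Ck_cst.
  apply: CkM => //; last exact: Ck_cst.
  case: k => [|k]; first by move=> r _; exact: cvg_id.
  split=> [r _|v]; first exact: (ex_diff (f := id)).
  by apply: (@eq_Ck _ _ k O (fun=> v)) => // [r _|]; [rewrite derive_id|exact: Ck_cst].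
have sg : chart_smooth_on O (s \o l).
  apply: (chart_smooth_comp _ _ smO (section_smooth X_immersion X_spacelike Ss)) => //.
split; first exact: chart_smooth_curve sIO sg.
apply: (curve_length_le sIO sg) => t t01.
have Ot : O t by exact: HU.
apply: (le_trans (speed_space_part sg Ot)).
have -> : 'D_1 (F \o (s \o l) : R^o -> _) t = b - a.
  rewrite (@near_eq_derive _ _ _ _ l); first by have [_] := dl t.
  by apply: (filterS _ (open_nbhs_nbhs (conj oO Ot))) => r Or /=; rewrite Fs.
exact: lexx.
Qed.

Lemma piecewise_smooth_cat (s1 s2 : seq (R -> M)) x y z :
  piecewise_smooth s1 x y -> piecewise_smooth s2 y z -> piecewise_smooth (s1 ++ s2) x z.
Proof.
elim: s1 x => [|g s1 IH] x /= => [->//|[sg g0 H] H2]; split=> //; exact: IH.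
Qed.

Lemma patch_joined m e G x y : graph_patch X m e G ->
  (G @` ball (F m) e) x -> (G @` ball (F m) e) y ->
  exists2 g : R -> M, piecewise_smooth [:: g] x y &
    curve_length X g <= Num.sqrt (dot (F y - F x) (F y - F x)).
Proof.
move=> PG Nx Ny; have Sg := patch_section PG.
have inB z : (G @` ball (F m) e) z -> ball (F m) e (F z).
  by move=> [v Bv <-]; rewrite (sectionK Sg).
have [|g L] := @section_segment _ _ (F x) (F y) Sg.
  by move=> r; apply: ball_segment; exact: inB.
exists (fun r : R => G (F x + r *: (F y - F x))) => //=; split=> //.
  by rewrite scale0r addr0; exact: (patch_invK PG Nx).
by rewrite scale1r addrC subrK; exact: (patch_invK PG Ny).
Qed.

(** Makes [distance] an infimum over a nonempty set rather than a default value. The reachable set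
    is open and closed, since lifted segments join any two points of a patch. *)
Lemma all_joined (x y : M) : connected [set: M] -> exists s, piecewise_smooth s x y.
Proof.
move=> cM; pose A := [set z | exists s, piecewise_smooth s x z].
suff AT : A = [set: M] by have : [set: M] y by []; rewrite -AT.
have step (m : M) : exists2 N, nbhs m N & forall z w, N z -> N w -> A z -> A w.
  have [e [G PG]] := patch_exists X_immersion X_spacelike m.
  exists (G @` ball (F m) e); first exact: (patch_nbhs PG).
  move=> z w Nz Nw [s Hs]; have [g Hg _] := patch_joined PG Nz Nw.
  by exists (s ++ [:: g]); exact: piecewise_smooth_cat Hs Hg.
apply: cM.
- by exists x; exists [::].
- exists A; last by rewrite setTI.
  rewrite openE => m Am; have [N Nm H] := step m; rewrite /interior.
  by apply: filterS (Nm) => z Nz; apply: H Am => //; exact: nbhs_singleton.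
- exists A; last by rewrite setTI.
  move=> m clA; have [N Nm H] := step m.
  have [z [Az Nz]] := clA N Nm.
  by apply: H Az => //; exact: nbhs_singleton.
Qed.

Lemma distance_le (s : seq (R -> M)) x y : piecewise_smooth s x y ->
  distance X x y <= \sum_(g <- s) curve_length X g.
Proof.
move=> Hs; apply: ge_inf; last by exists s.
exists 0 => l [s' _ ->]; apply: sumr_ge0 => g _; exact: curve_length_ge0.
Qed.

Lemma distance_lt x y (r : R) : connected [set: M] -> distance X x y < r ->
  exists2 s, piecewise_smooth s x y & \sum_(g <- s) curve_length X g < r.
Proof.
move=> cM d; have [s0 Hs0] := all_joined x y cM.
have H : has_inf [set l | exists2 s, piecewise_smooth s x y &
                          l = \sum_(g <- s) curve_length X g].
  split; first by exists (\sum_(g <- s0) curve_length X g), s0.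
  by exists 0 => l [s' _ ->]; apply: sumr_ge0 => g _; exact: curve_length_ge0.
have dr : 0 < r - distance X x y by rewrite subr_gt0.
have [l [s Hs ->] Hl] := inf_adherent dr H.
by exists s => //; apply: (lt_le_trans Hl); rewrite /distance addrC subrK.
Qed.

End Metric.

Section DotDerive.
Variables (R : realType) (V : normedModType R).

Lemma derivable_coord n (f : V -> 'rV[R]_n) x v j : derivable f x v ->
  derivable (fun y => f y 0 j) x v.
Proof. by move=> df; have /derivable_mxP := df; exact. Qed.

Lemma derive_coord n (f : V -> 'rV[R]_n) x v j : derivable f x v ->
  'D_v (fun y => f y 0 j) x = 'D_v f x 0 j.
Proof. by move=> df; rewrite derive_mx // mxE. Qed.

Lemma is_derive_dot n (f g : V -> 'rV[R]_n) x v :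
  derivable f x v -> derivable g x v ->
  is_derive x v (fun y => dot (f y) (g y)) (dot ('D_v f x) (g x) + dot (f x) ('D_v g x)).
Proof.
move=> df dg.
have -> : (fun y => dot (f y) (g y)) =
    \sum_(i < n) (((fun y : V => f y 0 i) : V -> R) * ((fun y : V => g y 0 i) : V -> R)).
  by apply/funext => y; rewrite fct_sumE.
rewrite /dot -big_split /=; apply: is_derive_sum => i.
have dfi := derivable_coord (j := i) df; have dgi := derivable_coord (j := i) dg.
have H := is_deriveM (derivableP dfi) (derivableP dgi).
have Ef := derive_coord i df; have Eg := derive_coord i dg.
rewrite Ef Eg in H; apply: (is_derive_eq H).
by rewrite addrC; congr (_ + _); exact: mulrC.
Qed.

End DotDerive.

(** * Small distance implies closeness in the manifold topology *)

Section MetricTopology.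
Variables (R : realType) (n p : nat) (M : smooth_manifold R n).
Variable X : M -> 'rV[R]_(n + p).
Hypotheses (X_immersion : immersion X) (X_spacelike : spacelike X).
Local Notation F := (space_part X).

Lemma X_section_derivable (V : normedModType R) (B : set V) (G : V -> M) y v :
  chart_smooth_on B G -> B y -> derivable (X \o G) y v.
Proof.
move=> sG By; apply/derivable_mxP => i j; rewrite (ord1 i).
exact: (Ck_derivable (X_pullback X_immersion 1 j sG) By).
Qed.

Lemma F_pullback (V : normedModType R) (B : set V) (G : V -> M) k i :
  chart_smooth_on B G -> Ck k B (fun y => F (G y) 0 i).
Proof.
move=> sG; have [oB _ _] := sG.
apply: (@eq_Ck _ _ k B (fun y => X (G y) 0 (lshift p i))) => //.
  by move=> y _; rewrite mxE.
exact: X_pullback.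
Qed.

Lemma X_section_derive_sum U s y v : section_on X U s -> U y ->
  'D_v (X \o s) y = \sum_i v 0 i *: 'D_(delta_mx 0 i) (X \o s) y.
Proof.
move=> Ss Uy; have sG := section_smooth X_immersion X_spacelike Ss.
have dX w j := Ck_derivable (v := w) (X_pullback X_immersion 1 j sG) Uy.
apply/rowP => j; rewrite derive_rV // mxE summxE.
rewrite derive_sum_coord; last exact: (Ck_differentiable (X_pullback X_immersion 1 j sG) Uy).
by apply: eq_bigr => i _; rewrite mxE derive_rV // mxE.
Qed.

Lemma inner_suml (I : finType) (a : I -> R) (x : I -> 'rV[R]_(n + p)) z :
  inner (\sum_i a i *: x i) z = \sum_i a i * inner (x i) z.
Proof.
have innerDl u w : inner (u + w) z = inner u z + inner w z.
  by rewrite !innerE !raddfD /= !dotDl; ring.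
elim: (index_enum I) => [|i r IH]; first by rewrite !big_nil innerE !raddf0 !dot0l subrr.
by rewrite !big_cons innerDl IH !innerE !linearZ /= !dotZl; ring.
Qed.

Lemma innerC (x z : 'rV[R]_(n + p)) : inner x z = inner z x.
Proof. by rewrite !innerE (dotC (lsubmx x)) (dotC (rsubmx x)). Qed.

Lemma section_metric_bound U s (K : set 'rV[R]_n) : section_on X U s ->
  compact K -> K `<=` U -> exists2 k : R, 0 < k & forall y v, K y ->
    k * dot v v <= inner ('D_v (X \o s) y) ('D_v (X \o s) y).
Proof.
move=> Ss cK KU; have sG := section_smooth X_immersion X_spacelike Ss.
pose g i j y := inner ('D_(delta_mx 0 i) (X \o s) y) ('D_(delta_mx 0 j) (X \o s) y).
have gE i j y : g i j y = inner ('D_(delta_mx 0 i) (X \o s) y) ('D_(delta_mx 0 j) (X \o s) y) by [].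
have E y v : U y -> inner ('D_v (X \o s) y) ('D_v (X \o s) y) =
    \sum_i \sum_j v 0 i * v 0 j * g i j y.
  move=> Uy; rewrite [in LHS](X_section_derive_sum v Ss Uy) inner_suml.
  apply: eq_bigr => i _; rewrite innerC inner_suml mulr_sumr; apply: eq_bigr => j _.
  by rewrite mulrA [in LHS]innerC gE.
have [||k k0 Hk] := @posdef_lower_bound R _ n K g cK.
- move=> i j y Ky.
  have c w l : {for y, continuous (fun y => 'D_w (X \o s) y 0 l)}.
    have [oU _ _] := Ss.
    apply: (near_continuous _ (Ck_continuous (Ck_derive w (X_pullback X_immersion 1 l sG)) (KU y Ky))).
    apply: (filterS _ (open_nbhs_nbhs (conj oU (KU y Ky)))) => z Uz.
    by rewrite derive_coord //; exact: (X_section_derivable sG Uz).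
  by apply: continuousB; apply: continuous_big_sum => l; apply: continuousM; exact: c.
- by move=> y v Ky v0; rewrite -E; [exact: (section_inner_gt0 X_immersion X_spacelike Ss (KU _ Ky) v0)|exact: KU].
exists k => // y v Ky; rewrite E; [exact: Hk|exact: KU].
Qed.

(* The cutoff [H], equal to 1 at [m] and to 0 outside the patch, varies along a
   curve by at most a constant times its length. *)
Lemma distance_nbhs m e G r : connected [set: M] -> graph_patch X m e G ->
  0 < r < e -> exists2 rho : R, 0 < rho &
    forall x, distance X x m < rho -> (G @` ball (F m) r) x.
Proof.
move=> cM PG /andP[r0 re]; have Sg := patch_section PG.
have [e0 GF FG sG oG] := PG.
pose K0 := [set y : 'rV[R]_n | `|F m - y| <= r].
have K0B : K0 `<=` ball (F m) e.
  by move=> y; rewrite /K0 /= -ball_normE /= => h; exact: le_lt_trans h re.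
have cK0 : compact K0 by exact: closed_ball_rV_compact.
have [k k0 Hk] := section_metric_bound Sg cK0 K0B.
(* A compact subset of a Hausdorff space. Outside it [H] vanishes, which makes the extension of [H]
   by 0 differentiable along curves that leave the patch. *)
have clC : closed (G @` K0).
  apply: compact_closed; first exact: manifold_hausdorff.
  apply: continuous_compact => //; apply: continuous_in_subspaceT => y /set_mem /K0B.
  exact: (section_continuous Sg).
pose N := G @` ball (F m) e.
pose q y := (r ^+ 2)^-1 * dot (y - F m) (y - F m).
pose H x : R := if x \in N then sqr_ramp (q (F x)) else 0.
have q_ge1 y : r <= `|F m - y| -> 1 <= q y.
  rewrite distrC => h.
  rewrite /q mulrC ler_pdivlMr ?exprn_gt0 // mul1r.
  apply: le_trans (norm_le_dot _); by rewrite ler_sqr ?nnegrE // ltW.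
have nK0 y : ~ K0 y -> r <= `|F m - y| by move=> /negP; rewrite -ltNge => /ltW.
have bump1 (s : R) : 1 <= s -> sqr_ramp s = 0.
  by move=> h; rewrite /sqr_ramp max_l ?expr0n // subr_le0.
have H_out x : ~ (G @` K0) x -> H x = 0.
  move=> hx; rewrite /H; case: ifP => // /set_mem [y By Exy].
  rewrite bump1 //; apply/q_ge1/nK0 => hF; apply: hx; exists y => //.
  by move: hF; rewrite -Exy FG.
(* The ramp contributes a factor 2, the differential of [q] a factor [2 / r ^+ 2], [dot_bound] a
   factor [n.+1%:R * r], and [Num.sqrt k] compares the Euclidean speed of the projection with the
   speed on [M]. The successor keeps [c] positive when [n] is 0. *)
pose c := 4 * n.+1%:R / (r * Num.sqrt k).
have sk0 : 0 < Num.sqrt k by rewrite sqrtr_gt0.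
have c0 : 0 < c by rewrite divr_gt0 ?mulr_gt0 // ltr0n.
have Hcurve (g : R -> M) : smooth_curve g -> H (g 1) - H (g 0) <= c * curve_length X g.
  move=> /smooth_curve_chart [D sID sg]; have [oD cg smg] := sg.
  have Dn t (P : set R) : D t -> nbhs (t : R^o) P -> \forall x \near (t : R), P x by [].
  suff key (t : R) : D t -> exists2 d, is_derive t (1 : R) (H \o g) d & d <= c * speed X g t.
    apply: (@increment_le_integral R (speed X g) (H \o g) c D) => //.
    - by move=> t Dt; exact: (speed_continuous X_immersion sg Dt).
    - by move=> t /key [d []].
    - by move=> t /key [d [_ ->]].
  move=> Dt.
  have [gN|gN] := pselect (N (g t)); last first.
    exists 0; last by rewrite mulr_ge0 ?(ltW c0) // sqrtr_ge0.
    have D0 := @is_derive_cst _ R R (0 : R) t 1.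
    apply: (near_eq_is_derive _ D0).
    have N1 : \forall x \near (t : R^o), (~` (G @` K0)) (g x).
      apply: (cg t Dt); apply: open_nbhs_nbhs; split; first by rewrite openC.
      by move=> [y /K0B By Ey]; apply: gN; exists y.
    by apply: filterS N1 => x /H_out /= ->.
  have dF : derivable (F \o g : R^o -> _) t (1 : R^o).
    apply/derivable_mxP => i j; rewrite (ord1 i).
    exact: (Ck_derivable (F_pullback 1 j sg) Dt).
  set v := 'D_(1 : R^o) (F \o g : R^o -> _) t.
  have Dq : is_derive (t : R) (1 : R) (fun x => q (F (g x)))
      ((r ^+ 2)^-1 * (2 * dot (F (g t) - F m) v)).
    have dFm : derivable (fun x : R^o => F (g x) - F m) t (1 : R^o).
      exact: (derivableB dF (derivable_cst _ _ _)).
    have EFm : 'D_(1 : R^o) (fun x : R^o => F (g x) - F m) t = v.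
      by have := deriveB dF (@derivable_cst _ R^o _ (F m) t 1); rewrite derive_cst subr0.
    have := is_derive_dot dFm dFm; rewrite EFm => Hd.
    have Hz := @is_deriveZ R R R (fun x : R => dot (F (g x) - F m) (F (g x) - F m)) (r ^+ 2)^-1 t 1 _ Hd.
    by apply: (is_derive_eq Hz); rewrite (dotC v) -[_ *: _]/(_ * _); ring.
  exists (- (2 * Num.max 0 (1 - q (F (g t)))) * ((r ^+ 2)^-1 * (2 * dot (F (g t) - F m) v))).
    apply: (@near_eq_is_derive _ R R (@sqr_ramp R \o (fun x => q (F (g x))))); last first.
      exact: is_derive1_comp (is_derive_sqr_ramp _) Dq.
    have N1 : \forall x \near (t : R^o), N (g x).
      by apply: (cg t Dt); apply: open_nbhs_nbhs.
    by apply: filterS N1 => x Nx /=; rewrite /H mem_set.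
  have [q1|q1] := pselect (K0 (F (g t))); last first.
    have -> : Num.max 0 (1 - q (F (g t))) = 0 by rewrite max_l // subr_le0; exact/q_ge1/nK0.
    by rewrite mulr0 oppr0 mul0r mulr_ge0 ?(ltW c0) // sqrtr_ge0.
  have gt : g t = G (F (g t)) by rewrite (patch_invK PG).
  have sp : Num.sqrt k * Num.sqrt (dot v v) <= speed X g t.
    have tv := derive_tangent X_immersion (1 : R^o) sg Dt.
    rewrite gt in tv.
    have E := tangent_sectionP X_immersion X_spacelike Sg (K0B _ q1) tv.
    rewrite (derive_space_part X_immersion (1 : R^o) sg Dt) in E.
    have hk := Hk (F (g t)) v q1.
    rewrite -sqrtrM ?(ltW k0) // /speed derive1E [X in inner X X]E.
    by rewrite ler_sqrt // (le_trans _ hk) // mulr_ge0 ?(ltW k0) ?dot_ge0.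
  have hF : `|F (g t) - F m| <= r by rewrite distrC.
  have hD := dot_bound (F (g t) - F m) v.
  move: sp hD; rewrite /c.
  have A0 : 0 <= Num.max 0 (1 - q (F (g t))) by rewrite le_max lexx.
  have A1 : Num.max 0 (1 - q (F (g t))) <= 1.
    by rewrite ge_max ler01 lerBlDr lerDl /q mulr_ge0 ?invr_ge0 ?sqr_ge0 ?dot_ge0.
  have S0 : 0 <= Num.sqrt (dot v v) by exact: sqrtr_ge0.
  move: (Num.max _ _) (dot _ v) (Num.sqrt (dot v v)) (speed X g t) A0 A1 S0
    => A D1 S sp A0 A1 S0 hsp hD.
  have hD' : `|D1| <= n.+1%:R * (r * S).
    apply: (le_trans hD); apply: ler_pM => //; [by rewrite mulr_ge0|by rewrite ler_nat|].
    exact: ler_wpM2r.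
  apply: (@le_trans _ _ (4 * (r ^+ 2)^-1 * `|D1|)).
    have -> : - (2 * A) * ((r ^+ 2)^-1 * (2 * D1)) = 4 * (r ^+ 2)^-1 * (A * - D1) by ring.
    rewrite ler_wpM2l ?mulr_ge0 ?invr_ge0 ?sqr_ge0 //.
    apply: (le_trans (ler_norm _)); rewrite normrM normrN (ger0_norm A0).
    exact: ler_piMl.
  apply: (@le_trans _ _ (4 * (r ^+ 2)^-1 * (n.+1%:R * (r * S)))).
    by rewrite ler_wpM2l ?mulr_ge0 ?invr_ge0 ?sqr_ge0.
  apply: (@le_trans _ _ (4 * n.+1%:R / (r * Num.sqrt k) * (Num.sqrt k * S))).
    rewrite le_eqVlt; apply/orP; left; apply/eqP; field.
    by rewrite !gt_eqF.
  by rewrite ler_wpM2l // divr_ge0 ?mulr_ge0 ?ltW // ltr0n.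
(* A chain of curves shorter than [c^-1] changes [H] by less than 1, so from a point with [H] equal
   to 0 it cannot reach [m]. *)
exists c^-1; first by rewrite invr_gt0.
move=> x /(distance_lt X_immersion X_spacelike cM) [s Hs ls].
have Hm : H m = 1.
  rewrite /H mem_set; last by exists (F m) => //; exact: ballxx.
  rewrite /q subrr dot0l mulr0 /sqr_ramp subr0 max_r ?expr1n //.
have Hsum : forall s x, piecewise_smooth s x m ->
    H m - H x <= c * \sum_(g <- s) curve_length X g.
  elim=> [|g s' IH] z /=; first by move=> ->; rewrite subrr big_nil mulr0.
  move=> [sg <- /IH]; rewrite big_cons mulrDr; have := Hcurve g sg.
  by lra.
have : 0 < H x.
  have := Hsum s x Hs; rewrite Hm.
  have : c * \sum_(g <- s) curve_length X g < 1 by rewrite -ltr_pdivlMl // mulr1.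
  by lra.
rewrite /H; case: ifP => [/set_mem [y By Exy]|_]; last by rewrite ltxx.
rewrite -Exy FG // => hb; exists y => //; rewrite -ball_normE /= ltNge.
by apply/negP => /q_ge1/bump1 E; rewrite E ltxx in hb.
Qed.

End MetricTopology.

(** * The global section *)

Section GlobalSection.
Variables (R : realType) (n p : nat) (M : smooth_manifold R n).
Variable X : M -> 'rV[R]_(n + p).
Hypotheses (M_connected : connected [set: M]) (X_immersion : immersion X)
  (X_spacelike : spacelike X) (X_complete : complete_submanifold X).
Local Notation F := (space_part X).
Variable m0 : M.
Let a0 := F m0.

(** On domains star-shaped about [a0], sections with the same value at [a0] agree wherever both are
    defined. All of them therefore glue to one maximal section [sg], over [Om]. *)
Let star_section U s : Prop := [/\ section_on X U s, U a0, s a0 = m0 &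
  forall v r, U v -> 0 <= r <= 1 -> U (a0 + r *: (v - a0))].

Let lift v m : Prop := exists U s, [/\ star_section U s, U v & s v = m].

Let lift_uniq v m m' : lift v m -> lift v m' -> m = m'.
Proof.
move=> [U [s [[Ss Ua sa stU] Uv <-]]] [U' [s' [[Ss' Ua' sa' stU'] Uv' <-]]].
apply: (sections_agree X_immersion X_spacelike Ss Ss' (a := a0)); last by rewrite sa sa'.
by move=> r r01; split; [exact: stU|exact: stU'].
Qed.

Let Om := [set v | exists m, lift v m].
Let sg v := xget m0 (lift v).

Let sg_lift v : Om v -> lift v (sg v).
Proof. by move=> [m Hm]; exact: (xgetPex m0 (ex_intro _ m Hm)). Qed.

Let sgE U s v : star_section U s -> U v -> Om v /\ sg v = s v.
Proof.
move=> H Uv; have L : lift v (s v) by exists U, s.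
split; first by exists (s v).
by apply: (lift_uniq _ L); apply: sg_lift; exists (s v).
Qed.

Let Om_star : star_section Om sg.
Proof.
have [e [G PG]] := patch_exists X_immersion X_spacelike m0.
have [e0 GF _ _ _] := PG.
have S0 : star_section (ball a0 e) G.
  split=> //; [exact: (patch_section PG)|exact: ballxx|].
  by move=> v r Bv r01; apply: ball_segment => //; exact: ballxx.
have [Om0 sg0] := sgE S0 (ballxx a0 e0).
split=> //; last 2 first.
- by rewrite sg0.
- move=> v r [m [U [s [H Uv _]]]] r01; have [_ _ _ st] := H.
  by have [] := sgE H (st v r Uv r01).
split.
- rewrite openE => v [m [U [s [H Uv _]]]]; have [[oU _ _] _ _ _] := H.
  apply: (filterS _ (open_nbhs_nbhs (conj oU Uv))) => w Uw.
  by have [] := sgE H Uw.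
- move=> v [m [U [s [H Uv _]]]]; have [[oU cs _] _ _ _] := H.
  apply: (near_continuous _ (cs v Uv)).
  apply: (filterS _ (open_nbhs_nbhs (conj oU Uv))) => w Uw.
  by have [_ ->] := sgE H Uw.
- move=> v [m [U [s [H Uv _]]]]; have [[_ _ Fs] _ _ _] := H.
  by have [_ ->] := sgE H Uv; exact: Fs.
Qed.

(* A star-shaped section, glued with a patch around a point [b]: it suffices
   that the two agree at one point [c] of the segment from [a0] to [b]. *)
Let Om_extend m e G c (t : R) : graph_patch X m e G -> 0 <= t <= 1 ->
  c = a0 + t *: (F m - a0) -> Om c -> ball (F m) e c -> sg c = G c -> Om (F m).
Proof.
move=> PG t01 Ec Omc Bc Egc.
have [SO Om0 sg0 stO] := Om_star; have [oO cO FO] := SO.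
have SG := patch_section PG; have [oB cG FG] := SG.
set B := ball (F m) e in oB cG FG Bc *.
pose B' := [set w | sg w = G w]° `&` (Om `&` B).
have oB' : open B' by apply: openI; [exact: open_interior|exact: openI].
have B'c : B' c by split=> //; exact: (section_near_eq X_immersion X_spacelike SO SG).
(* Adding the whole ball could spoil star-shapedness. [C] keeps the points whose ray passes through
   the region of agreement [B']: before it the ray lies in [Om], after it in the convex ball. *)
pose C := [set v | B v /\ exists2 s : R, 0 <= s <= 1 & B' (a0 + s *: (v - a0))].
have oC : open C.
  rewrite openE => v [Bv [s s01 B's]].
  have cv : {for v, continuous (fun w : 'rV[R]_n => a0 + s *: (w - a0))}.
    have c0 : {for v, continuous (fun w : 'rV[R]_n => a0 + s *: (w - a0))}.
      apply: (@continuousD R 'rV[R]_n 'rV[R]_n (fun=> a0)); first exact: cst_continuous.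
      apply: (@continuousZr R 'rV[R]_n).
      apply: continuousB; [exact: cvg_id|exact: cst_continuous].
    exact: c0.
  have N1 : \forall w \near v, B' (a0 + s *: (w - a0)) := cv _ (open_nbhs_nbhs (conj oB' B's)).
  have N2 : \forall w \near v, B w := open_nbhs_nbhs (conj oB Bv).
  by apply: filterS2 N1 N2 => w h1 h2; split=> //; exists s.
have seg (s r : R) v : (a0 + s *: (v - a0)) + r *: (v - (a0 + s *: (v - a0)))
    = a0 + (s + r * (1 - s)) *: (v - a0).
  by apply/rowP => j; rewrite !mxE; ring.
have agree v : Om v -> C v -> sg v = G v.
  move=> Ov [Bv [s s01 [/interior_subset /= Es [Os Bs]]]].
  apply: (sections_agree X_immersion X_spacelike SO SG _ Es) => r r01.
  split; last exact: ball_segment.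
  rewrite seg; apply: stO => //; move: s01 r01 => /andP[s0 s1] /andP[r0 r1].
  by apply/andP; split; nra.
pose s' v := if v \in Om then sg v else G v.
have s'O v : Om v -> s' v = sg v by move=> Ov; rewrite /s' mem_set.
have s'C v : C v -> s' v = G v.
  by move=> Cv; rewrite /s'; case: ifP => // /set_mem Ov; exact: agree.
have HU : star_section (Om `|` C) s'.
  split; [|by left|by rewrite s'O|].
  - split; first exact: openU.
    + move=> v [Ov|Cv].
        apply: (near_continuous _ (cO v Ov)).
        by apply: (filterS _ (open_nbhs_nbhs (conj oO Ov))) => w Ow; rewrite s'O.
      apply: (near_continuous _ (cG v Cv.1)).
      by apply: (filterS _ (open_nbhs_nbhs (conj oC Cv))) => w Cw; rewrite s'C.
    + by move=> v [Ov|Cv]; [rewrite s'O // FO|rewrite s'C // FG //; exact: Cv.1].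
  - move=> v r [Ov|[Bv [s s01 B's]]] r01; first by left; exact: stO.
    move: (s01) (r01) => /andP[s0 s1] /andP[r0 r1].
    have [rs|sr] := leP r s.
      left; have [Z|sn0] := eqVneq s 0.
        have -> : r = 0 by apply/eqP; rewrite eq_le r0 -Z rs.
        by rewrite scale0r addr0.
      have sp : 0 < s by rewrite lt0r sn0.
      have -> : a0 + r *: (v - a0) = a0 + (r / s) *: ((a0 + s *: (v - a0)) - a0).
        by rewrite [a0 + s *: _ - a0]addrAC subrr add0r scalerA divfK.
      apply: stO; first by case: B's => _ [].
      by rewrite divr_ge0 //= ler_pdivrMr // mul1r.
    right; have rp : 0 < r by apply: le_lt_trans sr.
    have s1' : 0 < 1 - s by rewrite subr_gt0; apply: lt_le_trans r1.
    split.
      have -> : a0 + r *: (v - a0) =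
          (a0 + s *: (v - a0)) + ((r - s) / (1 - s)) *: (v - (a0 + s *: (v - a0))).
        rewrite seg divfK ?gt_eqF //; congr (_ + _ *: _); ring.
      apply: ball_segment => //; first by case: B's => _ [].
      by rewrite divr_ge0 ?subr_ge0 ?(ltW sr) //= ler_pdivrMr // mul1r lerB.
    exists (s / r); first by rewrite divr_ge0 //= ler_pdivrMr // mul1r ltW.
    have -> : a0 + (s / r) *: ((a0 + r *: (v - a0)) - a0) = a0 + s *: (v - a0).
      by rewrite [a0 + r *: _ - a0]addrAC subrr add0r scalerA divfK // gt_eqF.
    exact: B's.
have [] // := sgE HU (_ : (Om `|` C) (F m)).
right; split; first by apply: ballxx; case: PG.
by exists t => //; rewrite -Ec.
Qed.

(** Completeness enters here: lifts do not lengthen segments, so the lifted points along the ray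
    form a Cauchy sequence, and the patch around their limit carries the section across the
    endpoint. *)
Let Om_limit b (T : R) : 0 < T <= 1 ->
  (forall t, 0 <= t < T -> Om (a0 + t *: (b - a0))) -> Om (a0 + T *: (b - a0)).
Proof.
move=> /andP[T0 T1] HT; pose l (t : R) := a0 + t *: (b - a0).
have [SO Om0 sg0 stO] := Om_star; have [oO cO FO] := SO.
(* Starts at 0, tends to [T], and stays strictly below it, where the lift is known to exist. *)
pose t_ (k : nat) : R := T * (1 - k.+1%:R^-1).
have k1 (k : nat) : 0 <= (1 - k.+1%:R^-1 : R) < 1.
  have h0 : 0 < k.+1%:R^-1 :> R by rewrite invr_gt0 ltr0n.
  have h1 : k.+1%:R^-1 <= 1 :> R by rewrite invf_le1 ?ltr0n // ler1n.
  by move: (k.+1%:R^-1 : R) h0 h1 => q h0 h1; apply/andP; split; lra.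
have tT k : 0 <= t_ k < T.
  by have /andP[h1 h2] := k1 k; rewrite /t_ mulr_ge0 ?(ltW T0) //= gtr_pMr.
pose u k := sg (l (t_ k)).
pose D := Num.sqrt (dot (b - a0) (b - a0)).
have D0 : 0 <= D by exact: sqrtr_ge0.
have dist_u i j : distance X (u i) (u j) <= `|t_ i - t_ j| * D.
  have Eseg (r : R) : l (t_ i) + r *: (l (t_ j) - l (t_ i)) = l (t_ i + r * (t_ j - t_ i)).
    by apply/rowP => q; rewrite !mxE; ring.
  have [|sm len] := @section_segment R n p M X X_immersion X_spacelike Om sg (l (t_ i)) (l (t_ j)) SO.
    move=> r /andP[r0 r1]; rewrite Eseg; apply: HT.
    have /andP[i0 iT] := tT i; have /andP[j0 jT] := tT j.
    move: (t_ i) (t_ j) i0 iT j0 jT => ti tj i0 iT j0 jT.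
    apply/andP; split; first by nra.
    have h1 : 0 <= r * (T - tj) by rewrite mulr_ge0 // subr_ge0 ltW.
    have [->|rn] := eqVneq r 1; first by lra.
    have h2 : 0 < (1 - r) * (T - ti) by rewrite mulr_gt0 ?subr_gt0 // lt_neqAle rn.
    by nra.
  have Hp : piecewise_smooth [:: fun r : R => sg (l (t_ i) + r *: (l (t_ j) - l (t_ i)))] (u i) (u j).
    split=> //=; first by rewrite scale0r addr0.
    by rewrite scale1r addrC subrK.
  apply: (le_trans (distance_le X Hp)); rewrite big_seq1; apply: (le_trans len).
  have -> : l (t_ j) - l (t_ i) = (t_ j - t_ i) *: (b - a0).
    by apply/rowP => q; rewrite !mxE; ring.
  by rewrite dotZl dotZr mulrA -expr2 sqrtrM ?sqr_ge0 // sqrtr_sqr distrC.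
have t_small (e : R) : 0 < e -> exists N, forall k, (N <= k)%N -> T - t_ k < e.
  move=> e0; have HN := archi_boundP (ltW (divr_gt0 T0 e0)); set N := Num.bound _ in HN.
  exists N => k Nk; rewrite /t_ mulrBr mulr1 opprB addrC subrK.
  rewrite ltr_pdivrMr ?ltr0n // mulrC -ltr_pdivrMr //.
  by apply: (lt_le_trans HN); rewrite ler_nat; exact: leq_trans Nk (leqnSn _).
have cauchy : forall e, 0 < e -> exists N, forall i j, (N <= i)%N -> (N <= j)%N ->
       distance X (u i) (u j) < e.
  move=> e e0; have [|N HN] := t_small (e / (D + 1)).
    by rewrite divr_gt0 // ltr_wpDl.
  exists N => i j /HN hi /HN hj; apply: (le_lt_trans (dist_u i j)).
  have h : `|t_ i - t_ j| < e / (D + 1).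
    have /andP[_ iT] := tT i; have /andP[_ jT] := tT j.
    by rewrite ltr_norml; apply/andP; split; lra.
  apply: (@le_lt_trans _ _ (`|t_ i - t_ j| * (D + 1))).
    by rewrite ler_wpM2l // lerDl.
  by rewrite -ltr_pdivlMr // ltr_wpDl.
have [y Hy] := X_complete cauchy.
have [e [G PG]] := patch_exists X_immersion X_spacelike y.
have [e0 GF FG _ _] := PG.
have near_y (r : R) : 0 < r < e -> exists N, forall k, (N <= k)%N -> (G @` ball (F y) r) (u k).
  move=> re; have [rho rho0 H] := distance_nbhs X_immersion X_spacelike M_connected PG re.
  have [N HN] := Hy rho rho0; exists N => k /HN; exact: H.
have ball_le (r : R) : r < e -> ball (F y) r `<=` ball (F y) e.
  by move=> re; exact/le_ball/ltW.
have in_ball r k : r < e -> (G @` ball (F y) r) (u k) ->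
    ball (F y) r (l (t_ k)) /\ u k = G (l (t_ k)).
  move=> re [v Bv Ev].
  have Fu : F (u k) = l (t_ k) by apply/FO/HT/tT.
  by have := FG v (ball_le r re v Bv); rewrite Ev Fu => ->; rewrite Ev.
(* Convergence is only known for [distance]. [distance_nbhs] places [u k] in arbitrarily small
   patches around [y], which turns it into convergence of the projections. *)
have EF : F y = l T.
  apply/eqP; rewrite -subr_eq0 -normr_le0; apply/ler_addgt0Pr => r' r'0; rewrite add0r.
  pose r := Num.min (r' / 2) (e / 2).
  have r0 : 0 < r by rewrite lt_min !divr_gt0.
  have re : r < e by rewrite gt_min (_ : e / 2 < e) ?orbT //; lra.
  have rr : r <= r' / 2 by rewrite ge_min lexx.
  have [N HN] : exists N, forall k, (N <= k)%N -> (G @` ball (F y) r) (u k).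
    by apply: near_y; rewrite r0.
  have [|N' HN'] := t_small (r' / 2 / (`|b - a0| + 1)).
    by rewrite divr_gt0 ?divr_gt0 // ltr_wpDl.
  pose k := maxn N N'.
  have [Bk _] := in_ball r k re (HN k (leq_maxl _ _)).
  move: Bk; rewrite -ball_normE /= => Bk.
  have hk := HN' k (leq_maxr _ _).
  have -> : F y - l T = (F y - l (t_ k)) - (T - t_ k) *: (b - a0).
    by apply/rowP => q; rewrite !mxE; ring.
  apply: (le_trans (ler_normB _ _)); rewrite normrZ.
  have /andP[_ kT] := tT k.
  rewrite ger0_norm ?subr_ge0 ?(ltW kT) //.
  have : (T - t_ k) * `|b - a0| <= r' / 2.
    apply: (@le_trans _ _ ((T - t_ k) * (`|b - a0| + 1))).
      by rewrite ler_wpM2l ?subr_ge0 ?(ltW kT) // lerDl.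
    by rewrite -ler_pdivlMr ?ltr_wpDl // ltW.
  by move: Bk rr; lra.
have [|N HN] := near_y (e / 2); first by apply/andP; split; lra.
have e2 : e / 2 < e by lra.
have [Bk Ek] := in_ball _ N e2 (HN N (leqnn _)).
rewrite -/(l T) -EF; have /andP[N0 NT] := tT N.
apply: (Om_extend (t := t_ N / T) PG _ _ (HT _ (tT N)) (ball_le _ e2 _ Bk) Ek).
  by rewrite divr_ge0 ?(ltW T0) //= ler_pdivrMr // mul1r ltW.
rewrite EF /l [a0 + T *: _ - a0]addrAC subrr add0r scalerA divfK // gt_eqF //.
Qed.

(** Continuity method along a ray: the supremum of the reached parameters is itself reached by
    [Om_limit], and openness of [Om] allows going further unless it is 1. *)
Let Om_full v : Om v.
Proof.
have [SO Om0 sg0 stO] := Om_star; have [oO cO FO] := SO.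
pose l (t : R) := a0 + t *: (v - a0).
pose A := [set t : R | 0 <= t <= 1 /\ Om (l t)].
have A0 : A 0 by rewrite /A /= lexx ler01 /l scale0r addr0.
have hA : has_sup A by split; [exists 0|exists 1 => t [/andP[]]].
pose T := sup A.
have T0 : 0 <= T by exact: (ub_le_sup hA.2 A0).
have T1 : T <= 1 by apply: ge_sup hA.1 _ => t [/andP[]].
have below (t : R) : 0 <= t < T -> Om (l t).
  move=> /andP[t0 tT]; have Tt0 : 0 < T - t by rewrite subr_gt0.
  have [t' [/andP[t'0 t'1] Ot'] ht'] := sup_adherent Tt0 hA.
  rewrite -/T opprB addrC subrK in ht'.
  have t'p : 0 < t' by exact: le_lt_trans ht'.
  have -> : l t = a0 + (t / t') *: (l t' - a0).
    by rewrite /l [a0 + t' *: _ - a0]addrAC subrr add0r scalerA divfK // gt_eqF.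
  by apply: stO => //; rewrite divr_ge0 //= ler_pdivrMr // mul1r ltW.
have OT : Om (l T).
  have [Z|Tn0] := eqVneq T 0; first by rewrite Z; exact: A0.2.
  by apply: Om_limit => //; rewrite lt0r Tn0 T0.
have [E|Tn1] := eqVneq T 1.
  by move: OT; rewrite E /l scale1r addrC subrK.
have Tl1 : T < 1 by rewrite lt_neqAle Tn1.
have cl : continuous l by exact: line_continuous.
have : \forall t \near T, Om (l t) := cl T _ (open_nbhs_nbhs (conj oO OT)).
move=> /nbhs_ballP [d /= d0 Hd].
pose t := Num.min 1 (T + d / 2).
have : A t.
  split; first by rewrite /t le_min ler01 /= ge_min lexx /= addr_ge0 // divr_ge0 // ltW.
  apply: Hd; rewrite -ball_normE /= /t; case: (leP 1 (T + d / 2)) => h;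
    rewrite ltr_norml; apply/andP; split; lra.
move=> /(ub_le_sup hA.2); rewrite -/T leNgt /t lt_min Tl1 /=.
by rewrite ltrDl divr_gt0.
Qed.

Theorem global_section : exists s, section_on X setT s /\ forall x, s (F x) = x.
Proof.
have [SO _ sg0 _] := Om_star.
have S : section_on X setT sg.
  have [oO cO FO] := SO.
  by split=> [|v _|v _]; [exact: openT|apply: cO; exact: Om_full|apply: FO; exact: Om_full].
exists sg; split=> //.
(* The image of the section. It is open and closed in the connected [M], so the section is also a
   left inverse of the projection. *)
pose A := [set x | sg (F x) = x].
suff AT : A = [set: M] by move=> x; have : [set: M] x by []; rewrite -AT.
apply: M_connected.
- by exists m0; exact: sg0.
- exists A; last by rewrite setTI.
  rewrite openE => x Ax; rewrite /interior.
  have := section_invK X_immersion X_spacelike S (I : setT (F x)).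
  by rewrite Ax.
- exists A; last by rewrite setTI.
  move=> x clA; have [e [G PG]] := patch_exists X_immersion X_spacelike x.
  have SG := patch_section PG; have [e0 GF _ _ _] := PG.
  have [x' [Ax' Nx']] := clA _ (patch_nbhs PG).
  have Bx' : ball (F x) e (F x') by case: Nx' => v Bv <-; rewrite (sectionK SG).
  rewrite /A /= -[RHS]GF.
  apply: (sections_agree X_immersion X_spacelike S SG (a := F x')).
    by move=> r r01; split=> //; apply: ball_segment => //; exact: ballxx.
  by rewrite (patch_invK PG Nx') Ax'.
Qed.

End GlobalSection.

(** * Entire graphs *)

Section LinearAlgebra.
Variable R : realType.

(** Orthonormal rows are added one at a time: while there are fewer than [m] of them, a rank count
    leaves a nonzero vector orthogonal to them for [S]. *)
Lemma gram_schmidt m (S : 'M[R]_m) : S^T = S ->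
  (forall v : 'rV_m, v != 0 -> 0 < (v *m S *m v^T) 0 0) ->
  exists B : 'M[R]_m, B *m S *m B^T = 1%:M.
Proof.
move=> sS pS.
suff: forall k, (k <= m)%N -> exists A : 'M[R]_(k, m), A *m S *m A^T = 1%:M.
  by move=> /(_ m (leqnn m)).
elim=> [|k IH] km; first by exists 0; rewrite flatmx0 [RHS]flatmx0.
have [A HA] := IH (ltnW km).
have [v v0 vA] : exists2 v : 'rV[R]_m, v != 0 & v *m (S *m A^T) = 0.
  have : kermx (S *m A^T) != 0.
    rewrite kermx_eq0 /row_free neq_ltn; apply/orP; left.
    by apply: leq_ltn_trans (rank_leq_col _) km.
  by case/rowV0Pn => v /sub_kermxP vk v0; exists v.
pose q := (v *m S *m v^T) 0 0.
have q0 : 0 < q by exact: pS.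
pose w := (Num.sqrt q)^-1 *: v.
have wA : w *m S *m A^T = 0 by rewrite /w -!scalemxAl -mulmxA vA scaler0.
have Aw : A *m S *m w^T = 0.
  by apply: trmx_inj; rewrite !trmx_mul trmxK sS mulmxA wA trmx0.
have ww : w *m S *m w^T = 1%:M.
  rewrite /w linearZ /= -!scalemxAl -scalemxAr scalerA.
  rewrite [v *m S *m v^T]mx11_scalar -/q scale_scalar_mx.
  by rewrite -invfM -expr2 sqr_sqrtr ?ltW // mulVf ?gt_eqF.
rewrite -addn1; exists (col_mx A w).
by rewrite tr_col_mx mul_col_mx mul_col_row HA wA Aw ww -scalar_mx_block.
Qed.

Lemma dotE m (x y : 'rV[R]_m) : dot x y = (x *m y^T) 0 0.
Proof. by rewrite mxE; apply: eq_bigr => i _; rewrite mxE. Qed.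

Lemma dot_mulmx m k (x : 'rV[R]_m) (A : 'M[R]_(m, k)) y : dot (x *m A) y = dot x (y *m A^T).
Proof. by rewrite !dotE trmx_mul trmxK mulmxA. Qed.

Lemma gram_form m k (A : 'M[R]_(m, k)) x y :
  (x *m (1%:M - A *m A^T) *m y^T) 0 0 = dot x y - dot (x *m A) (y *m A).
Proof. by rewrite mulmxBr mulmx1 mulmxA mulmxBl mxE [X in _ + X]mxE -!dotE dot_mulmx trmxK. Qed.

Lemma gram_sym m k (A : 'M[R]_(m, k)) : (1%:M - A *m A^T)^T = 1%:M - A *m A^T.
Proof. by rewrite linearB /= trmx1 trmx_mul trmxK. Qed.

Lemma mulmx_trmx_row m k (A : 'M[R]_(m, k)) (S : 'M[R]_k) i j :
  (A *m S *m A^T) i j = (row i A *m S *m (row j A)^T) 0 0.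
Proof. by rewrite -row_mul mxE [RHS]mxE; apply: eq_bigr => l _; rewrite !mxE. Qed.

Lemma dot_sub m (x y : 'rV[R]_m) : dot (x - y) (x - y) = dot x x - 2 * dot x y + dot y y.
Proof. by rewrite dotDl !dotDr dotNr !dotNl dotNr (dotC y x); ring. Qed.

(** Used to see that the normal metric is negative definite. With y = z P^T, nonnegativity of |z - y
    P|^2 gives 2 |y|^2 <= |z|^2 + |y P|^2, and |y P| < |y| unless y = 0. *)
Lemma contraction_trmx n p (P : 'M[R]_(n, p)) :
  (forall b : 'rV_n, b != 0 -> dot (b *m P) (b *m P) < dot b b) ->
  forall z : 'rV_p, z != 0 -> dot (z *m P^T) (z *m P^T) < dot z z.
Proof.
move=> H z z0; have [->|y0] := eqVneq (z *m P^T) 0; first by rewrite dot0l dot_gt0.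
have h := H _ y0; have := dot_ge0 (z - z *m P^T *m P).
rewrite dot_sub [dot z (_ *m P)]dotC dot_mulmx.
by move: h; lra.
Qed.

End LinearAlgebra.

(** * Geometry of a spacelike graph *)

Section Graph.
Variables (R : realType) (n p : nat) (M : smooth_manifold R n).
Variable X : M -> 'rV[R]_(n + p).
Hypotheses (X_immersion : immersion X) (X_spacelike : spacelike X).
Local Notation F := (space_part X).
Variable s : 'rV[R]_n -> M.
Hypotheses (Ss : section_on X setT s) (sF : forall x, s (F x) = x).

Definition graph_fun (v : 'rV[R]_n) : 'rV[R]_p := rsubmx (X (s v)).
Local Notation u := graph_fun.

Let sG : chart_smooth_on setT s.
Proof. exact: (section_smooth X_immersion X_spacelike Ss). Qed.

Let Fs v : F (s v) = v.
Proof. exact: (sectionK Ss). Qed.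

Lemma graph_funE v : X (s v) = row_mx v (u v).
Proof. by rewrite -[LHS]hsubmxK; congr row_mx; exact: Fs. Qed.

Lemma graph_fun_Ck k j : Ck k setT (fun v => u v 0 j).
Proof.
apply: (@eq_Ck _ _ k setT (fun v => X (s v) 0 (rshift n j))); first exact: openT.
  by move=> v _; rewrite /graph_fun mxE.
exact: (X_pullback X_immersion k _ sG).
Qed.

Lemma graph_fun_derivable v b : derivable u v b.
Proof.
apply/derivable_mxP => i j; rewrite (ord1 i).
exact: (Ck_derivable (graph_fun_Ck 1 j) I).
Qed.

Let P v : 'M[R]_(n, p) := \matrix_(j, l) 'D_(delta_mx 0 j) (fun x => u x 0 l) v.

Let derive_uE v b : 'D_b u v = b *m P v.
Proof.
apply/rowP => l; rewrite -derive_coord; last exact: graph_fun_derivable.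
rewrite derive_sum_coord; last exact: (Ck_differentiable (graph_fun_Ck 1 l) I).
by rewrite mxE; apply: eq_bigr => j _; rewrite mxE.
Qed.

(** [tvec] and [nvec] parametrise the tangent space by its spacelike part and the normal space by
    its timelike part; their orthogonality is the adjunction between [P] and its transpose. *)
Let tvec v b : 'rV[R]_(n + p) := row_mx b (b *m P v).
Let nvec v z : 'rV[R]_(n + p) := row_mx (z *m (P v)^T) z.

Let derive_Xs v b : 'D_b (X \o s) v = tvec v b.
Proof.
rewrite -[LHS]hsubmxK (derive_section X_immersion X_spacelike b Ss I) /tvec; congr row_mx.
rewrite -derive_uE; apply/rowP => l.
rewrite -derive_coord; last exact: graph_fun_derivable.
rewrite mxE -derive_coord; last exact: (X_section_derivable X_immersion sG I).
by congr ('D_b _ v); apply/funext => y; rewrite mxE.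
Qed.

Let tangentE v w : tangent_space X (s v) w <-> w = tvec v (lsubmx w).
Proof.
split=> [tw|->].
  by rewrite -derive_Xs; exact: (tangent_sectionP X_immersion X_spacelike Ss I tw).
by rewrite -derive_Xs; exact: (derive_tangent X_immersion _ sG I).
Qed.

Let tangent_tvec v b : tangent_space X (s v) (tvec v b).
Proof. by apply/tangentE; rewrite /tvec row_mxKl. Qed.

Let inner_row a b c d : inner (row_mx a b : 'rV[R]_(n + p)) (row_mx c d) = dot a c - dot b d.
Proof. by rewrite innerE !row_mxKl !row_mxKr. Qed.

Let P_contraction v b : b != 0 -> dot (b *m P v) (b *m P v) < dot b b.
Proof.
move=> b0; rewrite -subr_gt0 -inner_row.
apply: (X_spacelike (tangent_tvec v b)); apply: contra b0 => /eqP E.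
by rewrite -(row_mxKl b (b *m P v)) -/(tvec v b) E; apply/eqP/rowP => i; rewrite !mxE.
Qed.

Let normalE v z : Defs.normal_space X (s v) z <-> z = nvec v (rsubmx z).
Proof.
split=> [nz|->].
  rewrite -[LHS]hsubmxK /nvec; congr row_mx.
  apply/eqP; rewrite -subr_eq0; apply/eqP/dot_eq0.
  set d := _ - _; have := nz _ (tangent_tvec v d).
  by rewrite -[z in inner z _]hsubmxK inner_row dotC [dot (rsubmx z) _]dotC dot_mulmx -dotNr -dotDr.
move=> w /tangentE ->.
by rewrite /nvec /tvec inner_row dot_mulmx trmxK subrr.
Qed.

Let normal_nvec v z : Defs.normal_space X (s v) (nvec v z).
Proof. by apply/normalE; rewrite /nvec row_mxKr. Qed.

(** Objects chosen by [get] have their defining property only once a witness exists. Here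
    Gram-Schmidt is applied to 1 - P P^T for the tangent and to 1 - P^T P for the normal vectors. *)
Let frame_ex v : exists e, adapted_frame X (s v) e.
Proof.
have [|B HB] := gram_schmidt (gram_sym (P v)).
  by move=> b b0; rewrite gram_form subr_gt0; exact: P_contraction.
have [|C HC] := gram_schmidt (gram_sym (P v)^T).
  by move=> z z0; rewrite gram_form subr_gt0; exact: contraction_trmx (@P_contraction v) _ z0.
exists (fun i => tvec v (row i B), fun a => nvec v (row a C)); split=> /=.
- by move=> i; exact: tangent_tvec.
- by move=> a; exact: normal_nvec.
- by move=> i j; rewrite /tvec inner_row -gram_form -mulmx_trmx_row HB mxE.
- move=> a b; rewrite /nvec inner_row -opprB -gram_form -mulmx_trmx_row HC.
  by rewrite mxE.
Qed.

Let frameP v : adapted_frame X (s v) (frame X (s v)).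
Proof. exact: (@getPex _ [set e | adapted_frame X (s v) e] (frame_ex v)). Qed.

Let innerDl (x y z : 'rV[R]_(n + p)) : inner (x + y) z = inner x z + inner y z.
Proof. by rewrite !innerE !raddfD /= !dotDl; ring. Qed.

Let innerZl a (x z : 'rV[R]_(n + p)) : inner (a *: x) z = a * inner x z.
Proof. by rewrite !innerE !linearZ /= !dotZl; ring. Qed.

Let innerNl (x z : 'rV[R]_(n + p)) : inner (- x) z = - inner x z.
Proof. by rewrite -scaleN1r innerZl mulN1r. Qed.

(* The [p] normal vectors of [frame X] are independent, hence span the normal space. *)
Let normal_eq0 v z : Defs.normal_space X (s v) z ->
  (forall a, inner z ((frame X (s v)).2 a) = 0) -> z = 0.
Proof.
move=> nz Hz; have [_ nf _ of2] := frameP v.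
pose C : 'M[R]_p := \matrix_a rsubmx ((frame X (s v)).2 a).
pose Q := 1%:M - (P v)^T *m (P v)^T^T.
have innerQ z1 z2 : inner (nvec v z1) (nvec v z2) = - (z1 *m Q *m z2^T) 0 0.
  by rewrite /nvec inner_row gram_form opprB.
have nfE a : (frame X (s v)).2 a = nvec v (row a C) by rewrite rowK; exact/normalE.
have CQC : C *m Q *m C^T = 1%:M.
  apply/matrixP => a b; rewrite mulmx_trmx_row -[LHS]opprK -innerQ -!nfE of2 opprK.
  by rewrite mxE.
have uCQ : C *m Q \in unitmx.
  apply: inj_unitmx => y; move=> /(congr1 (mulmx^~ C^T)); rewrite -mulmxA CQC mul0mx.
  by rewrite mulmx1.
have uC : C \in unitmx by move: uCQ; rewrite unitmx_mul => /andP[].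
have zQC : rsubmx z *m Q *m C^T = 0.
  apply/rowP => a; rewrite [RHS]mxE -[LHS]opprK.
  have <- : inner z ((frame X (s v)).2 a) = - (rsubmx z *m Q *m C^T) 0 a.
    rewrite nfE [in LHS]((normalE v z).1 nz) innerQ; congr (- _).
    by rewrite mxE [RHS]mxE; apply: eq_bigr => k _; rewrite !mxE.
  by rewrite Hz oppr0.
have zQ : rsubmx z *m Q = 0.
  have uCT : C^T \in unitmx by rewrite unitmx_tr.
  by rewrite -[LHS](mulmxK uCT) zQC mul0mx.
have uQ : Q \in unitmx by move: uCQ; rewrite unitmx_mul => /andP[].
have rz : rsubmx z = 0 by rewrite -[LHS](mulmxK uQ) zQ mul0mx.
by rewrite ((normalE v z).1 nz) rz /nvec mul0mx row_mx0.
Qed.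

Let normal_part_ex v w : exists z, Defs.normal_space X (s v) z /\ tangent_space X (s v) (w - z).
Proof.
have [tf _ of1 _] := frameP v; set f := (frame X (s v)).1 in tf of1.
pose b := \sum_i inner w (f i) *: lsubmx (f i).
have Eb : tvec v b = \sum_i inner w (f i) *: f i.
  rewrite /tvec /b mulmx_suml -[RHS]hsubmxK; congr row_mx; rewrite linear_sum /=.
    by apply: eq_bigr => i _; rewrite linearZ.
  apply: eq_bigr => i _; rewrite linearZ /= -scalemxAl; congr (_ *: _).
  by rewrite {2}((tangentE v (f i)).1 (tf i)) /tvec row_mxKr.
exists (w - tvec v b); split; last by rewrite opprB addrC subrK; exact: tangent_tvec.
have ortho i : inner (w - tvec v b) (f i) = 0.
  rewrite innerDl innerNl Eb inner_suml (bigD1 i) //= of1 eqxx mulr1 big1 ?addr0 ?subrr //.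
  by move=> j ji; rewrite of1 (negPf ji) mulr0.
(* The spacelike parts of the tangent frame form a basis of R^n, so orthogonality to the frame is
   orthogonality to the whole tangent space. *)
have uB : (\matrix_i lsubmx (f i) : 'M[R]_n) \in unitmx.
  set B := \matrix_i _.
  have : B *m (1%:M - P v *m (P v)^T) *m B^T = 1%:M.
    apply/matrixP => i j.
    rewrite mulmx_trmx_row gram_form !rowK -inner_row -/(tvec v _) -/(tvec v _).
    by rewrite -!((tangentE v _).1 (tf _)) of1 mxE.
  by rewrite -mulmxA => /mulmx1_unit [].
set B := \matrix_i _ in uB.
move=> t /((tangentE v t).1) ->.
have -> : tvec v (lsubmx t) = \sum_i (lsubmx t *m invmx B) 0 i *: f i.
  have {1}-> : lsubmx t = \sum_i (lsubmx t *m invmx B) 0 i *: lsubmx (f i).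
    rewrite -{1}[lsubmx t](mulmxKV uB) mulmx_sum_row.
    by apply: eq_bigr => i _; rewrite rowK.
  rewrite /tvec mulmx_suml -[RHS]hsubmxK; congr row_mx; rewrite linear_sum /=.
    by apply: eq_bigr => i _; rewrite linearZ.
  apply: eq_bigr => i _; rewrite linearZ /= -scalemxAl; congr (_ *: _).
  by rewrite {2}((tangentE v (f i)).1 (tf i)) /tvec row_mxKr.
by rewrite innerC inner_suml big1 // => i _; rewrite innerC ortho mulr0.
Qed.

Let normal_partP v w : Defs.normal_space X (s v) (normal_part X (s v) w) /\
  tangent_space X (s v) (w - normal_part X (s v) w).
Proof.
exact: (@getPex _ [set z | Defs.normal_space X (s v) z /\ tangent_space X (s v) (w - z)]
  (normal_part_ex v w)).
Qed.

Let inner_normal_part v w z : Defs.normal_space X (s v) z ->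
  inner (normal_part X (s v) w) z = inner w z.
Proof.
move=> nz; have [_ tw] := normal_partP v w.
rewrite -[w in RHS](subrK (normal_part X (s v) w)) innerDl.
by rewrite [inner (w - _) z]innerC (nz _ tw) add0r.
Qed.

Let derive_u_Ck k b l : Ck k setT ('D_b (fun y => u y 0 l)).
Proof. exact: (Ck_derive b (graph_fun_Ck k.+1 l)). Qed.

(** Turns the derivative of [u] along a direction that depends on the point into a product, to which
    the Leibniz rule applies. *)
Let grad l (y : 'rV[R]_n) : 'rV[R]_n := \row_j 'D_(delta_mx 0 j) (fun x => u x 0 l) y.

Let grad_derivable l y a : derivable (grad l) y a.
Proof.
apply/derivable_mxP => i j; rewrite (ord1 i).
rewrite (_ : (fun x => _) = 'D_(delta_mx 0 j) (fun x => u x 0 l)); last first.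
  by apply/funext => x; rewrite mxE.
exact: (Ck_derivable (derive_u_Ck 1 _ l) I).
Qed.

Let dot_grad l y (b : 'rV[R]_n) : dot b (grad l y) = (b *m P y) 0 l.
Proof. by rewrite mxE; apply: eq_bigr => j _; rewrite !mxE. Qed.

Let derive_uE_coord y b l : 'D_b u y 0 l = dot b (grad l y).
Proof. by rewrite derive_uE dot_grad. Qed.

Lemma derive_graph_fun_derivable b y a : derivable ('D_b u) y a.
Proof.
apply/derivable_mxP => i l; rewrite (ord1 i).
rewrite (_ : (fun x => _) = 'D_b (fun x => u x 0 l)); last first.
  by apply/funext => x; rewrite -derive_coord //; exact: graph_fun_derivable.
exact: (Ck_derivable (derive_u_Ck 1 _ l) I).
Qed.

Let derive2_uE y a b l : 'D_a ('D_b u) y 0 l = dot b ('D_a (grad l) y).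
Proof.
rewrite -derive_coord; last exact: derive_graph_fun_derivable.
rewrite (_ : (fun x => _) = fun x => dot (cst b x) (grad l x)); last first.
  by apply/funext => x; rewrite derive_uE_coord.
have [_ ->] := is_derive_dot (@derivable_cst _ _ _ b y a) (grad_derivable (l := l) (y := y) (a := a)).
by rewrite derive_cst dot0l add0r.
Qed.

(** By the Leibniz rule, differentiating the spacelike part of the field gives a tangent vector, and
    the rest involves only the value of the field at the point. Hence the second fundamental form
    does not depend on the extension. *)
Let derive_tangent_field v (O : set M) (W : M -> 'rV[R]_(n + p)) a :
  open O -> O (s v) -> smooth_map_on O W ->
  (forall y, O y -> tangent_space X y (W y)) ->
  exists b', 'D_a (W \o s) v =
    tvec v b' + row_mx 0 ('D_a ('D_(lsubmx (W (s v))) u) v).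
Proof.
move=> oO Ov smW tW; pose U := setT `&` s @^-1` O.
have Uv : U v by split.
have oU : open U by apply: open_preimage_on => //; [exact: openT|exact: (section_continuous Ss)].
have WCk k i : Ck k U (fun y => W (s y) 0 i).
  exact: (smooth_map_section_Ck X_immersion X_spacelike k i Ss oO smW).
have dW : derivable (W \o s) v a.
  by apply/derivable_mxP => i j; rewrite (ord1 i); exact: (Ck_derivable (WCk 1 j) Uv).
pose be y := lsubmx (W (s y)).
have dbe : derivable be v a.
  apply/derivable_mxP => i j; rewrite (ord1 i).
  rewrite (_ : (fun x => _) = fun y => W (s y) 0 (lshift p j)); last first.
    by apply/funext => y; rewrite mxE.
  exact: (Ck_derivable (WCk 1 _) Uv).
exists ('D_a be v); rewrite -[LHS]hsubmxK /tvec add_row_mx addr0; congr row_mx.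
  apply/rowP => j; rewrite mxE -derive_coord // -derive_coord //.
  by congr ('D_a _ v); apply/funext => y; rewrite mxE.
apply/rowP => l; rewrite mxE -derive_coord // [RHS]mxE derive2_uE -dot_grad.
have N : \forall y \near v, dot (be y) (grad l y) = W (s y) 0 (rshift n l).
  apply: (filterS _ (open_nbhs_nbhs (conj oU Uv))) => y [_ Oy].
  rewrite dot_grad /be.
  rewrite [in RHS]((tangentE y (W (s y))).1 (tW _ Oy)) /tvec row_mxEr.
  by [].
rewrite -(near_eq_derive _ N).
by have [_ ->] := is_derive_dot dbe (grad_derivable (l := l) (y := v) (a := a)).
Qed.

Let flat_connectionE v (O : set M) W t : open O -> O (s v) -> smooth_map_on O W ->
  tangent_space X (s v) t -> flat_connection X W (s v) t = 'D_(lsubmx t) (W \o s) v.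
Proof.
move=> oO Ov smW tt; rewrite /flat_connection; set S := [set z | _].
have S0 : exists z, S z by have [c [w [ca cv Et]]] := tt; exists (chart_diff c W (s v) w), c, w.
have [c [w [ca cv Et ->]]] := getPex S0.
by rewrite Et; exact: (chart_diff_section X_immersion X_spacelike w Ss I oO Ov smW ca cv).
Qed.

Let tangent_extension_ex v w : tangent_space X (s v) w -> exists W, tangent_extension X (s v) w W.
Proof.
move=> /tangentE Ew; set b := lsubmx w in Ew.
exists (fun x => 'D_b (X \o s) (F x)), setT; split=> //; first exact: openT.
- move=> c ca k; rewrite setIT; apply: Ck_on_of_Ck => [|i]; first exact: chart_img_open.
  apply: (@Ck_comp _ _ n k _ setT (fun y => 'D_b (X \o s) y 0 i) (F \o chart_inv c)) => //.
  + exact: chart_img_open.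
  + apply: (@eq_Ck _ _ k setT ('D_b (fun y => X (s y) 0 i))); first exact: openT.
      by move=> y _; rewrite -derive_coord //; exact: (X_section_derivable X_immersion sG I).
    exact: (Ck_derive b (X_pullback X_immersion k.+1 i sG)).
  + by move=> j; exact: (F_chart_Ck X_immersion ca k j).
- by move=> y _; rewrite -{1}(sF y); exact: (derive_tangent X_immersion _ sG I).
- by rewrite Fs derive_Xs.
Qed.

Let sff_inner v t w z : tangent_space X (s v) t -> tangent_space X (s v) w ->
  Defs.normal_space X (s v) z ->
  inner (second_fundamental_form X (s v) t w) z =
    - dot ('D_(lsubmx t) ('D_(lsubmx w) u) v) (rsubmx z).
Proof.
move=> tt tw nz; rewrite /second_fundamental_form; set S := [set z | _].
have S0 : exists z, S z.
  by have [W HW] := tangent_extension_ex tw; exists (normal_part X (s v) (flat_connection X W (s v) t)), W.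
have [W [Dm [oO Ov smW tW Ww] ->]] := getPex S0.
rewrite inner_normal_part // (flat_connectionE oO) //.
have [b' ->] := derive_tangent_field (lsubmx t) oO Ov smW tW.
rewrite innerDl Ww [inner (tvec v b') z]innerC (nz _ (tangent_tvec v b')) add0r.
by rewrite -[z in LHS]hsubmxK inner_row dot0l add0r.
Qed.

Lemma graph_shrinker v : self_shrinker X -> exists b : 'I_n -> 'rV[R]_n,
  (forall k l, dot (b k) (b l) - dot ('D_(b k) u v) ('D_(b l) u v) = (k == l)%:R) /\
  \sum_k 'D_(b k) ('D_(b k) u) v = 2%:R^-1 *: ('D_v u v - u v).
Proof.
move=> shr; have [tf nf of1 of2] := frameP v.
set f := (frame X (s v)).1 in tf of1; set g := (frame X (s v)).2 in nf of2.
exists (fun k => lsubmx (f k)); split.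
  move=> k l; rewrite !derive_uE -inner_row -/(tvec v _) -/(tvec v _).
  by rewrite -!((tangentE v _).1 (tf _)) of1.
set S := \sum_k _.
have sffE a k : sff_coef X (s v) a k k =
    dot ('D_(lsubmx (f k)) ('D_(lsubmx (f k)) u) v) (rsubmx (g a)).
  by rewrite /sff_coef sff_inner // opprK.
have meanE a : inner (mean_curvature X (s v)) (g a) = - dot S (rsubmx (g a)).
  rewrite /mean_curvature inner_suml (bigD1 a) //= [X in _ + X]big1 => [|b ba]; last first.
    by rewrite -/g of2 (negPf ba) oppr0 mulr0.
  rewrite addr0 -/g of2 eqxx mulrN1; congr (- _); under eq_bigr do rewrite sffE.
  rewrite /S; elim: (index_enum _) => [|k r IH]; first by rewrite !big_nil dot0l.
  by rewrite !big_cons dotDl IH.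
(* The shrinker equation says that [w] has no normal part. Its spacelike part is v / 2, so its
   timelike part S + u / 2 must be D_v u / 2. *)
pose w := row_mx 0 S + 2%:R^-1 *: X (s v).
have wg a : inner w (g a) = 0.
  rewrite /w innerDl innerZl -(inner_normal_part (X (s v)) (nf a)).
  have := meanE a; rewrite shr innerZl.
  have -> : inner (row_mx 0 S) (g a) = - dot S (rsubmx (g a)).
    by rewrite -{1}[g a]hsubmxK inner_row dot0l sub0r.
  by move=> <-; rewrite mulNr addNr.
have nw : normal_part X (s v) w = 0.
  apply: (normal_eq0 (normal_partP v w).1) => a.
  by rewrite inner_normal_part ?wg //; exact: nf.
have := (normal_partP v w).2; rewrite nw subr0 => /tangentE.
rewrite /tvec /w graph_funE scale_row_mx add_row_mx add0r row_mxKl => /eq_row_mx [_].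
rewrite -scalemxAl -derive_uE => E.
by rewrite scalerBr -E addrK.
Qed.

(* [X (s v)] minus the tangent vector over [t] has the normal part of [X (s v)]
   and a spacelike tangent part. *)
Lemma graph_normal_bound v t :
  dot ('D_t u v - u v) ('D_t u v - u v) - dot (v - t) (v - t) <=
    normal_position_sqnorm X (s v).
Proof.
rewrite /normal_position_sqnorm; have [nz tz] := normal_partP v (X (s v)).
set z := normal_part _ _ _ in nz tz *.
pose w := X (s v) - z - tvec v t.
have tw : tangent_space X (s v) w.
  apply/tangentE; rewrite /w ((tangentE v _).1 tz) /tvec.
  by rewrite opp_row_mx add_row_mx !row_mxKl mulmxBl.
have Ew : X (s v) - tvec v t = z + w by rewrite /w addrA [z + _]addrC subrK.
have : inner (X (s v) - tvec v t) (X (s v) - tvec v t) = inner z z + inner w w.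
  rewrite Ew innerDl innerC innerDl [inner w (z + w)]innerC innerDl.
  have zw : inner w z = 0 by rewrite innerC (nz _ tw).
  rewrite [inner w z]zw ?(nz _ tw).
  by ring.
rewrite graph_funE /tvec opp_row_mx add_row_mx inner_row -derive_uE.
have w0 : 0 <= inner w w.
  have [->|wn] := eqVneq w 0; last exact/ltW/(X_spacelike tw).
  by rewrite innerE !raddf0 !dot0l subrr.
have -> : dot (u v - 'D_t u v) (u v - 'D_t u v) = dot ('D_t u v - u v) ('D_t u v - u v).
  by rewrite -[u v - _]opprB dotNl dotNr opprK.
by move: w0; lra.
Qed.

Lemma graph_fun_contraction v b : b != 0 -> dot ('D_b u v) ('D_b u v) < dot b b.
Proof. by move=> b0; rewrite derive_uE; exact: P_contraction. Qed.

Lemma graph_range : range X = range (fun v => row_mx v (u v)).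
Proof.
apply/seteqP; split=> y [x _ <-]; first by exists (F x) => //; rewrite -graph_funE sF.
by exists (s x) => //; rewrite graph_funE.
Qed.

End Graph.

(** * The maximum principle *)

Section OneVariable.
Variable R : realType.
Implicit Types (f g : R -> R) (r a b : R).

Lemma isd_cst r a : is_derive r (1 : R) (fun=> a) 0.
Proof. exact: is_derive_cst. Qed.

Lemma isd_id r : is_derive r (1 : R) (fun x => x) 1.
Proof. exact: is_derive_id. Qed.

Lemma isdD f g r a b : is_derive r (1 : R) f a -> is_derive r (1 : R) g b ->
  is_derive r (1 : R) (fun x => f x + g x) (a + b).
Proof. by move=> hf hg; have := is_deriveD hf hg; exact. Qed.

Lemma isdN f r a : is_derive r (1 : R) f a -> is_derive r (1 : R) (fun x => - f x) (- a).
Proof. by move=> hf; have := is_deriveN hf; exact. Qed.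

Lemma isdM f g r a b : is_derive r (1 : R) f a -> is_derive r (1 : R) g b ->
  is_derive r (1 : R) (fun x => f x * g x) (a * g r + f r * b).
Proof.
move=> hf hg; have H := is_deriveM hf hg; apply: (is_derive_eq H).
by rewrite addrC; congr (_ + _); exact: mulrC.
Qed.

Lemma isd_sum (I : finType) (f : I -> R -> R) r (a : I -> R) :
  (forall i, is_derive r (1 : R) (f i) (a i)) ->
  is_derive r (1 : R) (fun x => \sum_i f i x) (\sum_i a i).
Proof.
move=> H; elim: (index_enum I) => [|i l IH].
  rewrite (_ : (fun x => _) = fun=> 0) ?big_nil; first exact: isd_cst.
  by apply/funext => x; rewrite big_nil.
rewrite (_ : (fun x => _) = fun x => f i x + \sum_(j <- l) f j x) ?big_cons.
  exact: isdD.
by apply/funext => x; rewrite big_cons.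
Qed.

(** If [a] were positive, [f1] would be positive just to the right of 0, and the mean value theorem
    would make [f] exceed its maximum. *)
Lemma second_derivative_test f f1 a : (forall r, is_derive r (1 : R) f (f1 r)) ->
  is_derive 0 (1 : R) f1 a -> (forall r, f r <= f 0) -> f1 0 = 0 /\ a <= 0.
Proof.
move=> df df1 fmax.
have f10 : f1 0 = 0.
  have h1 : -1 <= 1 :> R by lra.
  have h0 : (0:R) \in (`]-1, 1[%R : interval R) by rewrite in_itv /=; apply/andP; split; lra.
  have [_ E0] := derive1_at_max h1 (fun r _ => (df r).(ex_derive)) h0 (fun r _ => fmax r).
  by have [_ E1] := df 0; rewrite -E1.
split=> //; rewrite leNgt; apply/negP => a0.
have Q : (fun h : R => h^-1 * f1 h) @ 0^' --> a.
  have [dv dE] := df1; move: dv => /cvg_ex [l Hl].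
  have El : l = a by rewrite -dE /derive; apply/esym/cvg_lim.
  rewrite -El; move: Hl; apply: cvg_trans; apply: near_eq_cvg.
  by near=> h; rewrite /= f10 subr0 addr0 [h *: _]mulr1.
have /cvgrPdist_lt /(_ _ a0) H := Q.
move: H; rewrite near_withinE => /nbhs_ballP [d /= d0 Hd].
have pos (h : R) : 0 < h < d -> 0 < f1 h.
  move=> /andP[h0 hd].
  have : `|a - h^-1 * f1 h| < a.
    by apply: Hd; [rewrite -ball_normE /= sub0r normrN gtr0_norm|rewrite gt_eqF].
  rewrite ltr_norml => /andP[_ h2].
  have : 0 < h^-1 * f1 h by lra.
  by rewrite pmulr_rgt0 // invr_gt0.
have d20 : 0 < d / 2 by rewrite divr_gt0.
have [|c] := @MVT R f f1 0 (d / 2) d20 (fun r _ => df r).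
  by apply: derivable_within_continuous => r _; have [] := df r.
rewrite in_itv /= subr0 => /andP[c0 c1] E.
have : 0 < f1 c by apply: pos; rewrite c0 /=; lra.
have := fmax (d / 2); rewrite -subr_le0 E => h1 h2.
by have := mulr_gt0 h2 d20; lra.
Unshelve. all: by end_near.
Qed.

End OneVariable.

(** * Calculus of smooth functions on R^n *)

Section Calculus.
Variables (R : realType) (n : nat).
Implicit Types (f : 'rV[R]_n -> R).

Definition smooth f := forall k, Ck k setT f.

Lemma smooth_derive f v : smooth f -> smooth ('D_v f).
Proof. by move=> sf k; exact: (Ck_derive v (sf k.+1)). Qed.

Lemma smooth_is_derive f x v : smooth f -> is_derive x v f ('D_v f x).
Proof. by move=> sf; apply/derivableP/(Ck_derivable (sf 1) I). Qed.

Lemma smooth_line f x v r : smooth f ->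
  is_derive r (1 : R) (fun t : R => f (x + t *: v)) ('D_v f (x + r *: v)).
Proof. by move=> sf; apply/is_derive_lineP; exact: smooth_is_derive. Qed.

Lemma smooth_comm f v w x : smooth f -> 'D_v ('D_w f) x = 'D_w ('D_v f) x.
Proof. by move=> sf; exact: (derive_comm _ _ openT I (sf 2)). Qed.

Lemma smooth_deriveD f v w x : smooth f -> 'D_(v + w) f x = 'D_v f x + 'D_w f x.
Proof.
move=> sf; have df := Ck_differentiable (sf 1) (I : setT x).
by rewrite !deriveE // linearD.
Qed.

Lemma smooth_deriveZ f a v x : smooth f -> 'D_(a *: v) f x = a * 'D_v f x.
Proof.
move=> sf; have df := Ck_differentiable (sf 1) (I : setT x).
by rewrite !deriveE // linearZ.
Qed.

Lemma smooth_derive_sum f (I : finType) (a : I -> R) (v : I -> 'rV[R]_n) x : smooth f ->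
  'D_(\sum_i a i *: v i) f x = \sum_i a i * 'D_(v i) f x.
Proof.
move=> sf; have df := Ck_differentiable (sf 1) (Logic.I : setT x).
rewrite deriveE // linear_sum; apply: eq_bigr => i _.
by rewrite linearZ deriveE.
Qed.

Lemma smooth_derive2_sum f (I : finType) (a : I -> R) (v : I -> 'rV[R]_n) w x : smooth f ->
  'D_w ('D_(\sum_i a i *: v i) f) x = \sum_i a i * 'D_w ('D_(v i) f) x.
Proof.
move=> sf; rewrite smooth_comm // (smooth_derive_sum _ _ _ (smooth_derive w sf)).
by apply: eq_bigr => i _; rewrite smooth_comm.
Qed.

Definition hessian f x : 'M[R]_n := \matrix_(i, j) 'D_(delta_mx 0 i) ('D_(delta_mx 0 j) f) x.

Lemma hessianE f x v w : smooth f -> 'D_v ('D_w f) x = (v *m hessian f x *m w^T) 0 0.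
Proof.
move=> sf; rewrite [X in 'D_X f](row_sum_delta w) smooth_derive2_sum //.
rewrite mxE; apply: eq_bigr => j _; rewrite mulrC [X in _ = _ * X]mxE; congr (_ * _).
rewrite [X in 'D_X _ _](row_sum_delta v) (smooth_derive_sum _ _ _ (smooth_derive _ sf)).
by rewrite mxE; apply: eq_bigr => i _; rewrite mxE.
Qed.

End Calculus.

#[local] Opaque derive.

Lemma sum_sym (R : pzRingType) (I : finType) (A : I -> I -> R) (T : I -> R) :
  \sum_k ((\sum_l A k l + \sum_l A l k) + T k) = 2 * (\sum_k \sum_l A k l) + \sum_k T k.
Proof. by rewrite !big_split /= [X in _ + X + _ = _]exchange_big /= -mulr2n -[in LHS]mulr_natl. Qed.

(** * The shrinker system and its linearisation *)

Section ShrinkerSystem.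
Variables (R : realType) (n p : nat).
Variable F : 'I_p -> 'rV[R]_n -> R.
Hypothesis F_smooth : forall q, smooth (F q).
Hypothesis F_contr : forall x b, b != 0 -> \sum_q 'D_b (F q) x ^+ 2 < dot b b.

Definition graph_frame (x : 'rV[R]_n) (b : 'I_n -> 'rV[R]_n) : Prop :=
  forall k l, dot (b k) (b l) - \sum_q 'D_(b k) (F q) x * 'D_(b l) (F q) x = (k == l)%:R.

Hypothesis F_pde : forall x, exists2 b, graph_frame x b &
  forall q, \sum_k 'D_(b k) ('D_(b k) (F q)) x = 2%:R^-1 * ('D_x (F q) x - F q x).

Let J y : 'M[R]_(n, p) := \matrix_(i, q) 'D_(delta_mx 0 i) (F q) y.

Let derive_FE y b q : 'D_b (F q) y = (b *m J y) 0 q.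
Proof.
rewrite derive_sum_coord; last exact: (Ck_differentiable (F_smooth q 1) I).
by rewrite mxE; apply: eq_bigr => i _; rewrite mxE.
Qed.

Let gram y : 'M[R]_n := 1%:M - J y *m (J y)^T.

Let gramE y b c : (b *m gram y *m c^T) 0 0 =
  dot b c - \sum_q 'D_b (F q) y * 'D_c (F q) y.
Proof. by rewrite gram_form; congr (_ - _); apply: eq_bigr => q _; rewrite !derive_FE. Qed.

Let gram_unit y : gram y \in unitmx.
Proof.
apply: inj_unitmx => v vg; apply/eqP/negPn/negP => v0.
have := F_contr y v0; have := gramE y v v; rewrite vg mul0mx mxE.
under [in X in _ -> X]eq_bigr do rewrite expr2.
by move=> /esym/eqP; rewrite subr_eq0 => /eqP ->; rewrite ltxx.
Qed.

Section AtPoint.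
Variables (x : 'rV[R]_n) (b : 'I_n -> 'rV[R]_n).
Hypothesis bx : graph_frame x b.

Let B : 'M[R]_n := \matrix_k b k.
(** Gram matrix at [y] of the frame that is orthonormal at [x]. The frames of [F_pde] come
    pointwise, with no regularity in the point; a fixed frame with its inverse Gram matrix can be
    differentiated. *)
Let Mm y : 'M[R]_n := B *m gram y *m B^T.

Let MmE y k l : Mm y k l = dot (b k) (b l) - \sum_q 'D_(b k) (F q) y * 'D_(b l) (F q) y.
Proof. by rewrite /Mm mulmx_trmx_row !rowK gramE. Qed.

Let Mmx : Mm x = 1%:M.
Proof. by apply/matrixP => k l; rewrite MmE bx mxE. Qed.

Let B_unit : B \in unitmx.
Proof. by have := Mmx; rewrite /Mm -mulmxA => /mulmx1_unit []. Qed.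

Let Mm_unit y : Mm y \in unitmx.
Proof. by rewrite /Mm !unitmx_mul B_unit gram_unit unitmx_tr B_unit. Qed.

Let N y := invmx (Mm y).

Let M_smooth k l : smooth (fun y => Mm y k l).
Proof.
move=> j; apply: (@eq_Ck _ _ j setT (fun y => dot (b k) (b l) -
    \sum_q 'D_(b k) (F q) y * 'D_(b l) (F q) y)); first exact: openT.
  by move=> y _; rewrite MmE.
apply: CkB; [exact: openT|exact: Ck_cst openT|].
apply: Ck_sum => [|q _]; first exact: openT.
by apply: CkM; [exact: openT|exact: (smooth_derive _ (F_smooth q))..].
Qed.

Let N_smooth k l : smooth (fun y => N y k l).
Proof.
move=> j; apply: Ck_invmx; [exact: openT|by move=> y _; exact: Mm_unit|].
by move=> i i'; exact: M_smooth.
Qed.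

Let pde_fixed_frame y q : \sum_k \sum_l N y k l * 'D_(b k) ('D_(b l) (F q)) y =
  2%:R^-1 * ('D_y (F q) y - F q y).
Proof.
have [c cy <-] := F_pde y.
pose C : 'M[R]_n := \matrix_k c k; pose H := hessian (F q) y.
have CgC : C *m gram y *m C^T = 1%:M.
  by apply/matrixP => k l; rewrite mulmx_trmx_row !rowK gramE cy mxE.
(* Both sides invert [gram y], so both frames compute the same trace of the Hessian. *)
have CC : C^T *m C = B^T *m N y *m B.
  have h1 : (C^T *m C) *m gram y = 1%:M by rewrite -mulmxA; exact: mulmx1C.
  have h2 : (B^T *m N y *m B) *m gram y = 1%:M.
    rewrite -!mulmxA; apply: mulmx1C.
    by rewrite -[RHS](mulVmx (Mm_unit y)) -/(N y) [in RHS]/Mm !mulmxA.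
  by rewrite -[LHS](mulmxK (gram_unit y)) h1 -h2 mulmxK.
have -> : \sum_k 'D_(c k) ('D_(c k) (F q)) y = \tr (C *m H *m C^T).
  by apply: eq_bigr => k _; rewrite hessianE // [RHS]mulmx_trmx_row !rowK.
rewrite mxtrace_mulC mulmxA CC.
have NT : (N y)^T = N y.
  rewrite /N trmx_inv; congr invmx; apply/matrixP => k l; rewrite mxE !MmE dotC.
  by congr (_ - _); apply: eq_bigr => i _; exact: mulrC.
have -> : B^T *m N y *m B *m H = B^T *m ((N y)^T *m B *m H) by rewrite NT !mulmxA.
rewrite mxtrace_mulC -mulmxA -[(N y)^T *m _ *m _]mulmxA -mulmxA.
rewrite /mxtrace exchange_big /=; apply: eq_bigr => l _.
rewrite [RHS]mxE; apply: eq_bigr => k _; rewrite [in RHS]mxE; congr (_ * _).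
by rewrite hessianE // mulmxA [RHS]mulmx_trmx_row !rowK.
Qed.

Let mt t k l := \sum_q 'D_(b k) ('D_t (F q)) x * 'D_(b l) (F q) x.

(** Differentiate N Mm = 1 at [x], where both factors are the identity: the derivatives of N and Mm
    are opposite. *)
Let derive_N t k l : 'D_t (fun y => N y k l) x = mt t k l + mt t l k.
Proof.
have sMl (i j : 'I_n) : is_derive (0 : R) (1 : R) (fun r : R => Mm (x + r *: t) i j)
    ('D_t (fun y => Mm y i j) (x + 0 *: t)).
  exact: smooth_line (M_smooth i j).
have sNl (i j : 'I_n) : is_derive (0 : R) (1 : R) (fun r : R => N (x + r *: t) i j)
    ('D_t (fun y => N y i j) (x + 0 *: t)).
  exact: smooth_line (N_smooth i j).
have Nx : N x = 1%:M by rewrite /N Mmx invmx1.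
have [_] := isd_sum (fun j => isdM (sNl k j) (sMl j l)).
have -> : (fun r : R => \sum_j N (x + r *: t) k j * Mm (x + r *: t) j l) = fun=> (k == l)%:R.
  apply/funext => r; have := mulVmx (Mm_unit (x + r *: t)).
  by move=> /matrixP /(_ k l); rewrite !mxE.
rewrite derive_cst scale0r addr0 Mmx Nx => /esym.
rewrite big_split /= (bigD1 l) //= big1 => [|j jl]; last by rewrite mxE (negPf jl) mulr0.
rewrite [X in _ + X = _](bigD1 k) //= [X in _ + (_ + X)]big1 => [|j jk]; last first.
  by rewrite mxE eq_sym (negPf jk) mul0r.
rewrite !mxE !eqxx mulr1 mul1r !addr0 => /eqP; rewrite addr_eq0 => /eqP ->.
have sF i q := smooth_line x t (0:R) (smooth_derive (b i) (F_smooth q)).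
have [_ E1] := sMl k l; rewrite scale0r addr0 in E1; rewrite -{}E1.
have -> : (fun r : R => Mm (x + r *: t) k l) = fun r => dot (b k) (b l) +
    - \sum_q 'D_(b k) (F q) (x + r *: t) * 'D_(b l) (F q) (x + r *: t).
  by apply/funext => r; rewrite MmE.
have [_ ->] := isdD (isd_cst 0 (dot (b k) (b l))) (isdN (isd_sum (fun q => isdM (sF k q) (sF l q)))).
rewrite add0r opprK scale0r addr0 big_split /=.
have c i q : 'D_t ('D_(b i) (F q)) x = 'D_(b i) ('D_t (F q)) x by exact: smooth_comm.
rewrite /mt; apply: (f_equal2 +%R).
  by apply: eq_bigr => q _; rewrite c.
by apply: eq_bigr => q _; rewrite c mulrC.
Qed.

(* In the fixed frame [b] the system reads
   [\sum_k \sum_l N y k l * 'D_(b k) ('D_(b l) (F q)) y = ('D_y (F q) y - F q y) / 2],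
   with [N y] the inverse Gram matrix of the induced metric; differentiate it at
   [x] in the direction [t]. *)
Lemma derive_pde t q :
  \sum_k 'D_(b k) ('D_(b k) ('D_t (F q))) x
    + 2 * \sum_k \sum_l mt t k l * 'D_(b k) ('D_(b l) (F q)) x
  = 2%:R^-1 * 'D_x ('D_t (F q)) x.
Proof.
have sNl (i j : 'I_n) := smooth_line x t (0:R) (N_smooth i j).
have sSl (i j : 'I_n) := smooth_line x t (0:R) (smooth_derive (b i) (smooth_derive (b j) (F_smooth q))).
have Nx : N x = 1%:M by rewrite /N Mmx invmx1.
have [_ H1] := isd_sum (fun k => isd_sum (fun l => isdM (sNl k l) (sSl k l))).
have [_ H2] := isdM (isd_cst 0 2%:R^-1) (isdD
  (isdD (smooth_line x t (0:R) (smooth_derive x (F_smooth q)))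
     (isdM (isd_id 0) (smooth_line x t (0:R) (smooth_derive t (F_smooth q)))))
  (isdN (smooth_line x t (0:R) (F_smooth q)))).
move: H1 H2; rewrite scale0r addr0 => H1 H2.
(* The direction in ['D_y (F q) y] moves with the point; the extra ['D_t (F q)] this produces
   cancels the derivative of [- F q y], so only the drift remains. *)
have : (fun r : R => \sum_k \sum_l N (x + r *: t) k l * 'D_(b k) ('D_(b l) (F q)) (x + r *: t))
   = (fun r : R => 2%:R^-1 * ('D_x (F q) (x + r *: t) + r * 'D_t (F q) (x + r *: t)
        + - F q (x + r *: t))).
  apply/funext => r; rewrite pde_fixed_frame; congr (_ * (_ - _)).
  by rewrite smooth_deriveD // smooth_deriveZ.
move=> E; rewrite E H2 in H1; move: H1.
have -> : \sum_k \sum_l ('D_t (fun y => N y k l) x * 'D_(b k) ('D_(b l) (F q)) x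
      + N x k l * 'D_t ('D_(b k) ('D_(b l) (F q))) x) =
   2 * \sum_k \sum_l mt t k l * 'D_(b k) ('D_(b l) (F q)) x
   + \sum_k 'D_(b k) ('D_(b k) ('D_t (F q))) x.
  transitivity (\sum_k ((\sum_l mt t k l * 'D_(b k) ('D_(b l) (F q)) x
     + \sum_l mt t l k * 'D_(b l) ('D_(b k) (F q)) x) + 'D_(b k) ('D_(b k) ('D_t (F q))) x)).
    apply: eq_bigr => k _; rewrite big_split /=; congr (_ + _).
      rewrite -big_split /=; apply: eq_bigr => l _.
      by rewrite derive_N mulrDl [in X in _ + X = _]smooth_comm.
    rewrite (bigD1 k) //= big1 => [|l lk]; last by rewrite Nx mxE eq_sym (negPf lk) mul0r.
    rewrite Nx mxE eqxx mul1r addr0.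
    have C1 := smooth_comm t (b k) x (smooth_derive (b k) (F_smooth q)).
    have C2 : 'D_t ('D_(b k) (F q)) = 'D_(b k) ('D_t (F q)).
      by apply/funext => y; exact: (smooth_comm t (b k) y (F_smooth q)).
    exact: (etrans C1 (congr1 (fun g => 'D_(b k) g x) C2)).
  exact: (sum_sym (fun k l => mt t k l * 'D_(b k) ('D_(b l) (F q)) x)).
rewrite mul0r add0r mul0r mul1r addr0 addrK => E'.
by rewrite addrC -E' (smooth_comm t x x (F_smooth q)).
Qed.

End AtPoint.
End ShrinkerSystem.

(* Distinct derivatives are compared up to conversion by [ring] and [lra], which
   is prohibitively slow: name them first. *)
Ltac name_atoms := cbv beta;
  repeat match goal with |- context [@bigop ?A ?B ?x ?r ?f] =>
    generalize (@bigop A B x r f); intro end;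
  repeat match goal with |- context [@derive ?A ?B ?C ?f ?x ?v] =>
    move: (@derive A B C f x v) => ? end;
  repeat match goal with |- context [@dot ?A ?B ?x ?v] =>
    generalize (@dot A B x v); intro end.

(** This and the next facts normalise the expressions that the one-variable derivative rules produce
    along the paths of [path_conditions]. *)
Fact d1_identity (R : comPzRingType) (s s0 s1 s2 s3 s4 s5 s6 r e : R) :
  s - (0 + (1 * (- 2 * s2 + r * s3) + r * (0 + (1 * s3 + r * 0)))) -
  (0 * (s4 + r * (2 * s5 + r * s6) - s0) +
   e * (0 + (1 * (2 * s5 + r * s6) + r * (0 + (1 * s6 + r * 0))) - s1)) =
  s - (- 2 * s2 + r * (2 * s3)) - e * (2 * s5 + r * (2 * s6) - s1).
Proof. by ring. Qed.

Fact d2_identity (R : comPzRingType) (s s0 s1 c1 b0 b1 e : R) :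
  s - (0 + (1 * (2 * c1) + 0 * 0)) -
  (0 * (2 * b0 + 0 * (2 * b1) - s0) + e * (0 + (1 * (2 * b1) + 0 * 0) - s1)) =
  s - 2 * c1 - e * (2 * b1 - s1).
Proof. by ring. Qed.

Fact d3_identity (R : comPzRingType) (a b c g : R) :
  a + b + (1 * (c + b) + 0 * g) = a + c + 2 * b.
Proof. by ring. Qed.

Fact d5_identity (R : comPzRingType) (a b c r g : R) :
  a + (1 * (b + c) + r * g) + - b = a + c + r * g.
Proof. by ring. Qed.

Fact first_order_half (R : realDomainType) (a d e b s : R) :
  2 * a - -2 * d - e * (2 * b - 2 * s) = 0 -> a + d = e * (b - s).
Proof. by move=> h; lra. Qed.

Fact second_order_half (R : realDomainType) (a d e b s : R) :
  2 * a - 2 * d - e * (2 * b - 2 * s) <= 0 -> a - d <= e * (b - s).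
Proof. by move=> h; lra. Qed.

Lemma dot_suml (R : realType) (n : nat) (I : finType) (m : I -> R) (b : I -> 'rV[R]_n) c :
  dot (\sum_l m l *: b l) c = \sum_l m l * dot (b l) c.
Proof.
apply: (big_ind2 (fun x y => dot x c = y)) => [|x y x' y' <- <-|l _]; first exact: dot0l.
  exact: dotDl.
exact: dotZl.
Qed.

(* The left hand side is the sum of squares [\sum_q a q ^+ 2 + \sum_l m l ^+ 2]. *)
Lemma complete_square (R : realType) (n p : nat) (a : 'I_p -> R) (J : 'I_n -> 'I_p -> R)
    (b : 'I_n -> 'rV[R]_n) (m : 'I_n -> R) :
  (forall k l, dot (b k) (b l) - \sum_q J k q * J l q = (k == l)%:R) ->
  (forall l, m l = \sum_q a q * J l q) ->
  0 <= \sum_q (a q + \sum_l m l * J l q) ^+ 2 - dot (\sum_l m l *: b l) (\sum_l m l *: b l).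
Proof.
move=> bJ mE; pose d q := \sum_l m l * J l q.
have ad : \sum_q a q * d q = \sum_l m l ^+ 2.
  under eq_bigr do rewrite mulr_sumr.
  rewrite exchange_big /=; apply: eq_bigr => l _.
  by rewrite expr2 [X in _ = m l * X]mE mulr_sumr; apply: eq_bigr => q _; ring.
have cc : dot (\sum_l m l *: b l) (\sum_l m l *: b l) = \sum_l m l ^+ 2 + \sum_q d q ^+ 2.
  have -> : \sum_q d q ^+ 2 = \sum_k \sum_l m k * m l * \sum_q J k q * J l q.
    transitivity (\sum_q \sum_k \sum_l m k * m l * (J k q * J l q)).
      apply: eq_bigr => q _; rewrite expr2 mulr_suml; apply: eq_bigr => k _.
      by rewrite mulr_sumr; apply: eq_bigr => l _; ring.
    rewrite exchange_big /=; apply: eq_bigr => k _; rewrite exchange_big /=.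
    by apply: eq_bigr => l _; rewrite mulr_sumr.
  rewrite dot_suml -big_split /=; apply: eq_bigr => k _.
  rewrite dotC dot_suml mulr_sumr.
  transitivity (\sum_l (m k * m l * (k == l)%:R + m k * m l * \sum_q J k q * J l q)).
    by apply: eq_bigr => l _; rewrite dotC -bJ; ring.
  rewrite big_split /= (bigD1 k) //= big1 => [|l lk]; last by rewrite eq_sym (negPf lk) mulr0.
  by rewrite eqxx mulr1 addr0 expr2.
have -> : \sum_q (a q + d q) ^+ 2 = \sum_q a q ^+ 2 + 2 * \sum_l m l ^+ 2 + \sum_q d q ^+ 2.
  rewrite -ad mulr_sumr -!big_split /=; apply: eq_bigr => q _; ring.
rewrite cc; have h1 : 0 <= \sum_q a q ^+ 2 by apply: sumr_ge0 => *; exact: sqr_ge0.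
have h2 : 0 <= \sum_l m l ^+ 2 by apply: sumr_ge0 => *; exact: sqr_ge0.
lra.
Qed.

Fact sum_split3 (R : comPzRingType) (I : finType) (A B C C' : I -> R) :
  (forall k, C k = C' k) ->
  \sum_k (A k + B k + 2 * C k) = \sum_k A k + 2 * (\sum_k C' k) + \sum_k B k.
Proof.
move=> CC; rewrite mulr_sumr -!big_split /=; apply: eq_bigr => k _.
by rewrite CC addrAC.
Qed.

Fact max_bound_arith (R : realFieldType) (s1 s2 s3 e d y1 y2 k : R) :
  s1 = e * (d - y1) -> 2^-1 * (s1 + s2) <= e * (k - 2^-1 * (y1 - y2)) -> s2 = s3 ->
  s3 <= e * (2 * k - d + y2).
Proof. by move=> h1 h2 h3; nra. Qed.

(** * First and second variation at a penalised maximum *)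

Section MaximumPrinciple.
Variables (R : realType) (n p : nat).
Variable F : 'I_p -> 'rV[R]_n -> R.
Hypothesis F_smooth : forall q, smooth (F q).
Hypothesis F_contr : forall x b, b != 0 -> \sum_q 'D_b (F q) x ^+ 2 < dot b b.
Hypothesis F_pde : forall x, exists2 b, graph_frame F x b &
  forall q, \sum_k 'D_(b k) ('D_(b k) (F q)) x = 2%:R^-1 * ('D_x (F q) x - F q x).

(* [- <X - V, X - V>] for the tangent vector [V] with spacelike part [t] *)
Definition defect x t : R :=
  \sum_q ('D_t (F q) x - F q x) ^+ 2 - dot (x - t) (x - t).

(* the squared Lorentzian distance to the point of the graph above [0] *)
Definition height x : R := dot x x - \sum_q (F q x - F q 0) ^+ 2.

Section Maximum.
Variables (x t : 'rV[R]_n) (e : R).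
Hypothesis max_xt : forall x' t', defect x' t' - e * height x' <= defect x t - e * height x.

Let N q := 'D_t (F q) x - F q x.

(* First and second derivative of [defect - e * height] along
   [r |-> (x + r *: b, t + r *: (b + c))]. *)
Let path_conditions b c :
  \sum_q N q * ('D_b ('D_t (F q)) x + 'D_c (F q) x) + dot (x - t) c
    = e * (dot x b - \sum_q (F q x - F q 0) * 'D_b (F q) x) /\
  \sum_q (('D_b ('D_t (F q)) x + 'D_c (F q) x) ^+ 2
     + N q * ('D_b ('D_b ('D_t (F q))) x + 'D_b ('D_b (F q)) x + 2 * 'D_b ('D_c (F q)) x))
    - dot c c
    <= e * (dot b b - \sum_q ('D_b (F q) x ^+ 2 + (F q x - F q 0) * 'D_b ('D_b (F q)) x)).
Proof.
(* This is the bracket inside [defect] at time [r], with the moving direction expanded by linearity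
   so that only derivatives in fixed directions occur. *)
pose P q (r : R) := 'D_t (F q) (x + r *: b)
  + r * ('D_b (F q) (x + r *: b) + 'D_c (F q) (x + r *: b)) - F q (x + r *: b).
pose P1 q (r : R) := 'D_b ('D_t (F q)) (x + r *: b) + 'D_c (F q) (x + r *: b)
  + r * ('D_b ('D_b (F q)) (x + r *: b) + 'D_b ('D_c (F q)) (x + r *: b)).
pose f (r : R) := \sum_q P q r * P q r
  - (dot (x - t) (x - t) + r * (- 2 * dot (x - t) c + r * dot c c))
  - e * ((dot x x + r * (2 * dot x b + r * dot b b))
         - \sum_q (F q (x + r *: b) - F q 0) * (F q (x + r *: b) - F q 0)).
pose f1 (r : R) := \sum_q 2 * (P q r * P1 q r)
  - (- 2 * dot (x - t) c + r * (2 * dot c c))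
  - e * ((2 * dot x b + r * (2 * dot b b))
         - \sum_q 2 * ((F q (x + r *: b) - F q 0) * 'D_b (F q) (x + r *: b))).
have fE r : f r = defect (x + r *: b) (t + r *: (b + c)) - e * height (x + r *: b).
  rewrite /f /defect /height.
  have -> : x + r *: b - (t + r *: (b + c)) = (x - t) - r *: c.
    by apply/rowP => i; rewrite !mxE; ring.
  rewrite dot_sub !(dotDl, dotDr, dotNl, dotNr, dotZl, dotZr).
  rewrite (dotC b x) (dotC t x) (dotC c x) (dotC c t).
  have -> : \sum_q ('D_(t + r *: (b + c)) (F q) (x + r *: b) - F q (x + r *: b)) ^+ 2 =
      \sum_q P q r * P q r.
    apply: eq_bigr => q _; rewrite expr2 (smooth_deriveD _ _ _ (F_smooth q)).
    by rewrite (smooth_deriveZ _ _ _ (F_smooth q)) (smooth_deriveD _ _ _ (F_smooth q)).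
  have -> : \sum_q (F q (x + r *: b) - F q 0) ^+ 2 =
      \sum_q (F q (x + r *: b) - F q 0) * (F q (x + r *: b) - F q 0).
    by apply: eq_bigr => q _; exact: expr2.
  by name_atoms; ring.
have dP q r : is_derive r (1 : R) (P q) (P1 q r).
  have H := isdD (isdD (smooth_line x b r (smooth_derive t (F_smooth q)))
    (isdM (isd_id r) (isdD (smooth_line x b r (smooth_derive b (F_smooth q)))
                           (smooth_line x b r (smooth_derive c (F_smooth q))))))
    (isdN (smooth_line x b r (F_smooth q))).
  by apply: (is_derive_eq H); exact: d5_identity.
have dF q r : is_derive r (1 : R) (fun r => F q (x + r *: b) - F q 0) ('D_b (F q) (x + r *: b)).
  have H := isdD (smooth_line x b r (F_smooth q)) (isd_cst r (- F q 0)).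
  by apply: (is_derive_eq H); rewrite addr0.
have dS r : is_derive r (1 : R) (fun r => \sum_q P q r * P q r) (\sum_q 2 * (P q r * P1 q r)).
  apply: (is_derive_eq (isd_sum (fun q => isdM (dP q r) (dP q r)))).
  by apply: eq_bigr => q _; move: (P1 q r) (P q r) => *; ring.
have dS' r : is_derive r (1 : R)
    (fun r => \sum_q (F q (x + r *: b) - F q 0) * (F q (x + r *: b) - F q 0))
    (\sum_q 2 * ((F q (x + r *: b) - F q 0) * 'D_b (F q) (x + r *: b))).
  apply: (is_derive_eq (isd_sum (fun q => isdM (dF q r) (dF q r)))).
  by apply: eq_bigr => q _; name_atoms; ring.
have df r : is_derive r (1 : R) f (f1 r).
  have H := isdD (isdD (dS r)
     (isdN (isdD (isd_cst r (dot (x - t) (x - t)))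
       (isdM (isd_id r) (isdD (isd_cst r (- 2 * dot (x - t) c))
          (isdM (isd_id r) (isd_cst r (dot c c))))))))
     (isdN (isdM (isd_cst r e) (isdD
        (isdD (isd_cst r (dot x x)) (isdM (isd_id r) (isdD (isd_cst r (2 * dot x b))
           (isdM (isd_id r) (isd_cst r (dot b b))))))
        (isdN (dS' r))))).
  apply: (is_derive_eq H).
  rewrite /f1.
  name_atoms.
  exact: (@d1_identity R).
pose Q2 q := 'D_b ('D_b ('D_t (F q))) x + 'D_b ('D_b (F q)) x + 2 * 'D_b ('D_c (F q)) x.
have x0 : x + 0 *: b = x by rewrite scale0r addr0.
have dP1 q : is_derive (0 : R) (1 : R) (P1 q) (Q2 q).
  have H := isdD (isdD (smooth_line x b (0:R) (smooth_derive b (smooth_derive t (F_smooth q))))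
     (smooth_line x b (0:R) (smooth_derive c (F_smooth q))))
    (isdM (isd_id 0) (isdD (smooth_line x b (0:R) (smooth_derive b (smooth_derive b (F_smooth q))))
       (smooth_line x b (0:R) (smooth_derive b (smooth_derive c (F_smooth q)))))).
  by apply: (is_derive_eq H); rewrite x0; exact: d3_identity.
have PN q : P q 0 = N q by rewrite /P x0 mul0r addr0.
have P10 q : P1 q 0 = 'D_b ('D_t (F q)) x + 'D_c (F q) x by rewrite /P1 x0 mul0r addr0.
pose a := \sum_q 2 * (P1 q 0 ^+ 2 + N q * Q2 q) - 2 * dot c c
  - e * (2 * dot b b - \sum_q 2 * ('D_b (F q) x ^+ 2 + (F q x - F q 0) * 'D_b ('D_b (F q)) x)).
have dT : is_derive (0 : R) (1 : R) (fun r => \sum_q 2 * (P q r * P1 q r))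
    (\sum_q 2 * (P1 q 0 ^+ 2 + N q * Q2 q)).
  apply: (is_derive_eq (isd_sum (fun q => isdM (isd_cst 0 2) (isdM (dP q 0) (dP1 q))))).
  by apply: eq_bigr => q _; rewrite PN; move: (P1 q 0) (N q) (Q2 q) => *; ring.
have dT' : is_derive (0 : R) (1 : R)
    (fun r : R => \sum_q 2 * ((F q (x + r *: b) - F q 0) * 'D_b (F q) (x + r *: b)))
    (\sum_q 2 * ('D_b (F q) x ^+ 2 + (F q x - F q 0) * 'D_b ('D_b (F q)) x)).
  apply: (is_derive_eq (isd_sum (fun q => isdM (isd_cst 0 2)
           (isdM (dF q 0) (smooth_line x b (0:R) (smooth_derive b (F_smooth q))))))).
  by apply: eq_bigr => q _; rewrite x0; name_atoms; ring.
have df1 : is_derive (0 : R) (1 : R) f1 a.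
  have H := isdD (isdD dT
     (isdN (isdD (isd_cst 0 (- 2 * dot (x - t) c)) (isdM (isd_id 0) (isd_cst 0 (2 * dot c c))))))
     (isdN (isdM (isd_cst 0 e) (isdD
        (isdD (isd_cst 0 (2 * dot x b)) (isdM (isd_id 0) (isd_cst 0 (2 * dot b b))))
        (isdN dT')))).
  apply: (is_derive_eq H).
  rewrite /a.
  name_atoms.
  exact: (@d2_identity R).
have fmax r : f r <= f 0 by rewrite !fE !scale0r !addr0.
have [f10 a0] := second_derivative_test df df1 fmax.
have E1 : \sum_q 2 * (P q 0 * P1 q 0) =
    2 * \sum_q N q * ('D_b ('D_t (F q)) x + 'D_c (F q) x).
  by rewrite mulr_sumr; apply: eq_bigr => q _; rewrite PN P10.
have E2 : \sum_q 2 * ((F q (x + 0 *: b) - F q 0) * 'D_b (F q) (x + 0 *: b)) =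
    2 * \sum_q (F q x - F q 0) * 'D_b (F q) x.
  by rewrite mulr_sumr; apply: eq_bigr => q _; rewrite x0.
have E3 : \sum_q 2 * (P1 q 0 ^+ 2 + N q * Q2 q) =
    2 * \sum_q (('D_b ('D_t (F q)) x + 'D_c (F q) x) ^+ 2 + N q * Q2 q).
  by rewrite mulr_sumr; apply: eq_bigr => q _; rewrite P10.
have E4 : \sum_q 2 * ('D_b (F q) x ^+ 2 + (F q x - F q 0) * 'D_b ('D_b (F q)) x) =
    2 * \sum_q ('D_b (F q) x ^+ 2 + (F q x - F q 0) * 'D_b ('D_b (F q)) x).
  by rewrite mulr_sumr.
split.
  by move: f10; rewrite /f1 E1 E2 !mul0r !addr0; exact: (@first_order_half R).
by move: a0; rewrite /a E3 E4; exact: (@second_order_half R).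
Qed.

(* The second variations along [b k], the spacelike part moving by
   [b k + c k], are summed over an orthonormal frame; [c k] makes the terms
   quadratic in the first derivatives of ['D_t F] nonnegative. *)
Lemma max_bound :
  defect x t <= e * (2 * n%:R - dot x x + \sum_q (F q x - F q 0) * F q x).
Proof.
have [b bx Hpde] := F_pde x.
pose m k l := \sum_q 'D_(b k) ('D_t (F q)) x * 'D_(b l) (F q) x.
(* With this choice [2 * 'D_(b k) ('D_(c k) (F q))] is, after summation over [k], exactly the metric
   term of [derive_pde]. *)
pose c k := \sum_l m k l *: b l.
have D0 q : 'D_0 (F q) x = 0.
  by have := smooth_deriveZ 0 (0 : 'rV[R]_n) x (F_smooth q); rewrite scale0r mul0r.
have D0' q : 'D_0 ('D_t (F q)) x = 0.
  have := smooth_deriveZ 0 (0 : 'rV[R]_n) x (smooth_derive t (F_smooth q)).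
  by rewrite scale0r mul0r.
(* Moving both arguments along [x] shows that the drift is of order [e]; moving only the second one,
   along [x - t], gives the relation that produces the defect in [S2]. *)
have [A1 _] := path_conditions x 0.
have [A2 _] := path_conditions 0 (x - t).
have S1 : \sum_q N q * 'D_x ('D_t (F q)) x =
    e * (dot x x - \sum_q (F q x - F q 0) * 'D_x (F q) x).
  rewrite -A1 dot0r addr0; apply: eq_bigr => q _.
  by rewrite (D0 q) addr0.
have S2 : \sum_q N q * ('D_x (F q) x - F q x) = defect x t.
  have E q : 'D_x (F q) x = 'D_t (F q) x + 'D_(x - t) (F q) x.
    by rewrite -(smooth_deriveD _ _ _ (F_smooth q)) subrKC.
  have A3 : \sum_q N q * 'D_(x - t) (F q) x = - dot (x - t) (x - t).
    apply/eqP; rewrite -addr_eq0; apply/eqP.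
    transitivity (e * (dot x 0 - \sum_q (F q x - F q 0) * 'D_0 (F q) x)).
      rewrite -A2; congr (_ + _); apply: eq_bigr => q _.
      by rewrite (D0' q) add0r.
    rewrite dot0r big1 ?subr0 ?mulr0 // => q _.
    by rewrite (D0 q) mulr0.
  rewrite /defect -A3 -big_split /=; apply: eq_bigr => q _.
  rewrite E /N; move: ('D_t (F q) x) ('D_(x - t) (F q) x) => u v; ring.
have S3 : 0 <= \sum_k (\sum_q ('D_(b k) ('D_t (F q)) x + 'D_(c k) (F q) x) ^+ 2 - dot (c k) (c k)).
  apply: sumr_ge0 => k _.
  have -> : \sum_q ('D_(b k) ('D_t (F q)) x + 'D_(c k) (F q) x) ^+ 2 =
      \sum_q ('D_(b k) ('D_t (F q)) x + \sum_l m k l * 'D_(b l) (F q) x) ^+ 2.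
    by apply: eq_bigr => q _; rewrite (smooth_derive_sum _ _ _ (F_smooth q)).
  exact: (@complete_square R n p _ (fun l q => 'D_(b l) (F q) x) b (m k) bx (fun l => erefl)).
have S4 : \sum_k (dot (b k) (b k) - \sum_q ('D_(b k) (F q) x ^+ 2
      + (F q x - F q 0) * 'D_(b k) ('D_(b k) (F q)) x)) =
    n%:R - 2^-1 * \sum_q (F q x - F q 0) * ('D_x (F q) x - F q x).
  transitivity (\sum_(k < n) (1 - \sum_q (F q x - F q 0) * 'D_(b k) ('D_(b k) (F q)) x)).
    apply: eq_bigr => k _; rewrite big_split /= opprD addrA; congr (_ - _).
    by rewrite -[RHS](congr1 (fun b : bool => b%:R) (eqxx k)) -bx.
  rewrite big_split /= sumr_const card_ord sumrN exchange_big /= mulr_sumr.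
  congr (_ - _); apply: eq_bigr => q _.
  by rewrite -mulr_sumr Hpde mulrCA.
have S5 : \sum_k \sum_q N q * ('D_(b k) ('D_(b k) ('D_t (F q))) x + 'D_(b k) ('D_(b k) (F q)) x
      + 2 * 'D_(b k) ('D_(c k) (F q)) x) =
    2^-1 * (\sum_q N q * 'D_x ('D_t (F q)) x + \sum_q N q * ('D_x (F q) x - F q x)).
  have T q : \sum_k ('D_(b k) ('D_(b k) ('D_t (F q))) x + 'D_(b k) ('D_(b k) (F q)) x
      + 2 * 'D_(b k) ('D_(c k) (F q)) x) =
      2^-1 * ('D_x ('D_t (F q)) x + ('D_x (F q) x - F q x)).
    rewrite mulrDr; apply: etrans (f_equal2 +%R (derive_pde F_smooth F_contr F_pde bx t q) (Hpde q)).
    apply: sum_split3 => k.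
    exact: (smooth_derive2_sum (m k) b (b k) x (F_smooth q)).
  rewrite exchange_big -big_split /= mulr_sumr; apply: eq_bigr => q _.
  rewrite -[LHS]mulr_sumr T -[in RHS]mulrDr.
  exact: mulrCA.
have S6 : \sum_k (\sum_q (('D_(b k) ('D_t (F q)) x + 'D_(c k) (F q) x) ^+ 2
     + N q * ('D_(b k) ('D_(b k) ('D_t (F q))) x + 'D_(b k) ('D_(b k) (F q)) x
              + 2 * 'D_(b k) ('D_(c k) (F q)) x)) - dot (c k) (c k)) <=
   \sum_k e * (dot (b k) (b k) - \sum_q ('D_(b k) (F q) x ^+ 2
      + (F q x - F q 0) * 'D_(b k) ('D_(b k) (F q)) x)).
  by apply: ler_sum => k _; have [_] := path_conditions (b k) (c k).
rewrite -mulr_sumr S4 in S6.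
have S7 : 2^-1 * (\sum_q N q * 'D_x ('D_t (F q)) x + \sum_q N q * ('D_x (F q) x - F q x)) <=
    e * (n%:R - 2^-1 * \sum_q (F q x - F q 0) * ('D_x (F q) x - F q x)).
  apply: le_trans S6; rewrite -S5 -[leLHS]add0r.
  rewrite [leRHS](eq_bigr (fun k => (\sum_q ('D_(b k) ('D_t (F q)) x + 'D_(c k) (F q) x) ^+ 2 - dot (c k) (c k))
    + \sum_q N q * ('D_(b k) ('D_(b k) ('D_t (F q))) x + 'D_(b k) ('D_(b k) (F q)) x
              + 2 * 'D_(b k) ('D_(c k) (F q)) x))) => [|k _].
    by rewrite [leRHS]big_split /= lerD2r.
  by rewrite big_split /= addrAC.
have S8 : \sum_q (F q x - F q 0) * ('D_x (F q) x - F q x) =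
    \sum_q (F q x - F q 0) * 'D_x (F q) x - \sum_q (F q x - F q 0) * F q x.
  by rewrite -sumrB; apply: eq_bigr => q _; rewrite mulrBr.
rewrite S8 in S7.
exact: (max_bound_arith S1 S7 S2).
Qed.

End Maximum.
End MaximumPrinciple.

Fact young (R : realFieldType) (a b : R) : a * b <= 2^-1 * (a ^+ 2 + b ^+ 2).
Proof. by have := sqr_ge0 (a - b); rewrite sqrrB; lra. Qed.

Fact weighted_young (R : realFieldType) (a b r : R) : 1 < r ->
  (a + b) ^+ 2 <= r / (r - 1) * a ^+ 2 + r * b ^+ 2.
Proof.
move=> r1; have s0 : 0 < r - 1 by rewrite subr_gt0.
rewrite -subr_ge0.
have -> : r / (r - 1) * a ^+ 2 + r * b ^+ 2 - (a + b) ^+ 2 = (a - (r - 1) * b) ^+ 2 / (r - 1).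
  by field; lra.
by rewrite divr_ge0 ?sqr_ge0 // ltW.
Qed.

(** * Growth of the height *)

Section Growth.
Variables (R : realType) (n p : nat).
Variable F : 'I_p -> 'rV[R]_n -> R.
Hypothesis F_smooth : forall q, smooth (F q).
Hypothesis F_contr : forall x b, b != 0 -> \sum_q 'D_b (F q) x ^+ 2 < dot b b.

(** The mean value theorem is applied to the scalar obtained by pairing [F] with the fixed vector
    [d]; Young's inequality then bounds |d|^2 by the squared derivative at an intermediate point. *)
Lemma strict_contraction x y : x != y ->
  \sum_q (F q x - F q y) ^+ 2 < dot (x - y) (x - y).
Proof.
move=> xy; pose d q := F q x - F q y.
pose phi (r : R) := \sum_q d q * F q (y + r *: (x - y)).
pose phi' (r : R) := \sum_q d q * 'D_(x - y) (F q) (y + r *: (x - y)).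
have dphi r : is_derive r (1 : R) phi (phi' r).
  apply: (is_derive_eq (isd_sum (fun q =>
    isdM (isd_cst r (d q)) (smooth_line y (x - y) r (F_smooth q))))).
  by apply: eq_bigr => q _; rewrite mul0r add0r.
have [|c _] := @MVT R phi phi' 0 1 ltr01 (fun r _ => dphi r).
  by apply: derivable_within_continuous => r _; have [] := dphi r.
have -> : phi 1 - phi 0 = \sum_q d q ^+ 2.
  rewrite -sumrB; apply: eq_bigr => q _.
  by rewrite scale1r scale0r addr0 subrKC -mulrBr expr2.
rewrite subr0 mulr1 => E.
have xy0 : x - y != 0 by rewrite subr_eq0.
have := F_contr (y + c *: (x - y)) xy0.
have : phi' c <= 2^-1 * (\sum_q d q ^+ 2 + \sum_q 'D_(x - y) (F q) (y + c *: (x - y)) ^+ 2).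
  by rewrite -big_split mulr_sumr /=; apply: ler_sum => q _; exact: young.
rewrite -E -/d; move: (\sum_q d q ^+ 2) (\sum_q _) (dot _ _) => a b e h1 h2; lra.
Qed.

Lemma contraction x y : \sum_q (F q x - F q y) ^+ 2 <= dot (x - y) (x - y).
Proof.
have [->|xy] := eqVneq x y; last exact/ltW/strict_contraction.
by rewrite subrr dot0l big1 // => q _; rewrite subrr expr0n.
Qed.

Lemma height_ge0 x : 0 <= height F x.
Proof. by rewrite subr_ge0; have := contraction x 0; rewrite subr0. Qed.

Lemma height_continuous x : {for x, continuous (height F)}.
Proof.
suff : Ck 0 setT (height F) by move=> /Ck_continuous; apply.
apply: CkB; first exact: openT.
  apply: Ck_sum => [|i _]; first exact: openT.
  by apply: CkM; do ?[exact: openT]; apply: Ck_coord; exact: openT.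
apply: Ck_sum => [|q _]; first exact: openT.
have C : Ck 0 setT (fun y => F q y - F q 0).
  by apply: CkB; [exact: openT|exact: F_smooth|apply: Ck_cst; exact: openT].
by apply: (eq_Ck (f := fun y => (F q y - F q 0) * (F q y - F q 0)) openT) => //; apply: CkM; [exact: openT|..].
Qed.

(** [mu] is the minimum of the height on the unit sphere, positive by strict contraction. From there
    to radius [r] the map varies by at most r - 1, and Young's inequality weighted by [r] gives r (r
    - 1) + r (1 - mu) = r^2 - mu r. *)
Lemma height_growth : exists2 mu : R, 0 < mu &
  forall x r, 1 <= r -> dot x x = r ^+ 2 -> mu * r <= height F x.
Proof.
have [mu mu0 Hmu] : exists2 mu : R, 0 < mu & forall y, dot y y = 1 -> mu <= height F y.
  have [Z|/set0P S0] := eqVneq [set v : 'rV[R]_n | dot v v = 1] set0.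
    by exists 1 => // y y1; have : set0 y by rewrite -Z.
  have [|c /set_mem c1 cmin] := EVT_min_rV S0 (@sphere_compact R n) (f := height F).
    by apply: continuous_subspaceT => y; exact: height_continuous.
  exists (height F c); last by move=> y y1; apply: cmin; exact: mem_set.
  rewrite subr_gt0; have := @strict_contraction c 0; rewrite subr0; apply.
  by apply/eqP => c0; move: c1 => /=; rewrite c0 dot0l => /eqP; rewrite eq_sym oner_eq0.
exists mu => // x r r1 xr; have r0 : 0 < r by lra.
pose y := r^-1 *: x.
have xE : x = r *: y by rewrite /y scalerA mulfV ?scale1r ?gt_eqF.
have y1 : dot y y = 1 by rewrite /y dotZl dotZr xr; field; rewrite gt_eqF.
move: r1; rewrite le_eqVlt => /orP[/eqP r1|r1].
  by rewrite -r1 mulr1; apply: Hmu; rewrite xr -r1 expr1n.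
have h1 := Hmu y y1; rewrite /height y1 in h1; rewrite /height xr.
have h2 : \sum_q (F q x - F q y) ^+ 2 <= (r - 1) ^+ 2.
  have -> : (r - 1) ^+ 2 = dot (x - y) (x - y); last exact: contraction.
  have -> : x - y = (r - 1) *: y by rewrite scalerBl scale1r -xE.
  by rewrite dotZl dotZr y1 mulr1 expr2.
have h3 : \sum_q (F q x - F q 0) ^+ 2 <=
    r / (r - 1) * \sum_q (F q x - F q y) ^+ 2 + r * \sum_q (F q y - F q 0) ^+ 2.
  rewrite !mulr_sumr -big_split; apply: ler_sum => q _ /=.
  by have := weighted_young (F q x - F q y) (F q y - F q 0) r1; rewrite subrKA.
have h4 : r / (r - 1) * \sum_q (F q x - F q y) ^+ 2 <= r * (r - 1).
  have -> : r * (r - 1) = r / (r - 1) * (r - 1) ^+ 2 by field; lra.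
  by rewrite ler_wpM2l // divr_ge0; lra.
have h5 : r * \sum_q (F q y - F q 0) ^+ 2 <= r * (1 - mu).
  by rewrite ler_pM2l //; lra.
by have -> : mu * r = r ^+ 2 - (r * (r - 1) + r * (1 - mu)) by [ring]; lra.
Qed.

(** The left side is the bracket of [max_bound]. It equals 2 n - height + S, where S grows at most
    linearly and is absorbed by [height_growth]. *)
Lemma generator_bound : exists2 K : R, 0 < K & forall x,
  2 * n%:R - dot x x + \sum_q (F q x - F q 0) * F q x <= K * (1 + height F x).
Proof.
have [mu mu0 Hmu] := height_growth.
pose E0 := \sum_q F q 0 ^+ 2.
have E00 : 0 <= E0 by apply: sumr_ge0 => *; exact: sqr_ge0.
have n0 : 0 <= n%:R :> R by [].
exists (2 * n%:R + (1 + E0) * (1 + mu^-1)).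
  have : 0 < (1 + E0) * (1 + mu^-1) by rewrite mulr_gt0 ?ltr_wpDr ?invr_ge0 // ltW.
  by lra.
move=> x; have z0 := height_ge0 x.
pose G := \sum_q (F q x - F q 0) ^+ 2; pose S := \sum_q (F q x - F q 0) * F q 0.
have GS : \sum_q (F q x - F q 0) * F q x = G + S.
  by rewrite -big_split /=; apply: eq_bigr => q _; ring.
have Gx : G <= dot x x by have := contraction x 0; rewrite subr0.
(* Young's inequality with a free scale: for [r] the Euclidean length of [x] it bounds [S] linearly
   in [r], and for 1 it serves inside the unit ball. *)
have SE r : r * S <= 2^-1 * (G + r ^+ 2 * E0).
  rewrite /G /S /E0 !mulr_sumr -big_split mulr_sumr; apply: ler_sum => q _ /=.
  by have := young (F q x - F q 0) (r * F q 0); rewrite exprMn; lra.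
suff S0 : S <= (1 + E0) * (1 + mu^-1 * height F x).
  have muV0 : 0 < mu^-1 by rewrite invr_gt0.
  have h1 : (1 + E0) * (1 + mu^-1 * height F x) <= (1 + E0) * (1 + mu^-1) * (1 + height F x).
    rewrite -mulrA ler_wpM2l; [by []|lra|].
    have := mulr_ge0 (ltW muV0) z0; lra.
  have h2 := mulr_ge0 n0 z0.
  have hE : height F x = dot x x - G by [].
  rewrite GS mulrDl; move: hE z0 h1 h2 S0 => hE z0 h1 h2 S0; lra.
pose r := Num.sqrt (dot x x); have r0 : 0 <= r := sqrtr_ge0 _.
have rE : dot x x = r ^+ 2 by rewrite sqr_sqrtr ?dot_ge0.
have muz : 0 <= mu^-1 * height F x by rewrite mulr_ge0 ?invr_ge0 // ltW.
have [r1|r1] := ltP r 1.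
  have := SE 1; have : r ^+ 2 <= 1 by rewrite expr_le1 // ltW.
  have := mulr_ge0 E00 muz.
  by move: muz; rewrite mulrDl; move: (mu^-1 * height F x) => z; lra.
have rz : r <= mu^-1 * height F x by rewrite ler_pdivlMl //; exact: Hmu.
have h3 : S <= 2^-1 * (1 + E0) * r.
  have rp : 0 < r by lra.
  rewrite -(ler_pM2l rp); apply: (le_trans (SE r)).
  by move: Gx; rewrite rE; move: (G) (E0) => g e0 ?; nra.
apply: (le_trans h3); rewrite -subr_ge0.
have -> : (1 + E0) * (1 + mu^-1 * height F x) - 2^-1 * (1 + E0) * r =
  (1 + E0) * (1 + mu^-1 * height F x - 2^-1 * r) by ring.
by rewrite mulr_ge0; lra.
Qed.

End Growth.

Fact spacelike_bound_arith (R : realFieldType) (k s a d v w W : R) : 0 < k -> 1 < s ->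
  d < v -> v <= (1 + k) * a + s * w -> k * d <= d - a -> w <= W -> k ^+ 2 * d <= s * W.
Proof.
move=> k0 s1 dv h1 h2 h3.
have h4 : s * w <= s * W by rewrite ler_pM2l //; lra.
have h5 : (1 + k) * a <= (1 + k) * ((1 - k) * d) by rewrite ler_pM2l; lra.
have -> : k ^+ 2 * d = d - (1 + k) * ((1 - k) * d) by ring.
by lra.
Qed.

Fact le_1_add_sqr (R : realFieldType) (a : R) : a <= 1 + a ^+ 2.
Proof. by have := sqr_ge0 (2 * a - 1); have := sqr_ge0 a; rewrite sqrrB1 exprMn; lra. Qed.

(** * Nonpositivity of the defect *)

Section Nonpositivity.
Variables (R : realType) (n p : nat).
Variable F : 'I_p -> 'rV[R]_n -> R.
Hypothesis F_smooth : forall q, smooth (F q).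
Hypothesis F_contr : forall x b, b != 0 -> \sum_q 'D_b (F q) x ^+ 2 < dot b b.
Local Notation E := 'rV[R]_n.
Local Notation dF i q := ('D_(delta_mx 0 i) (F q)).

Let smooth_continuous (f : E -> R) x : smooth f -> {for x, continuous f}.
Proof. by move=> sf; exact: (Ck_continuous (sf 0)). Qed.

Let deriveE_coord v q x : 'D_v (F q) x = \sum_i v 0 i * dF i q x.
Proof. by apply: derive_sum_coord; exact: (Ck_differentiable (F_smooth q 1) I). Qed.

Lemma defect_continuous (u : E * E) : {for u, continuous (fun u : E * E => defect F u.1 u.2)}.
Proof.
have c1 (f : E -> R) : smooth f -> {for u, continuous (fun u : E * E => f u.1)}.
  by move=> sf; apply: (@continuous_comp _ _ _ fst f); [exact: cvg_fst|exact: smooth_continuous].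
have c11 l : {for u, continuous (fun x : E * E => x.1 0 l : R)}.
  apply: (@continuous_comp _ _ _ fst (fun v : E => v 0 l)); first exact: cvg_fst.
  exact/coord_continuous.
have c2 l : {for u, continuous (fun x : E * E => x.2 0 l : R)}.
  apply: (@continuous_comp _ _ _ snd (fun v : E => v 0 l)); first exact: cvg_snd.
  exact/coord_continuous.
have cN q : {for u, continuous (fun u : E * E => \sum_i u.2 0 i * dF i q u.1 - F q u.1)}.
  apply: continuousB; last exact: c1.
  apply: continuous_big_sum => i; apply: continuousM; first exact: c2.
  exact: (c1 _ (smooth_derive _ (F_smooth q))).
have -> : (fun u : E * E => defect F u.1 u.2) = fun u =>
    \sum_q (\sum_i u.2 0 i * dF i q u.1 - F q u.1) * (\sum_i u.2 0 i * dF i q u.1 - F q u.1)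
    - \sum_i (u.1 0 i - u.2 0 i) * (u.1 0 i - u.2 0 i).
  apply/funext => z; congr (_ - _).
    by apply: eq_bigr => q _; rewrite expr2 deriveE_coord.
  by apply: eq_bigr => i _; rewrite !mxE.
apply: continuousB; apply: continuous_big_sum => i; apply: continuousM; do ?exact: cN.
  by apply: continuousB; [exact: c11|exact: c2].
by apply: continuousB; [exact: c11|exact: c2].
Qed.

Let sqr_derive_sum v x : \sum_q 'D_v (F q) x ^+ 2 =
  \sum_i \sum_j v 0 i * v 0 j * \sum_q dF i q x * dF j q x.
Proof.
transitivity (\sum_q \sum_i \sum_j v 0 i * v 0 j * (dF i q x * dF j q x)).
  apply: eq_bigr => q _; rewrite deriveE_coord expr2 mulr_suml; apply: eq_bigr => i _.
  by rewrite mulr_sumr; apply: eq_bigr => j _; rewrite mulrACA.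
rewrite exchange_big /=; apply: eq_bigr => i _; rewrite exchange_big /=.
by apply: eq_bigr => j _; rewrite mulr_sumr.
Qed.

(** On the ball the metric dominates k times the Euclidean one, so |D_y F|^2 <= (1 - k) |y|^2 with y
    = x - t. A positive defect then forces |y|^2 <= (1 - k^2) |y|^2 + s W. *)
Lemma spacelike_bound r : exists T : R, forall x t,
  `|x| <= r -> 0 < defect F x t -> `|t| <= T.
Proof.
pose K := [set x : E | `|0 - x| <= r].
have cK : compact K by exact: closed_ball_rV_compact.
pose g i j (x : E) := (i == j)%:R - \sum_q dF i q x * dF j q x.
have gE x (v : E) : \sum_i \sum_j v 0 i * v 0 j * g i j x = dot v v - \sum_q 'D_v (F q) x ^+ 2.
  rewrite sqr_derive_sum -sumrB; apply: eq_bigr => i _.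
  rewrite (eq_bigr (fun j => v 0 i * v 0 j * (i == j)%:R
     - v 0 i * v 0 j * \sum_q dF i q x * dF j q x)) => [|j _]; last exact: mulrBr.
  rewrite sumrB; congr (_ - _); rewrite (bigD1 i) //= big1 => [|j ji].
    by rewrite eqxx mulr1 addr0.
  by rewrite eq_sym (negPf ji) mulr0.
have [||k k0 Hk] := @posdef_lower_bound R E n K g cK.
- move=> i j x _; apply: continuousB; first exact: cst_continuous.
  apply: continuous_big_sum => q; apply: continuousM; apply: smooth_continuous; exact: smooth_derive.
- by move=> x v _ v0; rewrite gE subr_gt0; exact: F_contr.
pose w q x := 'D_x (F q) x - F q x.
have [W HW] : exists W, forall x, K x -> \sum_q w q x ^+ 2 <= W.
  have [K0|/set0P K0] := eqVneq K set0; first by exists 0 => x; rewrite K0.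
  have [|c _ cmax] := EVT_max_rV K0 cK (f := fun x => \sum_q w q x ^+ 2).
    apply: continuous_subspaceT => x.
    have cw q : {for x, continuous (w q)}.
      rewrite (_ : w q = fun x => \sum_i x 0 i * dF i q x - F q x).
        apply: continuousB; last exact: smooth_continuous.
        apply: continuous_big_sum => i; apply: continuousM; first exact/coord_continuous.
        by apply: smooth_continuous; exact: smooth_derive.
      by apply/funext => y; rewrite /w deriveE_coord.
    rewrite (_ : (fun _ => _) = fun x => \sum_q w q x * w q x).
      by apply: continuous_big_sum => q; apply: continuousM; exact: cw.
    by apply/funext => y; apply: eq_bigr => q _; rewrite expr2.
  by exists (\sum_q w q c ^+ 2) => x Kx; apply: cmax; exact: mem_set.
(* Chosen so that the other Young weight s / (s - 1) is 1 + k, and (1 + k) (1 - k) < 1. *)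
pose s := 1 + k^-1.
have s1 : 1 < s by rewrite /s ltrDl invr_gt0.
have sE : s / (s - 1) = 1 + k by rewrite /s; field; rewrite gt_eqF //=; lra.
exists (r + (1 + s * W / k ^+ 2)) => x t xr.
have Kx : K x by rewrite /K /= sub0r normrN.
pose y := x - t.
have xE : t = x - y by rewrite /y opprB addrC subrK.
rewrite {1}/defect -/y => d0.
have h1 : \sum_q ('D_t (F q) x - F q x) ^+ 2 <=
    (1 + k) * \sum_q 'D_y (F q) x ^+ 2 + s * \sum_q w q x ^+ 2.
  rewrite !mulr_sumr -big_split; apply: ler_sum => q _ /=.
  have -> : 'D_t (F q) x - F q x = - 'D_y (F q) x + w q x.
    have := smooth_deriveD y t x (F_smooth q); rewrite [y + t]subrK /w => ->.
    by move: ('D_y (F q) x) ('D_t (F q) x) => a b; ring.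
  by have := weighted_young (- 'D_y (F q) x) (w q x) s1; rewrite sE sqrrN.
have h2 := Hk x y Kx; rewrite gE in h2.
have h3 := HW x Kx.
have h4 : k ^+ 2 * dot y y <= s * W.
  by apply: (spacelike_bound_arith k0 s1 _ h1 h2 h3); rewrite -subr_gt0.
have h5 : `|y| ^+ 2 <= s * W / k ^+ 2.
  by apply: (le_trans (norm_le_dot y)); rewrite ler_pdivlMr ?exprn_gt0 // mulrC.
rewrite xE; apply: (le_trans (ler_normB _ _)); apply: lerD => //.
apply: (le_trans _ (_ : 1 + `|y| ^+ 2 <= _)); last by rewrite lerD2l.
exact: le_1_add_sqr.
Qed.

Hypothesis F_pde : forall x, exists2 b, graph_frame F x b &
  forall q, \sum_k 'D_(b k) ('D_(b k) (F q)) x = 2%:R^-1 * ('D_x (F q) x - F q x).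
Variable Cb : R.
Hypothesis F_bound : forall x t, defect F x t <= Cb.

(* Maximum principle for [defect - eta * ln (1 + height)], the logarithm being
   replaced by its tangent line at the maximum. *)
Lemma defect_le0 x1 t1 : defect F x1 t1 <= 0.
Proof.
rewrite leNgt; apply/negP => m0; set m := defect F x1 t1 in m0.
have [K K0 HK] := generator_bound F_smooth F_contr.
have [mu mu0 Hmu] := height_growth F_smooth F_contr.
have z0 := height_ge0 F_smooth F_contr.
have zp x : 0 < 1 + height F x by have := z0 x; lra.
pose L := ln (1 + height F x1).
have L0 : 0 <= L by rewrite ln_ge0 // lerDl.
(* Makes [eta] so small that the penalty [eta * L] at the given point and the error [eta * K] at the
   maximum together stay below [m]. *)
pose D := 2 * (K + L + 1).
have D0 : 0 < D by rewrite /D; lra.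
pose eta := m / D.
have eta0 : 0 < eta by rewrite divr_gt0.
have etaD : eta * D = m by rewrite /eta mulfVK ?gt_eqF.
have etaL0 := mulr_ge0 (ltW eta0) L0.
have etaK0 := mulr_gt0 eta0 K0.
have etaE : eta * K + eta * L < m by rewrite -etaD /D; lra.
pose Q (u : E * E) := defect F u.1 u.2 - eta * ln (1 + height F u.1).
have Q1 : 0 < Q (x1, t1) by rewrite /Q /= -/m -/L; lra.
(* Where [Q] is positive the penalty is below [Cb], which bounds the height by an exponential and
   hence the radius by [height_growth]; the 1 covers the unit ball. *)
pose r := 1 + expR (Cb / eta) / mu.
have Ce0 := expR_gt0 (Cb / eta).
have Qx x t : 0 < Q (x, t) -> `|x| <= r.
  rewrite /Q /= => Qxt.
  have h1 : ln (1 + height F x) <= Cb / eta.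
    by rewrite ler_pdivlMr //; have := F_bound x t; lra.
  have h2 : height F x <= expR (Cb / eta).
    have : 1 + height F x <= expR (Cb / eta) by move: h1; rewrite -ler_expR lnK ?posrE.
    lra.
  pose rho := Num.sqrt (dot x x).
  have rE : dot x x = rho ^+ 2 by rewrite sqr_sqrtr ?dot_ge0.
  have xr : `|x| <= rho by rewrite -(@ler_sqr _ `|x|) ?nnegrE ?sqrtr_ge0 // -rE norm_le_dot.
  apply: (le_trans xr); rewrite /r.
  have muV : 0 < expR (Cb / eta) / mu by rewrite divr_gt0.
  have [r1|r1] := ltP rho 1; first lra.
  have : rho <= expR (Cb / eta) / mu.
    by rewrite ler_pdivlMr // mulrC; apply: le_trans h2; exact: Hmu.
  lra.
have lnz0 x : 0 <= eta * ln (1 + height F x).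
  by rewrite mulr_ge0 ?ln_ge0 ?(ltW eta0) // lerDl.
have [T HT] := spacelike_bound r.
have Qt x t : 0 < Q (x, t) -> `|t| <= T.
  move=> H; apply: (HT x); first exact: Qx H.
  by move: H; rewrite /Q /=; have := lnz0 x; lra.
pose A := [set x : E | `|0 - x| <= r] `*` [set t : E | `|0 - t| <= T].
have QA u : 0 < Q u -> A u.
  case: u => x t H; split; rewrite /= sub0r normrN; first exact: Qx H.
  exact: Qt H.
have cQ : {within A, continuous Q}.
  apply: continuous_subspaceT => u.
  suff c : {for u, continuous (fun u : E * E => eta * ln (1 + height F u.1))}.
    exact: (continuousB (@defect_continuous u) c).
  apply: (@continuousM _ _ (fun=> eta)); first exact: cst_continuous.
  apply: (@continuous_comp _ _ _ fst (fun x => ln (1 + height F x))); first exact: cvg_fst.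
  apply: (@continuous_comp _ _ _ (fun x => 1 + height F x) (@ln R)).
    by apply: continuousD; [exact: cst_continuous|exact: height_continuous].
  exact: continuous_ln.
have A0 : A !=set0 by exists (x1, t1); exact: QA.
have cA : compact A by apply: compact_setX; exact: closed_ball_rV_compact.
have [[x t] _ umax'] := compact_EVT_max A0 cA cQ.
have umax x' t' : Q (x', t') <= Q (x, t).
  have [H|H] := ltP 0 (Q (x', t')); first by apply: umax'; exact/mem_set/QA.
  by apply: (le_trans H); apply: (le_trans (ltW Q1)); apply: umax'; exact/mem_set/QA.
(* The slope of the logarithmic penalty at the maximum. By concavity its tangent line lies above it,
   so the maximum persists for the penalty linear in the height. *)
pose e := eta / (1 + height F x).
have e0 : 0 <= e by rewrite divr_ge0 ?ltW.
have eE : e * (1 + height F x) = eta by rewrite /e mulfVK // gt_eqF.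
have dmax x' t' : defect F x' t' - e * height F x' <= defect F x t - e * height F x.
  have := umax x' t'; rewrite /Q /=.
  have : ln (1 + height F x') <= ln (1 + height F x) + (height F x' - height F x) / (1 + height F x).
    have -> : 1 + height F x' =
        (1 + height F x) * (1 + (height F x' - height F x) / (1 + height F x)).
      by field; rewrite gt_eqF.
    have H : -1 < (height F x' - height F x) / (1 + height F x).
      by rewrite ltr_pdivlMr //; have := z0 x'; lra.
    by rewrite lnM ?posrE //; [rewrite lerD2l; exact: le_ln1Dx|lra].
  move=> h1 h2.
  have h3 : eta * ln (1 + height F x') <=
      eta * ln (1 + height F x) + (e * height F x' - e * height F x).
    have -> : e * height F x' - e * height F x =
        eta * ((height F x' - height F x) / (1 + height F x)) by rewrite /e; ring.
    by rewrite -mulrDr ler_pM2l.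
  by move: h2 h3; clear; lra.
(* The defect at the maximum is at most [eta * K], whereas the value of [Q] at the given point is
   [m - eta * L], which is larger. *)
have := max_bound F_smooth F_contr F_pde dmax.
have : e * (2 * n%:R - dot x x + \sum_q (F q x - F q 0) * F q x) <= eta * K.
  by rewrite -eE -mulrA [(1 + _) * K]mulrC; apply: ler_wpM2l.
have := umax x1 t1; rewrite /Q /= -/m -/L.
have := lnz0 x; move: (e * _) (eta * ln _) (defect F x t) (eta * L) (eta * K) etaE.
by clear => a b c d f; lra.
Qed.

End Nonpositivity.

(* Euler's theorem: along a ray, [r phi' = phi] forces [r phi'' = 0]. *)
Lemma homogeneous_linear (R : realType) n (f : 'rV[R]_n -> R) : smooth f ->
  (forall x, 'D_x f x = f x) -> forall x, f x = 'D_x f 0.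
Proof.
move=> sf hf x; pose f1 (r : R) := 'D_x f (r *: x); pose f2 (r : R) := 'D_x ('D_x f) (r *: x).
have line g r : smooth g -> is_derive r (1 : R) (fun r : R => g (r *: x)) ('D_x g (r *: x)).
  move=> sg; have := smooth_line 0 x r sg; rewrite add0r.
  by rewrite (_ : (fun t : R => g (0 + t *: x)) = fun t => g (t *: x)) //; apply/funext => t; rewrite add0r.
have d1 r : is_derive r (1 : R) f1 (f2 r) by exact: line (smooth_derive x sf).
have d0 r : is_derive r (1 : R) (fun r : R => r * f1 r) (f1 r).
  rewrite (_ : (fun r : R => r * f1 r) = fun r => f (r *: x)); first exact: line.
  by apply/funext => t; rewrite /f1 -smooth_deriveZ // hf.
have f20 r : r * f2 r = 0.
  have [_] := isdM (isd_id r) (d1 r); have [_ ->] := d0 r.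
  by rewrite mul1r -[LHS]addr0 => /addrI.
have [|c] := @MVT R f1 f2 0 1 ltr01 (fun r _ => d1 r).
  by apply: derivable_within_continuous => r _; have [] := d1 r.
rewrite in_itv /= => /andP[c0 _] E.
have c2 : f2 c = 0 by have /eqP := f20 c; rewrite mulf_eq0 gt_eqF //= => /eqP.
by move: E; rewrite c2 mul0r /f1 scale1r scale0r => /eqP; rewrite subr_eq0 hf => /eqP.
Qed.

(** * The graph is a plane *)

Theorem theorem1p4 (R : realType) (n p : nat) (M : smooth_manifold R n)
    (X : M -> 'rV[R]_(n + p)) (x0 : M) (C eps rho0 C0 : R)
    (M_connected : connected [set: M])
    (X_immersion : immersion X)
    (X_spacelike : spacelike X)
    (X_complete : complete_submanifold X)
    (X_self_shrinker : self_shrinker X)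
    (X_normal_bound : forall x : M, normal_position_sqnorm X x < 2 * p%:R)
    (C_gt0 : 0 < C) (eps_gt0 : 0 < eps) (rho0_gt0 : 0 < rho0)
    (C0_def : C0 = Num.sqrt (2 * p%:R) * C)
    (A_decay : forall x : M, 0 < distance X x0 x ->
       sff_norm X x <= C / distance X x0 x `^ (1 + eps))
    (rho0_large : (C0 / eps) `^ eps^-1 <= rho0) :
  spacelike_hyperplane X.
Proof.
have [s [Ss sF]] := global_section M_connected X_immersion X_spacelike X_complete x0.
pose u := graph_fun X s; pose F q v := u v 0 q.
have F_smooth q : smooth (F q) by move=> k; exact: graph_fun_Ck.
have du v b : derivable u v b by exact: graph_fun_derivable.
have d2u v b a : derivable ('D_b u) v a by exact: derive_graph_fun_derivable.
have dF v b q : 'D_b (F q) v = 'D_b u v 0 q by exact: derive_coord.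
have d2F v a b q : 'D_a ('D_b (F q)) v = 'D_a ('D_b u) v 0 q.
  by rewrite -(derive_coord q (d2u v b a)); congr ('D_a _ v); apply/funext => y; exact: dF.
have dotF v a b : dot ('D_a u v) ('D_b u v) = \sum_q 'D_a (F q) v * 'D_b (F q) v.
  by apply: eq_bigr => q _; rewrite !dF.
have F_contr v b : b != 0 -> \sum_q 'D_b (F q) v ^+ 2 < dot b b.
  by move=> b0; under eq_bigr do rewrite expr2; rewrite -dotF; exact: graph_fun_contraction.
have F_pde v : exists2 b, graph_frame F v b &
    forall q, \sum_k 'D_(b k) ('D_(b k) (F q)) v = 2%:R^-1 * ('D_v (F q) v - F q v).
  have [b [ob Eb]] := graph_shrinker X_immersion X_spacelike Ss sF v X_self_shrinker.
  exists b => [k l|q]; first by rewrite -dotF; exact: ob.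
  transitivity ((\sum_k 'D_(b k) ('D_(b k) u) v) 0 q).
    by rewrite summxE; apply: eq_bigr => k _; rewrite d2F.
  by rewrite Eb mxE mxE [X in _ + X]mxE dF.
have F_bound v t : defect F v t <= 2 * p%:R.
  have -> : defect F v t =
      dot ('D_t u v - u v) ('D_t u v - u v) - dot (v - t) (v - t).
    congr (_ - _); apply: eq_bigr => q _.
    have -> : ('D_t u v - u v) 0 q = 'D_t (F q) v - F q v by rewrite mxE [X in _ + X]mxE dF.
    exact: expr2.
  apply: le_trans (ltW (X_normal_bound (s v))).
  exact (graph_normal_bound X_immersion X_spacelike Ss v t).
have F_homog q v : 'D_v (F q) v = F q v.
  have := defect_le0 F_smooth F_contr F_pde F_bound v v.
  rewrite /defect subrr dot0l subr0 => h.
  have /eqP := le_anti (introT andP (conj h (sumr_ge0 _ (fun q _ => sqr_ge0 ('D_v (F q) v - F q v))))).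
  rewrite psumr_eq0 => [|i _]; last exact: sqr_ge0.
  by move=> /allP /(_ q (mem_index_enum q)) /=; rewrite sqrf_eq0 subr_eq0 => /eqP.
have uE v : u v = 'D_v u 0.
  by apply/rowP => q; rewrite -dF -(homogeneous_linear (F_smooth q)).
pose J : 'M[R]_(n, p) := \matrix_(i, q) 'D_(delta_mx 0 i) (F q) 0.
have uJ v : u v = v *m J.
  apply/rowP => q; rewrite uE -dF derive_sum_coord; last exact: (Ck_differentiable (F_smooth q 1) I).
  by rewrite mxE; apply: eq_bigr => i _; rewrite [in RHS]mxE.
pose g : 'Hom('rV[R]_n, 'rV[R]_(n + p)) := linfun (mulmxr (row_mx 1%:M J)).
have gE v : g v = row_mx v (u v) by rewrite lfunE /= mul_mx_row mulmx1 uJ.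
(* The graph of a linear map passes through the origin, so the plane is a linear subspace. *)
exists 0, (limg g); split.
- rewrite limg_dim_eq; first by rewrite dimvf dim_matrix; exact: mul1n.
  apply/eqP; rewrite -subv0; apply/subvP => v; rewrite memv_cap memvf memv_ker gE /= memv0.
  by move=> /eqP /(congr1 lsubmx); rewrite row_mxKl linear0 => ->.
- move=> w /memv_imgP [v _ ->]; rewrite gE => v0.
  have {}v0 : v != 0.
    apply: contra_neq v0 => ->; rewrite uJ mul0mx; exact: row_mx0.
  by rewrite innerE row_mxKl row_mxKr subr_gt0 uE; exact: graph_fun_contraction.
- rewrite (graph_range Ss sF); apply/seteqP; split => w /= [v].
    by move=> _ <-; exists (g v); [exact: memv_img (memvf v)|rewrite add0r gE].
  by move=> /memv_imgP [y _ ->] <-; exists y => //; rewrite add0r gE.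
Qed.
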